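(* Let $k$ be a perfect field containing $\mathbb{F}$, $E=k(\!(\varpi)\!)$, $\mathcal{O}_E=k[\![\varpi]\!]$, $\kappa:A\to\mathcal{O}_E$ an $\mathbb{F}$-algebra morphism, and $\ell$ a maximal ideal of $A$ with $\kappa(\ell)\mathcal{O}_E=\mathcal{O}_E$. Let $\underline{M}=(M,\tau_M)$ be an $A$-motive over $E$ with maximal $\mathcal{O}_E$-integral model $M_{\mathcal{O}}$, and for $n\ge1$ let $L_n$ be the maximal integral model of the Frobenius space $(M/\ell^nM,\tau_M)$. Then for $m\in M$: $m\in M_{\mathcal{O}}$ if and only if $m+\ell^nM\in L_n$ for all sufficiently large positive integers $n$.
   Context: $\mathbb{F}$ finite with $q$ elements; $A=\Gamma(C\setminus\{\infty\},\mathcal{O}_C)$ for a geometrically irreducible smooth projective curve $C/\mathbb{F}$ and closed point $\infty$; tensor products over $\mathbb{F}$. $\tau(a\otimes x)=a\otimes x^q$; $\mathfrak{j}$ is generated by the $a\otimes1-1\otimes\kappa(a)$; $L[\mathfrak{j}^{-1}]$ is the union of the $\mathfrak{j}^{-n}L$ (elements $m$ with $(a\otimes1-1\otimes\kappa(a))^nm\in L$ for all $a\in A\setminus\mathbb{F}$). An $A$-motive over $E$ is $(M,\tau_M)$ with $M$ locally free of finite constant rank over $A\otimes E$ and $\tau_M:(\tau^*M)[\mathfrak{j}^{-1}]\xrightarrow{\sim}M[\mathfrak{j}^{-1}]$. $M_{\mathcal{O}}$ is the unique maximal finitely generated $A\otimes\mathcal{O}_E$-submodule of $M$ generating $M$ over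 $A\otimes E$ with $\tau_M(\tau^*M_{\mathcal{O}})\subset M_{\mathcal{O}}[\mathfrak{j}^{-1}]$. Since $\ell^n$ and $\mathfrak{j}$ are coprime in $A\otimes E$, $M/\ell^nM\cong M[\mathfrak{j}^{-1}]/\ell^nM[\mathfrak{j}^{-1}]$, so $\tau_M$ induces an $E$-linear isomorphism $\tau^*(M/\ell^nM)\to M/\ell^nM$ on the finite-dimensional $E$-vector space $M/\ell^nM$; this pair is a Frobenius space. For a Frobenius space $(V,\varphi)$ (finite-dimensional $E$-space $V$, $E$-linear isomorphism $\varphi:\sigma^*V\to V$, $\sigma$ the $q$-Frobenius), its maximal integral model is the unique largest $\mathcal{O}_E$-lattice $L\subset V$ (finitely generated, spanning $V$) with $\varphi(\sigma^*L)\subset L$. *)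

(* Defs.v *)
From HB Require Import structures.
From mathcomp Require Import all_boot all_order all_algebra all_field.
From mathcomp Require Import boolp classical_sets functions.

Set Implicit Arguments.
Unset Strict Implicit.
Unset Printing Implicit Defensive.

Import GRing.Theory.
Local Open Scope ring_scope.
Local Open Scope classical_set_scope.

(******************************************************************************)
(*                          Submodules and base change                        *)
(******************************************************************************)

(* Finite linear combinations of elements of X with coefficients in B; when B
   is a subring of R this is the B-submodule generated by X. *)
Definition span_over (R : nzRingType) (M : lmodType R)
    (B : set R) (X : set M) : set M :=
  [set m | exists (n : nat) (c : 'I_n -> R) (x : 'I_n -> M),
     [/\ forall i, B (c i), forall i, X (x i) & m = \sum_i c i *: x i]].

Definition semilinear_for (R S : nzRingType) (f : R -> S)
    (M : lmodType R) (N : lmodType S) (g : M -> N) : Prop :=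
  (forall x y, g (x + y) = g x + g y) /\
  (forall r x, g (r *: x) = f r *: g x).

(* eta : M -> N is the base change f^*M = S (x)_{R,f} M, eta m = 1 (x) m, of M
   along the ring morphism f (universal property). *)
Definition is_base_change (R S : nzRingType) (f : R -> S)
    (M : lmodType R) (N : lmodType S) (eta : M -> N) : Prop :=
  semilinear_for f eta /\
  forall (P : lmodType S) (g : M -> P), semilinear_for f g ->
    exists2 h : {linear N -> P}, (forall m, h (eta m) = g m)
      & forall h' : {linear N -> P}, (forall m, h' (eta m) = g m) -> h' =1 h.

Definition regular_elt (R : nzRingType) (s : R) : Prop :=
  forall x, s * x = 0 -> x = 0.

(* iota : M -> V is the localization of M at the non-zero-divisors of R, i.e.
   V = M (x)_R Frac R when R is a domain. *)
Definition is_frac_module (R : comNzRingType) (M V : lmodType R)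
    (iota : {linear M -> V}) : Prop :=
  [/\ forall s : R, regular_elt s -> bijective (fun v : V => s *: v),
      forall v, exists s : R, regular_elt s /\ exists m, s *: v = iota m
    & forall m, iota m = 0 -> exists2 s : R, regular_elt s & s *: m = 0].

(* The images of e_1, ..., e_r form a basis of M[1/f] over R[1/f]. *)
Definition loc_basis (R : comNzRingType) (M : lmodType R) (f : R)
    (r : nat) (e : 'I_r -> M) : Prop :=
  (forall m, exists N (c : 'I_r -> R), f ^+ N *: m = \sum_i c i *: e i) /\
  (forall c : 'I_r -> R, \sum_i c i *: e i = 0 ->
     exists N, forall i, f ^+ N * c i = 0).

(* Zariski-locally on Spec R, M is free of rank r. *)
Definition locally_free_rank (R : comNzRingType) (M : lmodType R)
    (r : nat) : Prop :=
  exists (n : nat) (f : 'I_n -> R),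
    (exists c : 'I_n -> R, \sum_i c i * f i = 1) /\
    (forall i, exists e : 'I_r -> M, loc_basis (f i) e).

Definition is_ideal (R : comNzRingType) (I : set R) : Prop :=
  [/\ I 0, forall x y, I x -> I y -> I (x + y)
    & forall r x, I x -> I (r * x)].

Definition is_maximal_ideal (R : comNzRingType) (I : set R) : Prop :=
  [/\ is_ideal I, I <> setT
    & forall J, is_ideal J -> I `<=` J -> J = I \/ J = setT].

Fixpoint ideal_pow (R : comNzRingType) (I : set R) (n : nat) : set R :=
  if n is n'.+1 then
    span_over (M := R^o) setT
      [set z | exists x y, [/\ I x, ideal_pow I n' y & z = x * y]]
  else setT.

(******************************************************************************)
(*                   Formal power series and Laurent series                   *)
(******************************************************************************)

Record pseries (k : fieldType) := PSeries { pscoef : nat -> k }.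

Section PowerSeries.
Variable k : fieldType.
Implicit Types f g h : pseries k.

HB.instance Definition _ := gen_eqMixin (pseries k).
HB.instance Definition _ := gen_choiceMixin (pseries k).

Lemma pseriesP f g : pscoef f =1 pscoef g -> f = g.
Proof. by case: f g => [f] [g] /= /funext ->. Qed.

Definition psC (c : k) := PSeries (fun n => if n == 0%N then c else 0).
Definition psadd f g := PSeries (fun n => pscoef f n + pscoef g n).
Definition psopp f := PSeries (fun n => - pscoef f n).
Definition psmul f g :=
  PSeries (fun n => \sum_(i < n.+1) pscoef f i * pscoef g (n - i)).

Fact psaddA : associative psadd.
Proof. by move=> f g h; apply: pseriesP => n /=; rewrite addrA. Qed.
Fact psaddC : commutative psadd.
Proof. by move=> f g; apply: pseriesP => n /=; rewrite addrC. Qed.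
Fact psadd0 : left_id (psC 0) psadd.
Proof. by move=> f; apply: pseriesP => n /=; rewrite if_same add0r. Qed.
Fact psaddN : left_inverse (psC 0) psopp psadd.
Proof. by move=> f; apply: pseriesP => n /=; rewrite if_same addNr. Qed.

HB.instance Definition _ :=
  GRing.isZmodule.Build (pseries k) psaddA psaddC psadd0 psaddN.

Let trunc N f : {poly k} := \poly_(i < N) pscoef f i.

Let psmul_trunc N f g n : (n < N)%N ->
  pscoef (psmul f g) n = (trunc N f * trunc N g)`_n.
Proof.
move=> nN; rewrite coefM /=; apply: eq_bigr => i _.
have iN : (i < N)%N by apply: leq_trans nN; case: i.
by rewrite !coef_poly iN (leq_ltn_trans (leq_subr _ _) nN).
Qed.

Fact psmulC : commutative psmul.
Proof.
move=> f g; apply: pseriesP => n.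
by rewrite !(@psmul_trunc n.+1) // mulrC.
Qed.

Let coefM_trunc N (p p' r : {poly k}) n : (n < N)%N ->
  (forall i, (i < N)%N -> p`_i = p'`_i) -> (p * r)`_n = (p' * r)`_n.
Proof.
move=> nN pp'; rewrite !coefM; apply: eq_bigr => i _.
by rewrite pp' //; apply: leq_trans nN; case: i.
Qed.

Fact psmulA : associative psmul.
Proof.
suff H f g h n : pscoef (psmul (psmul f g) h) n =
    (trunc n.+1 f * trunc n.+1 g * trunc n.+1 h)`_n.
  move=> f g h; apply: pseriesP => n.
  by rewrite (psmulC f) !H mulrC mulrA.
rewrite (@psmul_trunc n.+1) //; apply: (@coefM_trunc n.+1) => // i iN.
by rewrite coef_poly iN (@psmul_trunc n.+1).
Qed.

Fact psmul1 : left_id (psC 1) psmul.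
Proof.
move=> f; apply: pseriesP => n /=.
rewrite big_ord_recl /= mul1r subn0 big1 ?addr0 // => i _.
by rewrite mul0r.
Qed.

Fact psmulDl : left_distributive psmul psadd.
Proof.
move=> f g h; apply: pseriesP => n /=.
by rewrite -big_split; apply: eq_bigr => i _; rewrite /= mulrDl.
Qed.

Fact ps1_neq0 : psC 1 != 0 :> pseries k.
Proof.
apply/eqP => /(congr1 (fun f => pscoef f 0)) /= /eqP.
by rewrite (oner_eq0 k).
Qed.

HB.instance Definition _ := GRing.Zmodule_isComNzRing.Build (pseries k)
  psmulA psmulC psmul1 psmulDl ps1_neq0.

Definition psunit f : bool := `[< exists g, g * f = 1 >].
Definition psinv f : pseries k :=
  if pselect (exists g, g * f = 1) is left ex then projT1 (cid ex) else f.

Fact psmulVx : {in psunit, left_inverse 1 psinv *%R}.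
Proof.
move=> f /asboolP uf; rewrite /psinv.
by case: pselect => // ex; case: cid.
Qed.
Fact psunitP f g : g * f = 1 -> psunit f.
Proof. by move=> gf; apply/asboolP; exists g. Qed.
Fact psinv_out : {in [predC psunit], psinv =1 id}.
Proof.
move=> f /negP nuf; rewrite /psinv; case: pselect => // ex.
by case: nuf; apply/asboolP.
Qed.

HB.instance Definition _ := GRing.ComNzRing_hasMulInverse.Build (pseries k)
  psmulVx psunitP psinv_out.

Let low f : f != 0 ->
  exists n, pscoef f n != 0 /\ forall i, (i < n)%N -> pscoef f i = 0.
Proof.
move=> nzf; have ex : exists n, pscoef f n != 0.
  apply: contrapT => nex; case/eqP: nzf; apply: pseriesP => n /=.
  rewrite if_same; apply/eqP; apply: contrapT => /negP fn.
  by apply: nex; exists n.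
case: (ex_minnP ex) => n fn min; exists n; split=> // i ltin.
by apply/eqP; apply: contraLR ltin => /min; rewrite -leqNgt.
Qed.

Fact psmul_eq0 f g : f * g = 0 -> (f == 0) || (g == 0).
Proof.
move=> fg; apply: contrapT => /negP; rewrite negb_or => /andP[nf ng].
have [m [fm lm]] := low nf; have [n [gn ln]] := low ng.
have := congr1 (fun h => pscoef h (m + n)) fg.
rewrite /= if_same.
have ltm : (m < (m + n).+1)%N by rewrite ltnS leq_addr.
rewrite (bigD1 (Ordinal ltm)) //= addKn big1 ?addr0 => [/eqP|i nei].
  by rewrite mulf_eq0 (negPf fm) (negPf gn).
case: (ltngtP i m) => [/lm -> | ltmi | /eqP eim]; first by rewrite mul0r.
  rewrite ln ?mulr0 // ltn_subLR ?ltn_add2r //.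
  by rewrite -ltnS.
by case/negP: nei; rewrite -val_eqE.
Qed.

HB.instance Definition _ :=
  GRing.ComUnitRing_isIntegral.Build (pseries k) psmul_eq0.

End PowerSeries.

Local Notation "x %:F" := (@FracField.tofrac _ x).

(* k((t)) as the field of fractions of k[[t]]. *)
Definition laurent (k : fieldType) : fieldType := {fraction (pseries k)}.

Definition laurent_int (k : fieldType) : set (laurent k) :=
  range (fun f : pseries k => f%:F : laurent k).

Definition perfect_field (k : fieldType) : Prop :=
  forall p : nat, p \in [pchar k] -> forall x : k, exists y : k, y ^+ p = x.

(******************************************************************************)
(*             Curves over a finite field and their affine rings              *)
(******************************************************************************)

(* The local rings of the closed points of the smooth projective curve with
   function field K / F are the valuation rings F < O < K; a closed point is
   encoded by its local ring. *)
Definition is_closed_point (F K : fieldType) (i : F -> K) (O : set K) : Prop :=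
  [/\ forall c, O (i c),
      forall x y, O x -> O y -> O (x - y),
      forall x y, O x -> O y -> O (x * y),
      O <> setT
    & forall x, O x \/ O x^-1].

Definition ratfuns (F K : fieldType) (i : {rmorphism F -> K}) (x : K) : set K :=
  [set y | exists p r : {poly F}, (map_poly i r).[x] != 0 /\
     y = (map_poly i p).[x] / (map_poly i r).[x]].

(* A smooth projective geometrically irreducible curve C over the finite
   (hence perfect) field F, given by its function field K, together with a
   closed point oo.  Geometric irreducibility of C amounts to F being
   algebraically closed in K. *)
Record pointed_curve (F : finFieldType) := PointedCurve {
  function_field : fieldType;
  curve_const : {rmorphism F -> function_field};
  curve_dim1 : exists x : function_field,
    ~ algebraicOver curve_const x /\
    exists s : seq function_field,
      span_over (M := function_field^o) (ratfuns curve_const x) [set` s] = setT;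
  curve_geom_irr : forall y : function_field,
    algebraicOver curve_const y -> exists c, y = curve_const c;
  curve_infty : set function_field;
  curve_inftyP : is_closed_point curve_const curve_infty
}.

Section CoordinateRing.
Variables (F : finFieldType) (C : pointed_curve F).
Let K := function_field C.

(* Regular at every closed point other than oo. *)
Definition regular_away : {pred K} := fun x =>
  `[< forall O : set K, is_closed_point (@curve_const F C) O ->
        O <> @curve_infty F C -> O x >].

Fact regular_away_subring : subring_closed regular_away.
Proof.
split.
- apply/asboolP => O [cO _ _ _ _] _.
  by rewrite -(rmorph1 (@curve_const F C)); apply: cO.
- move=> x y /asboolP hx /asboolP hy; apply/asboolP => O pO nO.
  by have [_ sO _ _ _] := pO; apply: sO; [apply: hx | apply: hy].
- move=> x y /asboolP hx /asboolP hy; apply/asboolP => O pO nO.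
  by have [_ _ mO _ _] := pO; apply: mO; [apply: hx | apply: hy].
Qed.

HB.instance Definition _ :=
  GRing.isSubringClosed.Build K regular_away regular_away_subring.

(* A = Gamma(C \ {oo}, O_C). *)
Record coord_ring :=
  CoordRing { coord_val : K; coord_valP : coord_val \in regular_away }.

HB.instance Definition _ := [isSub for coord_val].
HB.instance Definition _ := [Choice of coord_ring by <:].
HB.instance Definition _ := [SubChoice_isSubComNzRing of coord_ring by <:].

Fact coord_const_subproof (c : F) : @curve_const F C c \in regular_away.
Proof. by apply/asboolP => O [cO _ _ _ _] _; apply: cO. Qed.

Definition coord_const (c : F) : coord_ring :=
  CoordRing (coord_const_subproof c).

End CoordinateRing.

(******************************************************************************)
(*                       Tensor products of F-algebras                        *)
(******************************************************************************)

(* The F-algebra A (x)_F E of two commutative F-algebras with structure maps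
   fA and fE: as an F-module it is characterized by the universal property of
   the F-balanced biadditive map (a, x) |-> a (x) x = inl a * inr x. *)
Record tensor_algebra (F A E : comNzRingType) (fA : F -> A) (fE : F -> E) :=
  TensorAlgebra {
  tens_ring :> comNzRingType;
  tens_inl : {rmorphism A -> tens_ring};
  tens_inr : {rmorphism E -> tens_ring};
  tens_const : forall c, tens_inl (fA c) = tens_inr (fE c);
  tens_univ : forall (W : zmodType) (b : A -> E -> W),
    (forall a a' x, b (a + a') x = b a x + b a' x) ->
    (forall a x x', b a (x + x') = b a x + b a x') ->
    (forall c a x, b (fA c * a) x = b a (fE c * x)) ->
    exists2 h : {additive tens_ring -> W},
      (forall a x, h (tens_inl a * tens_inr x) = b a x)
      & forall h' : {additive tens_ring -> W},
          (forall a x, h' (tens_inl a * tens_inr x) = b a x) -> h' =1 h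
}.

Arguments tens_inl {F A E fA fE} t.
Arguments tens_inr {F A E fA fE} t.

(******************************************************************************)
(*                              Frobenius spaces                              *)
(******************************************************************************)

(* Here E = k((t)) and sigma x = x ^ q; frob_tw is a model of sigma^* V. *)
Record frob_space (k : fieldType) (q : nat) := FrobSpace {
  frob_sp :> vectType (laurent k);
  frob_tw : lmodType (laurent k);
  frob_eta : frob_sp -> frob_tw;
  frob_etaP : is_base_change (fun x : laurent k => x ^+ q) frob_eta;
  frob_phi : {linear frob_tw -> frob_sp};
  frob_phi_iso : bijective frob_phi
}.

(* O_E-lattices L of V with phi (sigma^* L) in L, where sigma^* L is identified
   with the O_E-span of its generators in sigma^* V. *)
Definition is_frob_integral_model (k : fieldType) (q : nat)
    (V : frob_space k q) (L : set V) : Prop :=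
  [/\ exists s : seq V, L = span_over (@laurent_int k) [set` s],
      span_over setT L = setT
    & forall y, span_over (@laurent_int k) (@frob_eta k q V @` L) y ->
        L (@frob_phi k q V y)].

Definition is_max_frob_integral_model (k : fieldType) (q : nat)
    (V : frob_space k q) (L : set V) : Prop :=
  is_frob_integral_model L /\
  forall L', is_frob_integral_model L' -> L' `<=` L.

(******************************************************************************)
(*                                 A-motives                                  *)
(******************************************************************************)

Section Motives.
Variables (F : finFieldType) (C : pointed_curve F) (k : fieldType).
Variable i : {rmorphism F -> k}.

Let A : comNzRingType := coord_ring C.
Let E : fieldType := laurent k.

Definition laurent_const (c : F) : E := (psC (i c))%:F.

Variable AE : tensor_algebra (@coord_const F C) laurent_const.

Definition tens (a : A) (x : E) : AE := tens_inl AE a * tens_inr AE x.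

Definition is_tau (tau : AE -> AE) : Prop :=
  forall a x, tau (tens a x) = tens a (x ^+ #|F|).

(* A (x) O_E inside A (x) E. *)
Definition tens_int : set AE :=
  [set r | exists (n : nat) (a : 'I_n -> A) (x : 'I_n -> E),
     (forall j, laurent_int (x j)) /\ r = \sum_j tens (a j) (x j)].

Variable kappa : {rmorphism A -> pseries k}.

Definition jgen (a : A) : AE := tens a 1 - tens 1 ((kappa a)%:F : E).

(* L[j^-1] = union of the j^-n L, inside the fraction module V of N, for
   L a subset of N. *)
Definition jinv (N V : lmodType AE) (iota : N -> V) (L : set N) : set V :=
  [set v | exists n : nat, forall a : A,
     ~ (exists c : F, a = coord_const C c) ->
     exists2 m, L m & jgen a ^+ n *: v = iota m].

Variable tau : {rmorphism AE -> AE}.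

(* mot_tw is a model of tau^* M; mot_frac and mot_twfrac are the fraction
   modules in which M[j^-1] and (tau^* M)[j^-1] live.  Only the restriction
   of mot_tau to (tau^* M)[j^-1] is meaningful. *)
Record Amotive := AMotive {
  mot :> lmodType AE;
  mot_loc_free : exists r, locally_free_rank mot r;
  mot_tw : lmodType AE;
  mot_eta : mot -> mot_tw;
  mot_etaP : is_base_change tau mot_eta;
  mot_frac : lmodType AE;
  mot_iota : {linear mot -> mot_frac};
  mot_iotaP : is_frac_module mot_iota;
  mot_twfrac : lmodType AE;
  mot_twiota : {linear mot_tw -> mot_twfrac};
  mot_twiotaP : is_frac_module mot_twiota;
  mot_tau : mot_twfrac -> mot_frac;
  mot_tau_linear : forall (r : AE) (x y : mot_twfrac),
    jinv mot_twiota setT x -> jinv mot_twiota setT y ->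
    mot_tau (r *: x + y) = r *: mot_tau x + mot_tau y;
  mot_tau_iso : set_bij (jinv mot_twiota setT) (jinv mot_iota setT) mot_tau
}.

(* Finitely generated A (x) O_E-submodules L of M generating M over A (x) E
   with tau_M (tau^* L) in L[j^-1]. *)
Definition is_integral_model (M : Amotive) (L : set M) : Prop :=
  [/\ exists s : seq M, L = span_over tens_int [set` s],
      span_over setT L = setT
    & forall y, span_over tens_int (@mot_eta M @` L) y ->
        jinv (@mot_iota M) L (mot_tau (@mot_twiota M y))].

Definition is_max_integral_model (M : Amotive) (L : set M) : Prop :=
  is_integral_model L /\
  forall L', is_integral_model L' -> L `<=` L' -> L' = L.

(* l^n N for an A (x) E-submodule N of V. *)
Definition lpow_mul (l : set A) (n : nat) (V : lmodType AE) (N : set V)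
    : set V :=
  span_over setT
    [set v | exists c x, [/\ ideal_pow l n c, N x & v = tens c 1 *: x]].

(* D, with the projection pr : M -> D, is the Frobenius space M / l^n M: its
   structure map sends sigma^*(m mod l^n M) to m' mod l^n M whenever
   tau_M (tau^* m) = m' in M[j^-1] / l^n M[j^-1] = M / l^n M. *)
Definition is_frob_quotient (M : Amotive) (l : set A) (n : nat)
    (D : frob_space k #|F|) (pr : M -> D) : Prop :=
  [/\ forall m m', pr (m + m') = pr m + pr m',
      forall (x : E) m, pr (tens 1 x *: m) = x *: pr m,
      forall v, exists m, pr m = v,
      forall m, pr m = 0 <-> lpow_mul l n setT m
    & forall m m',
        lpow_mul l n (jinv (@mot_iota M) setT)
          (mot_tau (@mot_twiota M (@mot_eta M m)) - @mot_iota M m') ->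
        @frob_phi k #|F| D (@frob_eta k #|F| D (pr m)) = pr m'].

End Motives.

(* Main.v *)
Require Import Defs.
From HB Require Import structures.
From mathcomp Require Import all_boot all_order all_algebra all_field.
From mathcomp Require Import boolp classical_sets functions.
From mathcomp Require Import ring.
From mathcomp Require abelian.
Set Implicit Arguments.
Unset Strict Implicit.
Unset Printing Implicit Defensive.
Import GRing.Theory.
Local Open Scope ring_scope.
Local Open Scope classical_set_scope.

(* Some a in l is nonconstant with kappa(a) a unit, so jgen a is invertible
   modulo l^n in A (x) O_E.  Hence tau_M acts on M / l^n M, the image N_n of
   M_O is an integral model of it, and N_n <= L_n.

   Conversely let M' be the set of m whose class lies in L_n for n >> 0.
   Since tau_M is surjective on M[1/j], t^c N_n lies in the O_E-span of
   phi(sigma^* N_n) with c independent of n; as phi raises denominators t^-d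
   to t^-qd, this forces t^c L_n <= N_n, so t^c M' lies in the intersection of
   the M_O + l^n M.  A linear form M -> A (x) E maps that intersection, up to a
   power of t, into the intersection of the A (x) O_E + l^n (A (x) E), which is
   A (x) O_E because the powers of l meet in 0.  Embedding M in a free module
   puts M' inside a finitely generated module over A (x) O_E; this ring is
   noetherian, so M' is an integral model containing M_O, and M' = M_O by
   maximality.

   A is a finite module over F[a] because its filtration by pole order
   at infinity has graded pieces of bounded dimension and starts with F: a
   nonconstant function has a pole somewhere, by Chevalley's extension theorem.
   That theorem also gives a valuation ring O above l; an element y <> 0 of all
   l^n would make O / y O infinite dimensional. *)

(** * Finite extensions of rational function fields *)

(** Two points shape the proof. L_n is only an O_E-lattice, while M' has to be a module over A (x)
    O_E. For b in A the lattice L_n + b L_n is again Frobenius-stable, since tau fixes b (x) 1, so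
    maximality puts it inside L_n. Secondly, membership in M' concerns all large n at once, so
    bounds must not depend on n. The constant c is therefore found on M itself, from preimages under
    tau_M of the finitely many generators of M_O; reduction modulo l^n comes afterwards and removes
    the powers of j. Likewise, for tau_M (tau^* M') in M'[j^-1], the exponent of j is read off in
    M[j^-1] before n is chosen. The objects A (x) E and tau^* M are given by universal properties
    only; that they are generated by the evident elements is deduced from the uniqueness of the
    induced maps. *)

Section SpanOver.
Variables (R : nzRingType) (M : lmodType R) (B : set R).
Implicit Types X Y : set M.

Lemma span_over_ind X (P : set M) :
  P 0 -> (forall x y, P x -> P y -> P (x + y)) ->
  (forall c x, B c -> X x -> P (c *: x)) -> span_over B X `<=` P.
Proof.
move=> P0 PD PZ m [n [c [x [Bc Xx ->]]]].
by apply: (big_ind P) => // i _; apply: PZ.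
Qed.

Lemma span_over0 X : span_over B X 0.
Proof.
by exists 0%N, (fun=> 0), (fun=> 0); split=> [[]|[]|] //; rewrite big_ord0.
Qed.

Lemma span_overD X x y :
  span_over B X x -> span_over B X y -> span_over B X (x + y).
Proof.
move=> [n [c [u [Bc Xu ->]]]] [n' [c' [u' [Bc' Xu' ->]]]].
exists (n + n')%N,
  (fun i : 'I_(n + n') => match fintype.split i with inl j => c j | inr j =>
    c' j end),
  (fun i : 'I_(n + n') => match fintype.split i with inl j => u j | inr j =>
    u' j end); split.
- by move=> i; case: (fintype.split i).
- by move=> i; case: (fintype.split i).
rewrite big_split_ord /=; congr (_ + _); apply: eq_bigr => i _.
  by rewrite (unsplitK (inl i)).
by rewrite (unsplitK (inr i)).
Qed.

Lemma span_over_gen X c x : B c -> X x -> span_over B X (c *: x).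
Proof.
move=> Bc Xx; exists 1%N, (fun=> c), (fun=> x); split=> //.
by rewrite big_ord1.
Qed.

Lemma span_over_incl X : B 1 -> X `<=` span_over B X.
Proof. by move=> B1 x Xx; rewrite -[x]scale1r; apply: span_over_gen. Qed.

Lemma span_over_sum X (I : Type) (r : seq I) (P : pred I) (G : I -> M) :
  (forall i, P i -> span_over B X (G i)) ->
  span_over B X (\sum_(i <- r | P i) G i).
Proof.
by apply: (big_ind (span_over B X)); [apply: span_over0 | apply: span_overD].
Qed.

Lemma span_overZ X b x : (forall c d, B c -> B d -> B (c * d)) ->
  B b -> span_over B X x -> span_over B X (b *: x).
Proof.
move=> BM Bb; move: x; apply: (@span_over_ind _ (fun x => span_over B X (b *: x))).
- by rewrite scaler0; apply: span_over0.
- by move=> x y Xx Xy; rewrite scalerDr; apply: span_overD.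
- by move=> c x Bc Xx; rewrite scalerA; apply: span_over_gen => //; apply: BM.
Qed.

Lemma span_over_seq (s : seq M) x : span_over B [set` s] x ->
  B 0 -> (forall c d, B c -> B d -> B (c + d)) ->
  exists2 c : 'I_(size s) -> R, forall i, B (c i) & x = \sum_i c i *: s`_i.
Proof.
move=> + B0 BD; move: x; apply: (@span_over_ind _ (fun x =>
  exists2 c : 'I_(size s) -> R,
  forall i, B (c i) & x = \sum_i c i *: s`_i)).
- by exists (fun=> 0) => //; rewrite big1 // => i _; rewrite scale0r.
- move=> x y [c Bc ->] [d Bd ->]; exists (fun i => c i + d i).
    by move=> i; apply: BD.
  by rewrite -big_split; apply: eq_bigr => i _; rewrite scalerDl.
move=> c x Bc /= xs; have xi : (index x s < size s)%N by rewrite index_mem.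
exists (fun i => if i == Ordinal xi then c else 0) => [i|]; first by case: ifP.
rewrite (bigD1 (Ordinal xi)) //= eqxx nth_index // big1 ?addr0 // => i /negPf->.
by rewrite scale0r.
Qed.

End SpanOver.

Lemma span_over_sub (R : nzRingType) (M : lmodType R) (B B' : set R)
    (X Y : set M) :
  B `<=` B' -> X `<=` Y -> span_over B X `<=` span_over B' Y.
Proof.
move=> BB' XY; apply: span_over_ind; first exact: span_over0.
  exact: span_overD.
by move=> c x /BB' ? /XY ?; apply: span_over_gen.
Qed.

(** The family w need not be independent: a nonzero vector in the left kernel of the coefficient
    matrix already gives the relation. *)
Lemma wide_dependent (F : fieldType) (K : comNzRingType)
    (f : {rmorphism F -> K}) (I J : finType) (v : I -> K) (w : J -> K)
    (A : I -> J -> F) :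
  (#|J| < #|I|)%N -> (forall a, v a = \sum_b f (A a b) * w b) ->
  exists2 c : I -> F, exists a, c a != 0 & \sum_a f (c a) * v a = 0.
Proof.
move=> ltJI vA.
pose B := \matrix_(p < #|I|, q < #|J|) A (enum_val p) (enum_val q).
have kB : kermx B != 0.
  by rewrite -mxrank_eq0 mxrank_ker subn_eq0 -ltnNge (leq_ltn_trans (rank_leq_col B)).
have [p kp] : exists p, row p (kermx B) != 0.
  apply: contrapT => nex; case/eqP: kB; apply/row_matrixP => p.
  by rewrite row0; apply/eqP; apply: contrapT => /negP ?; apply: nex; exists p.
set u := row p _ in kp.
have uB : u *m B = 0 by rewrite /u -row_mul mulmx_ker row0.
exists (fun a => u 0 (enum_rank a)).
  apply: contrapT => nex; case/eqP: kp; apply/rowP => q; rewrite [RHS]mxE.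
  apply/eqP; apply: contrapT => /negP uq; apply: nex; exists (enum_val q).
  by rewrite enum_valK.
under eq_bigr => a _ do rewrite vA mulr_sumr.
rewrite exchange_big big1 //= => b _.
under eq_bigr => a _ do rewrite mulrA -rmorphM.
rewrite -mulr_suml -rmorph_sum.
have := congr1 (fun m : 'rV_#|J| => m 0 (enum_rank b)) uB; rewrite !mxE => uBb.
suff -> : \sum_a u 0 (enum_rank a) * A a b = 0 by rewrite rmorph0 mul0r.
rewrite -[RHS]uBb (reindex _ (onW_bij _ (@enum_val_bij I))) /=.
by apply: eq_bigr => q _; rewrite !mxE enum_valK enum_rankK.
Qed.

Lemma poly_split (R : nzRingType) (p : {poly R}) :
  exists q, p = q * 'X + (p`_0)%:P.
Proof.
elim/poly_ind: p => [|q c _]; first by exists 0; rewrite mul0r coef0 add0r polyC0.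
by exists q; rewrite coefD coefMX eqxx add0r coefC.
Qed.

Section FiniteOverRational.
Variables (F K : fieldType) (f : {rmorphism F -> K}) (x : K) (s : seq K).
Hypothesis span_s : span_over (M := K^o) (ratfuns f x) [set` s] = setT.
Local Notation ev p := (map_poly f p).[x].

(** Spanned over F by S * [size s] elements, which makes dimension counts possible once the
    denominators in [ratfuns] are cleared. *)
Definition poly_span (S : nat) : set K := [set z |
  exists p : 'I_(size s) -> {poly F},
    (forall j, (size (p j) <= S)%N) /\ z = \sum_j ev (p j) * s`_j].

Lemma poly_span_le S S' z : (S <= S')%N -> poly_span S z -> poly_span S' z.
Proof. by move=> le [p [ps ->]]; exists p; split=> // j; apply: leq_trans le. Qed.

Lemma poly_span0 S : poly_span S 0.
Proof.
exists (fun=> 0); split=> [j|]; first by rewrite size_poly0.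
by rewrite big1 // => j _; rewrite rmorph0 horner0 mul0r.
Qed.

Lemma poly_spanD S z z' : poly_span S z -> poly_span S z' ->
  poly_span S (z + z').
Proof.
move=> [p [ps ->]] [p' [ps' ->]]; exists (fun j => p j + p' j); split=> [j|].
  by rewrite (leq_trans (size_polyD _ _)) // geq_max ps ps'.
by rewrite -big_split; apply: eq_bigr => j _; rewrite rmorphD hornerD mulrDl.
Qed.

Lemma poly_spanM S (q : {poly F}) z : poly_span S z -> poly_span (S + size q) (ev q * z).
Proof.
move=> [p [ps ->]]; exists (fun j => q * p j); split=> [j|].
  rewrite (leq_trans (size_polyMleq _ _)) // (leq_trans (leq_pred _)) // addnC.
  by rewrite leq_add2r.
by rewrite mulr_sumr; apply: eq_bigr => j _; rewrite rmorphM hornerM mulrA.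
Qed.

Lemma poly_span_sum S (I : finType) (z : I -> K) :
  (forall j, poly_span S (z j)) -> poly_span S (\sum_j z j).
Proof.
by move=> zS; apply: (big_ind (poly_span S)) => //;
  [apply: poly_span0 | apply: poly_spanD].
Qed.

Lemma poly_span_clear z : exists g S, ev g != 0 /\ poly_span S (ev g * z).
Proof.
have : span_over (M := K^o) (ratfuns f x) [set` s] z by rewrite span_s.
move: z; apply: (@span_over_ind _ K^o _ _ (fun z : K => exists g S,
  ev g != 0 /\ poly_span S (ev g * z))).
- exists 1, 0%N; rewrite rmorph1 hornerC oner_neq0 mulr0; split=> //.
  exact: poly_span0.
- move=> z z' [g [S [g0 gS]]] [g' [S' [g0' gS']]].
  exists (g * g'), ((S + size g') + (S' + size g))%N; split.
    by rewrite rmorphM hornerM mulf_neq0.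
  rewrite rmorphM hornerM mulrDr; apply: poly_spanD.
    apply: (poly_span_le (leq_addr _ _)).
    by rewrite mulrAC mulrC; apply: poly_spanM.
  apply: (poly_span_le (leq_addl _ _)).
  by rewrite -mulrA; apply: poly_spanM.
move=> c z [p [r [r0 ->]]] /= zs.
have zi : (index z s < size s)%N by rewrite index_mem.
exists r, (size p); split=> //.
exists (fun j => if j == Ordinal zi then p else 0); split=> [j|].
  by case: ifP => //; rewrite size_poly0.
rewrite (bigD1 (Ordinal zi)) //= eqxx nth_index // big1 ?addr0 => [|j /negPf->].
  by rewrite /GRing.scale /= mulrA mulrCA divff // mulr1.
by rewrite rmorph0 horner0 mul0r.
Qed.

Lemma poly_span_clear_fin (I : finType) (z : I -> K) :
  exists g S, ev g != 0 /\ forall j, poly_span S (ev g * z j).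
Proof.
have [gS hgS] := choice (fun j => poly_span_clear (z j)).
have [S hS] := choice hgS; move: hS => {}hgS; move: gS hgS => g hgS.
pose T j := (S j + size (\prod_(j' | j' != j) g j')%R)%N.
exists (\prod_j g j), (\sum_j T j)%N; split=> [|j].
  rewrite rmorph_prod horner_prod; apply/prodf_neq0 => j _.
  by case: (hgS j).
rewrite (bigD1 (op := GRing.mul) j) //= rmorphM hornerM mulrAC mulrC.
apply: (@poly_span_le (T j)); first by rewrite (bigD1 j) //= leq_addr.
by apply: poly_spanM; case: (hgS j).
Qed.

(** The factor g^m is the same for all i <= m, so that the products y^i z land in one common space;
    for i < m the surplus factors g only raise degrees. *)
Lemma poly_span_mul y : exists g c, ev g != 0 /\
  forall m i S z, (i <= m)%N -> poly_span S z ->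
    poly_span (S + c * m) (ev g ^+ m * (y ^+ i * z)).
Proof.
have [g [S0 [g0 gS]]] := poly_span_clear_fin (fun j : 'I_(size s) => y * s`_j).
pose c := (S0 + size g)%N; exists g, c; split=> //.
have g1 S z : poly_span S z -> poly_span (S + c) (ev g * z).
  move=> /(poly_spanM g); apply: poly_span_le.
  by rewrite leq_add2l leq_addl.
have gy S z : poly_span S z -> poly_span (S + c) (ev g * (y * z)).
  move=> [p [ps ->]]; rewrite !mulr_sumr; apply: poly_span_sum => j.
  have -> : ev g * (y * (ev (p j) * s`_j)) = ev (p j) * (ev g * (y * s`_j)).
    by ring.
  apply: (poly_span_le _ (poly_spanM (p j) (gS j))).
  by rewrite [leqRHS]addnC -addnA leq_add2l (leq_trans (ps j)) ?leq_addl.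
elim=> [|m IH] i S z.
  by rewrite leqn0 => /eqP-> zS; rewrite muln0 addn0 !expr0 !mul1r.
case: i => [_|i im] zS; rewrite mulnS addnA.
  have := IH 0%N (S + c)%N _ (leq0n m) (g1 _ _ zS).
  by rewrite !expr0 !mul1r mulrA -exprSr.
have := IH i (S + c)%N _ im (gy _ _ zS).
by congr poly_span; rewrite !exprSr; ring.
Qed.

(* Multiplying by y (after clearing denominators) raises degrees in x by at most
   c, so the (d c + 1) m products y^i v_j, i < m, lie in an F-space of dimension
   d (S + c m), which is smaller for m > d S. *)
Lemma finite_dependent (y : K) : exists n : nat, forall v : 'I_n.+1 -> K,
  exists2 p : 'I_n.+1 -> {poly F}, exists j, p j != 0
    & \sum_j (map_poly f (p j)).[y] * v j = 0.
Proof.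
have [g [c [g0 gc]]] := poly_span_mul y; pose d := size s.
exists (d * c)%N => v; have [h [S [h0 hS]]] := poly_span_clear_fin v.
pose m := (d * S).+1; pose N := (S + c * m)%N.
have vN (a : 'I_(d * c).+1 * 'I_m) : exists A : 'I_d * 'I_N -> F,
    ev g ^+ m * (y ^+ a.2 * (ev h * v a.1)) =
    \sum_b f (A b) * (x ^+ b.2 * s`_b.1).
  have [p [ps ->]] := gc m a.2 S _ (ltnW (ltn_ord a.2)) (hS a.1).
  exists (fun b : 'I_d * 'I_N => (p b.1)`_b.2).
  rewrite -(pair_bigA _ (fun (j : 'I_d) (i : 'I_N) =>
    f (p j)`_i * (x ^+ i * s`_j))) /=.
  apply: eq_bigr => j _; rewrite (@horner_coef_wide _ N); last first.
    by rewrite size_map_poly ps.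
  by rewrite mulr_suml; apply: eq_bigr => i _; rewrite coef_map mulrA.
have [A hA] := choice vN.
have lt : (#|{: 'I_d * 'I_N}| < #|{: 'I_(d * c).+1 * 'I_m}|)%N.
  rewrite !card_prod !card_ord /N mulnDr mulSn mulnA.
  by rewrite ltn_add2r /m ltnS.
have [b [[j i] bji] b0] := wide_dependent lt hA.
(* The relation over the pairs (j, i) is collected along the powers of y. *)
exists (fun j => \sum_(i < m) (b (j, i))%:P * 'X^i).
  exists j; apply: contra_neq bji => /(congr1 (fun p : {poly F} => p`_i)).
  rewrite coef0 coef_sum (bigD1 i) //= coefCM coefXn eqxx mulr1 big1 ?addr0 //.
  move=> i' ne; rewrite coefCM coefXn; case: eqP => [e|_]; last by rewrite mulr0.
  by case/eqP: ne; apply: val_inj.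
have gh : ev g ^+ m * ev h != 0 by rewrite mulf_neq0 // expf_neq0.
apply: (mulfI gh); rewrite mulr0 -[RHS]b0.
transitivity (\sum_j \sum_(i < m) f (b (j, i)) *
    (ev g ^+ m * (y ^+ i * (ev h * v j)))); last first.
  by rewrite pair_bigA; apply: eq_bigr => -[].
rewrite mulr_sumr.
apply: eq_bigr => j' _; rewrite rmorph_sum horner_sum mulr_suml mulr_sumr.
apply: eq_bigr => i' _; rewrite rmorphM /= map_polyC map_polyXn hornerCM hornerXn.
rewrite /=.
ring.
Qed.

(* The residue algebra O / y O of a subring O of K has dimension at most n. *)
Lemma residue_dependent (y : K) : y != 0 -> exists n : nat,
  forall O : set K, (forall c, O (f c)) ->
  (forall u v, O u -> O v -> O (u - v)) ->
  (forall u v, O u -> O v -> O (u * v)) -> O y ->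
  forall v : 'I_n.+1 -> K, (forall j, O (v j)) ->
  exists2 c : 'I_n.+1 -> F, exists j, c j != 0
    & exists2 z, O z & \sum_j f (c j) * v j = y * z.
Proof.
move=> y0; have [n dep] := finite_dependent y; exists n => O Of OsB OM Oy v Ov.
have O0 : O 0 by rewrite -(rmorph0 f).
have OD u w : O u -> O w -> O (u + w).
  by move=> Ou Ow; have := OsB _ _ Ou (OsB _ _ O0 Ow); rewrite sub0r opprK.
have Oev p : O (map_poly f p).[y].
  elim/poly_ind: p => [|p c Op]; first by rewrite rmorph0 horner0.
  rewrite rmorphD rmorphM /= map_polyX map_polyC hornerMXaddC.
  by apply: OD (Of c); apply: OM.
have [p [j pj] p0] := dep v.
(* If some coefficient polynomial has a nonzero constant term, reduction modulo y gives the relation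
   over F. To get there, a common factor y is cancelled as long as all constant terms vanish. *)
suff [q [j' qj'] q0] : exists2 q : 'I_n.+1 -> {poly F},
    exists j, (q j)`_0 != 0 & \sum_j (map_poly f (q j)).[y] * v j = 0.
  exists (fun j => (q j)`_0); first by exists j'.
  have [r hr] := choice (fun j => poly_split (q j)).
  exists (- \sum_j (map_poly f (r j)).[y] * v j).
    rewrite -sub0r; apply: (OsB _ _ O0).
    by apply: (big_ind O) => // i _; apply: OM => //; apply: Oev.
  apply/eqP; rewrite mulrN -addr_eq0 mulr_sumr -big_split /=; apply/eqP.
  rewrite -[RHS]q0; apply: eq_bigr => i _.
  rewrite [in RHS](hr i) rmorphD rmorphM /= map_polyX map_polyC hornerMXaddC.
  ring.
move: {2}(size (p j)) (leqnn (size (p j))) => N.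
elim: N p j pj p0 => [|N IH] p j pj p0 le.
  by move: le; rewrite leqn0 size_poly_eq0 (negPf pj).
case: (pselect (exists j, (p j)`_0 != 0)) => [?|nex]; first by exists p.
have [r hr] := choice (fun j => poly_split (p j)).
have {}hr i : p i = r i * 'X.
  rewrite {1}(hr i); suff -> : (p i)`_0 = 0 by rewrite addr0.
  by apply/eqP; apply: contrapT => /negP ?; apply: nex; exists i.
have rj : r j != 0 by apply: contra_neq pj => rj; rewrite hr rj mul0r.
apply: (IH r j rj); last by move: le; rewrite hr size_mulX.
apply: (mulfI y0); rewrite mulr0 -[RHS]p0 mulr_sumr; apply: eq_bigr => i _.
by rewrite [in RHS]hr rmorphM /= map_polyX hornerMX mulrA (mulrC y).
Qed.

End FiniteOverRational.

(** * Valuation rings *)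

Definition is_subring (R : nzRingType) (B : set R) : Prop :=
  [/\ B 1, forall x y, B x -> B y -> B (x - y)
    & forall x y, B x -> B y -> B (x * y)].

Section Subring.
Variables (R : nzRingType) (B : set R).
Hypothesis subB : is_subring B.

Lemma is_subring1 : B 1. Proof. by case: subB. Qed.
Lemma is_subringB x y : B x -> B y -> B (x - y). Proof. by case: subB => _ + _;
  apply. Qed.
Lemma is_subringM x y : B x -> B y -> B (x * y). Proof. by case: subB => _ _;
  apply. Qed.
Lemma is_subring0 : B 0.
Proof. by rewrite -(subrr 1); apply: is_subringB is_subring1 is_subring1. Qed.
Lemma is_subringN x : B x -> B (- x).
Proof. by rewrite -sub0r; apply: is_subringB is_subring0. Qed.
Lemma is_subringD x y : B x -> B y -> B (x + y).
Proof. by move=> Bx /is_subringN By; rewrite -[y]opprK; apply: is_subringB. Qed.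
Lemma is_subringX x n : B x -> B (x ^+ n).
Proof.
by move=> Bx; elim: n => [|n IH]; rewrite ?exprS;
  [apply: is_subring1 | apply: is_subringM].
Qed.
Lemma is_subring_sum (I : Type) (r : seq I) (P : pred I) (G : I -> R) :
  (forall i, P i -> B (G i)) -> B (\sum_(i <- r | P i) G i).
Proof. by apply: (big_ind B); [apply: is_subring0 | apply: is_subringD]. Qed.

End Subring.

(** * Chevalley's extension theorem *)

Definition adjoin (K : fieldType) (B : set K) (x : K) : set K :=
  [set z | exists2 p : {poly K}, forall j, B p`_j & z = p.[x]].

Section Chevalley.
Variables (K : fieldType) (R0 I : set K).
Hypotheses (subR0 : is_subring R0) (IR0 : I `<=` R0).
Local Notation ext B := (span_over (M := K^o) B I).
Hypothesis I1 : ~ ext R0 1.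

Let good (B : set K) := [/\ is_subring B, R0 `<=` B & ~ ext B 1].

(** In the use of Zorn's lemma, the alternative [B = set0] accounts for the empty chain, whose union
    is not a ring; a maximal element is nonempty because R0 is good. *)
Let good_max :
  exists2 B, good B & forall B', good B' -> B `<=` B' -> B' `<=` B.
Proof.
have [|B [PB maxB]] := @Zorn_bigcup K (fun B => B = set0 \/ good B).
  move=> Fm FmP tot.
  case: (pselect (exists2 B, Fm B & good B)) => [[B0 FB0 gB0]|nex]; last first.
    left; apply/seteqP; split=> // x [B FB Bx].
    case: (FmP B FB) => [B0|gB]; first by move: Bx; rewrite B0.
    by case: nex; exists B.
  have two x y : (\bigcup_(X in Fm) X) x -> (\bigcup_(X in Fm) X) y ->
      exists B, [/\ Fm B, good B, B x & B y].
    move=> [B FB Bx] [B' FB' By].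
    case: (FmP _ FB) => [e|gB]; first by move: Bx; rewrite e.
    case: (FmP _ FB') => [e|gB']; first by move: By; rewrite e.
    by case: (tot _ _ FB FB') => s; [exists B' | exists B]; split=> //; apply: s.
  right; split.
  - split=> [|x y Ux Uy|x y Ux Uy].
    + by exists B0 => //; case: gB0 => -[].
    + have [B [FB [[_ sB _] _ _] Bx By]] := two _ _ Ux Uy.
      by exists B => //; apply: sB.
    + have [B [FB [[_ _ mB] _ _] Bx By]] := two _ _ Ux Uy.
      by exists B => //; apply: mB.
  - by move=> x R0x; exists B0 => //; case: gB0 => _ + _; apply.
  suff: ext (\bigcup_(X in Fm) X) `<=` [set m | exists B, [/\ Fm B,
    good B & ext B m]].
    by move=> s /s [B [_ [_ _ nB]]].
  apply: (@span_over_ind _ K^o).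
  - by exists B0; split=> //; apply: span_over0.
  - move=> x y [B [FB gB Bx]] [B' [FB' gB' By]].
    have sub D D' z : D `<=` D' -> ext D z -> ext D' z.
      by move=> DD'; apply: (@span_over_sub _ K^o) => // ?.
    case: (tot _ _ FB FB') => s; [exists B' | exists B]; split=> //.
      exact: span_overD (sub _ _ _ s Bx) By.
    exact: span_overD Bx (sub _ _ _ s By).
  move=> c x Uc Ix; have [B [FB gB Bc _]] := two _ _ Uc Uc.
  by exists B; split=> //; apply: span_over_gen.
have gR0 : good R0 by split.
exists B => [|B' gB' BB'].
  case: PB => // B0; case: (maxB R0); last by right.
  rewrite B0; split=> // /(_ 1 (is_subring1 subR0)).
  by [].
by apply: contrapT => nB'B; apply: (maxB B') => //; right.
Qed.

Section Maximal.
Variable B : set K.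
Hypotheses (gB : good B) (maxB : forall B', good B' -> B `<=` B' -> B' `<=` B).
Let subB : is_subring B. Proof. by case: gB. Qed.

Local Notation J := (ext B).
Let JP (p : {poly K}) := forall j, J p`_j.

Let JM b z : B b -> J z -> J (b * z).
Proof. by move=> Bb Jz; apply: span_overZ => //; apply: is_subringM. Qed.

Let JB z : J z -> B z.
Proof.
move: z; apply: (@span_over_ind _ K^o).
- exact: is_subring0.
- exact: is_subringD.
by move=> c x Bc /IR0 R0x; apply: is_subringM => //; case: gB => _ + _; apply.
Qed.

Let J1 : ~ J 1. Proof. by case: gB. Qed.

Let JPD p q : JP p -> JP q -> JP (p + q).
Proof. by move=> pJ qJ j; rewrite coefD; apply: span_overD. Qed.

Let JPZ b p : B b -> JP p -> JP (b *: p).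
Proof. by move=> Bb pJ j; rewrite coefZ; apply: JM. Qed.

(** B[x] is strictly larger than B, so by maximality I generates the unit ideal in it; p records an
    expression of 1. *)
Let JP_eq1 x : ~ B x -> exists2 p, JP p & p.[x] = 1.
Proof.
move=> nBx; have subC : is_subring (adjoin B x).
  split.
  - exists 1 => [j|]; last by rewrite hornerC.
    by rewrite coef1; case: (_ == _); [apply: is_subring1 | apply: is_subring0].
  - move=> _ _ [p pB ->] [q qB ->]; exists (p - q) => [j|].
      by rewrite coefB; apply: is_subringB.
    by rewrite hornerD hornerN.
  move=> _ _ [p pB ->] [q qB ->]; exists (p * q) => [j|]; last by rewrite hornerM.
  by rewrite coefM; apply: is_subring_sum => // i _; apply: is_subringM.
have BC : B `<=` adjoin B x.
  move=> b Bb; exists b%:P => [j|]; last by rewrite hornerC.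
  by rewrite coefC; case: ifP => // _; apply: is_subring0.
have Cx : adjoin B x x.
  exists 'X => [j|]; last by rewrite hornerX.
  by rewrite coefX; case: (_ == _); [apply: is_subring1 | apply: is_subring0].
have : ext (adjoin B x) 1.
  apply: contrapT => n1; apply: nBx; apply: (maxB _ BC) Cx; split=> //.
  by move=> z R0z; apply: BC; case: gB => _ + _; apply.
suff : ext (adjoin B x) `<=` [set z | exists2 p, JP p & p.[x] = z] by apply.
apply: (@span_over_ind _ K^o).
- by exists 0; [move=> j; rewrite coef0; apply: span_over0 | rewrite horner0].
- by move=> _ _ [p pJ <-] [q qJ <-]; exists (p + q); [apply: JPD | rewrite hornerD].
move=> _ z [p pB ->] Iz; exists (p * z%:P); last by rewrite hornerM hornerC.
by move=> j; rewrite coefMC; apply: span_over_gen.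
Qed.

(** With s = 1 - c, a failure gives 1 = p(1/s) with p over J. Multiplication by s^N, N = [size p],
    puts s^N in J; since 1 - s^N is in J as well, 1 would be. *)
Let J_unit c : J c -> B (1 - c)^-1.
Proof.
move=> Jc; apply: contrapT => /JP_eq1[p pJ p1]; apply: J1.
have s0 : 1 - c != 0.
  by apply/negP; rewrite subr_eq0 => /eqP e; apply: J1; rewrite e.
have Bs : B (1 - c) by apply: is_subringB => //; [apply: is_subring1 | apply: JB].
have Js n : J (1 - (1 - c) ^+ n).
  elim: n => [|n IH]; first by rewrite expr0 subrr; apply: span_over0.
  have -> : 1 - (1 - c) ^+ n.+1 = (1 - c) * (1 - (1 - c) ^+ n) + c.
    by rewrite exprS; ring.
  by apply: span_overD => //; apply: JM.
rewrite -[1](subrK ((1 - c) ^+ size p)); apply: span_overD => //.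
rewrite -[_ ^+ _]mulr1 -[X in span_over _ _ (_ * X)]p1 horner_coef mulr_sumr.
apply: (@span_over_sum _ K^o) => i _.
rewrite (_ : _ * _ = (1 - c) ^+ (size p - i) * p`_i).
  by apply: JM => //; apply: is_subringX.
by rewrite exprVn expfB ?ltn_ord // mulrCA [RHS]mulrC.
Qed.

(* q(1/x) = 1 expresses x^n by lower powers of x with coefficients in J, the
   constant coefficient of 1 - q being a unit; substitute this in the leading
   term of p. *)
Let JP_drop x p q : x != 0 -> JP p -> JP q -> p.[x] = 1 -> q.[x^-1] = 1 ->
  (size q <= size p)%N ->
  exists2 p', JP p' & p'.[x] = 1 /\ (size p' < size p)%N.
Proof.
move=> x0 pJ qJ px qx le.
have [r qr] := poly_split q; set c := q`_0 in qr.
have rJ : JP r by move=> j; have := qJ j.+1; rewrite qr coefD coefMX coefC addr0.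
case sp: (size p) le => [|[|n]] le.
- by move/eqP: sp px; rewrite size_poly_eq0 => /eqP->; rewrite horner0 =>
  /esym/eqP; rewrite oner_eq0.
- have [b pb] : exists b, p = b%:P by exists p`_0; apply: size1_polyC; rewrite sp.
  by case: J1; rewrite -px pb hornerC; have := pJ 0%N; rewrite pb coefC.
set s := 1 - c; have Bs : B s^-1 by apply: J_unit; apply: qJ.
have s0 : s != 0.
  apply/negP; rewrite subr_eq0 => /eqP e.
  by apply: J1; rewrite e; apply: qJ.
have rx : r.[x^-1] = s * x.
  move: qx; rewrite qr hornerMXaddC => qx.
  by rewrite /s -[in LHS](mulfK (invr_neq0 x0) r.[_]) invrK -qx; ring.
have sr : (size r <= n.+1)%N.
  case: (eqVneq r 0) => [->|r0]; first by rewrite size_poly0.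
  rewrite -ltnS; move: le; rewrite qr size_MXaddC (negPf r0) /=.
  by [].
(* The reversed polynomial: t(x) = x^n r(1/x). *)
pose t := \poly_(i < n.+1) r`_(n - i).
have tx : t.[x] = s * x ^+ n.+1.
  rewrite horner_poly exprS mulrA -rx (horner_coef_wide _ sr) mulr_suml.
  rewrite (reindex_inj rev_ord_inj) /=; apply: eq_bigr => i _.
  rewrite subSS subKn ?leq_ord // exprVn -mulrA; congr (_ * _).
  by rewrite mulrC -expfB_cond // (negPf x0) leq_ord.
have tJ : JP t.
  by move=> j; rewrite coef_poly; case: ifP => // _; apply: span_over0.
pose b := p`_n.+1; have Jb : J b by apply: pJ.
exists (p - b *: 'X^(n.+1) + (b / s) *: t).
  apply: JPD; last by apply: JPZ => //; apply: is_subringM => //; apply: JB.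
  move=> j; rewrite coefB coefZ coefXn; case: (j =P n.+1) => [->|_].
    by rewrite mulr1 subrr; apply: span_over0.
  by rewrite mulr0 subr0.
split.
  rewrite !hornerE tx px mulrA mulfVK //; ring.
rewrite ltnS (leq_trans (size_polyD _ _)) // geq_max; apply/andP; split; last first.
  exact: leq_trans (size_scale_leq _ _) (size_poly _ _).
apply/leq_sizeP => j; rewrite leq_eqVlt coefB coefZ coefXn => /orP[/eqP<-|lt].
  by rewrite eqxx mulr1 subrr.
by rewrite gtn_eqF // mulr0 subr0 nth_default // sp.
Qed.

Let B_valuation x : B x \/ B x^-1.
Proof.
apply: contrapT => /not_orP[nx nx'].
have x0 : x != 0.
  by apply/negP => /eqP x0; apply: nx; rewrite x0; apply: is_subring0.
have [p pJ px] := JP_eq1 nx; have [q qJ qx] := JP_eq1 nx'.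
(* Descent on the sum of the sizes: the longer relation is shortened by means of the other, with x
   and 1/x exchanged if necessary. *)
move: {2}(size p + size q)%N (leqnn (size p + size q)) => N.
elim: N x p q {nx nx'} x0 pJ px qJ qx => [|N IH] x p q x0 pJ px qJ qx le.
  move: le; rewrite leqn0 addn_eq0 size_poly_eq0 => /andP[/eqP p0 _].
  by move/eqP: px; rewrite p0 horner0 eq_sym oner_eq0.
case: (leqP (size q) (size p)) => [qp|/ltnW pq].
  have [p' pJ' [px' lt]] := JP_drop x0 pJ qJ px qx qp.
  apply: (IH x p' q) => //; rewrite -ltnS; apply: leq_trans le.
  by rewrite -addSn leq_add2r.
have [|q' qJ' [qx' lt]] := JP_drop (invr_neq0 x0) qJ pJ qx _ pq.
  by rewrite invrK.
apply: (IH x p q') => //; rewrite -ltnS; apply: leq_trans le.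
by rewrite -addnS leq_add2l.
Qed.

Lemma maximal_valuation : (forall x, B x \/ B x^-1) /\
  (forall z, I z -> z != 0 -> ~ B z^-1).
Proof.
split=> // z Iz z0 Bz; apply: J1; rewrite -(mulVf z0).
exact: (@span_over_gen _ K^o).
Qed.

End Maximal.

Lemma valuation_ring_above : exists O : set K,
  [/\ is_subring O, R0 `<=` O, forall x, O x \/ O x^-1
    & forall z, I z -> z != 0 -> ~ O z^-1].
Proof.
have [B gB maxB] := good_max.
by have [val loc] := maximal_valuation gB maxB; exists B; case: gB.
Qed.

End Chevalley.

(** * The coordinate ring *)

Section IdealPow.
Variables (R : comNzRingType) (I : set R).

Lemma ideal_pow_ideal n : is_ideal (ideal_pow I n).
Proof.
case: n => [|n] //=; split; first exact: span_over0.
  by move=> x y; apply: span_overD.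
by move=> r x; apply: (@span_overZ _ R^o).
Qed.

Lemma ideal_pow_exp x n : I x -> ideal_pow I n (x ^+ n).
Proof.
move=> Ix; elim: n => [|n IH] //=.
by apply: (@span_over_incl _ R^o) => //; exists x, (x ^+ n); rewrite exprS.
Qed.

End IdealPow.

Lemma is_ideal_sum (R : comNzRingType) (I : set R) (T : Type) (r : seq T)
    (P : pred T) (G : T -> R) :
  is_ideal I -> (forall i, P i -> I (G i)) -> I (\sum_(i <- r | P i) G i).
Proof. by case=> I0 ID _; apply: (big_ind I). Qed.

(** * Powers of the maximal ideal of a valuation ring *)

Section ValuationRing.
Variables (K : fieldType) (O : set K).
Hypotheses (subO : is_subring O) (valO : forall x, O x \/ O x^-1).

(** Either z / (1 + z w) or its inverse is in O. The first case suffices, as 1 / (1 + z w) = 1 - w z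
    / (1 + z w); the second would put 1/z in O. *)
Lemma valuation_unit z w : ~ O z^-1 -> O w -> 1 + z * w != 0 /\ O (1 + z * w)^-1.
Proof.
move=> nz Ow; have z0 : z != 0.
  by apply/negP => /eqP e; apply: nz; rewrite e invr0; apply: is_subring0.
have s0 : 1 + z * w != 0.
  apply/negP; rewrite addrC addr_eq0 => /eqP zw; apply: nz.
  have -> : z^-1 = - w by apply: (mulfI z0); rewrite mulrN zw opprK divff.
  exact: is_subringN.
split=> //; have [Ot|Ot] := valO (z / (1 + z * w)).
  have -> : (1 + z * w)^-1 = 1 - z / (1 + z * w) * w by field.
  by apply: is_subringB => //; [apply: is_subring1 | apply: is_subringM].
case: nz; have -> : z^-1 = (z / (1 + z * w))^-1 - w by field; rewrite z0 s0.
exact: is_subringB.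
Qed.

(** The maximal ideal of O; the guard [x != 0] lets 0 in, whose inverse is 0 by convention. *)
Let max x := O x /\ (x != 0 -> ~ O x^-1).

(** No sums are taken: of two elements of a valuation ring one divides the other, so these products
    already form the n-th power ideal. *)
Fixpoint max_pow n : set K :=
  if n is n'.+1 then [set y | exists x v, [/\ max x, max_pow n' v & y = x * v]]
  else O.

Lemma max_powM n b y : O b -> max_pow n y -> max_pow n (b * y).
Proof.
move=> Ob; elim: n y => [|n IH] y /=; first exact: is_subringM.
by move=> [x [v [mx vn ->]]]; exists x, (b * v); split=> //;
  [apply: IH | rewrite mulrCA].
Qed.

Lemma max_powD n y y' : max_pow n y -> max_pow n y' -> max_pow n (y + y').
Proof.
elim: n y y' => [|n IH] y y' /=; first exact: is_subringD.
move=> [x [v [mx nv ->]]] [x' [v' [mx' nv' ->]]].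
case: (eqVneq x 0) => [->|x0]; first by exists x', v'; rewrite mul0r add0r.
case: (eqVneq x' 0) => [->|x0']; first by exists x, v; rewrite mul0r addr0.
have [r|r] := valO (x / x').
  exists x', (x / x' * v + v'); split=> //; first by apply: IH => //;
    apply: max_powM.
  by field.
exists x, (v + (x / x')^-1 * v'); split=> //; first by apply: IH => //;
  apply: max_powM.
by field; rewrite x0 x0'.
Qed.

Lemma max_pow_le n m y : (n <= m)%N -> max_pow m y -> max_pow n y.
Proof.
move=> /subnK <-; elim: (m - n)%N y => [|d IH] y //=.
by move=> [x [v [[Ox _] nv ->]]]; apply: max_powM => //; apply: IH.
Qed.

(** Thus O / y O has dimension at least n. For y = x v the family is 1 followed by x times the
    family of v: a relation in which 1 occurs would make x a unit, and otherwise x cancels. *)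
Lemma max_pow_independent (F : fieldType) (f : {rmorphism F -> K}) n y :
  (forall c, O (f c)) -> y != 0 -> max_pow n y ->
  exists2 w : 'I_n -> K, forall i, O (w i) & forall c : 'I_n -> F,
    (exists2 z, O z & \sum_i f (c i) * w i = y * z) -> forall i, c i = 0.
Proof.
move=> Of; elim: n y => [|n IH] y y0 /=.
  by exists (fun=> 0) => [[]|c _ []].
move=> [x [v [[Ox mx] nv yxv]]]; move: y0; rewrite yxv mulf_eq0 negb_or =>
  /andP[x0 v0].
have [w Ow wi] := IH v v0 nv.
exists (fun i => if unlift ord0 i is Some j then x * w j else 1).
  by move=> i; case: unlift => [j|]; [apply: is_subringM | apply: is_subring1].
move=> c [z Oz]; rewrite big_ord_recl unlift_none mulr1.
under eq_bigr => i _ do rewrite liftK mulrCA.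
rewrite -mulr_sumr => e; have Ov := max_pow_le (leq0n n) nv.
have c0 : c ord0 = 0.
  apply/eqP/negPn/negP => c0; apply: (mx x0).
  have fc0 : f (c ord0) != 0 by rewrite fmorph_eq0.
  have -> : x^-1 = f (c ord0)^-1 * (v * z - \sum_i f (c (lift ord0 i)) * w i).
    apply: (mulfI x0); rewrite divff // mulrCA mulrBr mulrA -e addrK fmorphV.
    by rewrite mulVf.
  apply: is_subringM => //; apply: is_subringB => //; first exact: is_subringM.
  by apply: is_subring_sum => // i _; apply: is_subringM.
move: e; rewrite c0 rmorph0 add0r -mulrA => /(mulfI x0) e.
move=> i; case: (unliftP ord0 i) => [j ->|-> //].
by apply: (wi (fun j => c (lift ord0 j))); exists z.
Qed.

End ValuationRing.

(** A family in Y that is independent modulo z has at most n members. Generators are drawn from Y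
    itself, so that later each of them comes from an element of A with a known bound on its pole
    order. *)
Lemma residue_generators (F K : fieldType) (f : {rmorphism F -> K}) (O : set K)
    (z : K) (n : nat) (Y : set K) :
  is_subring O -> (forall c, O (f c)) ->
  (forall v : 'I_n.+1 -> K, (forall j, O (v j)) ->
    exists2 c : 'I_n.+1 -> F, exists j, c j != 0
      & exists2 u, O u & \sum_j f (c j) * v j = z * u) ->
  Y `<=` O ->
  exists k (v : 'I_k -> K), (forall i, Y (v i)) /\
    forall y, Y y -> exists (c : 'I_k -> F) u,
      O u /\ y = \sum_i f (c i) * v i + z * u.
Proof.
move=> subO Of dep YO; apply: contrapT => nex.
suff indep k : exists2 v : 'I_k -> K, forall i, Y (v i) &
    forall c : 'I_k -> F,
      (exists2 u, O u & \sum_i f (c i) * v i = z * u) -> forall i, c i = 0.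
  have [v Yv vi] := indep n.+1.
  have [c [j cj] /vi c0] := dep v (fun j => YO _ (Yv j)).
  by rewrite c0 eqxx in cj.
elim: k => [|k [v Yv vi]]; first by exists (fun=> 0) => [[]|c _ []].
have [y [Yy ny]] : exists y, Y y /\ ~ exists (c : 'I_k -> F) u,
    O u /\ y = \sum_i f (c i) * v i + z * u.
  apply: contrapT => nny; apply: nex; exists k, v; split=> // y Yy.
  by apply: contrapT => ny; apply: nny; exists y.
exists (fun i => if unlift ord0 i is Some j then v j else y).
  by move=> i; case: unlift.
move=> c [u Ou]; rewrite big_ord_recl unlift_none.
under eq_bigr => i _ do rewrite liftK.
move=> e; have c0 : c ord0 = 0.
  apply/eqP/negPn/negP => c0; apply: ny.
  have fc0 : f (c ord0) != 0 by rewrite fmorph_eq0.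
  exists (fun j => - (c ord0)^-1 * c (lift ord0 j)), (f (c ord0)^-1 * u); split.
    exact: is_subringM.
  apply: (mulfI fc0); rewrite mulrDr [X in _ = _ + X]mulrCA fmorphV mulVKf //.
  rewrite -e addrC mulr_sumr -addrA -big_split big1 ?addr0 //= => j _.
  by rewrite rmorphM rmorphN fmorphV; field.
move: e; rewrite c0 rmorph0 mul0r add0r => e i.
case: (unliftP ord0 i) => [j ->|-> //].
by apply: (vi (fun j => c (lift ord0 j))); exists u.
Qed.

Section Curve.
Variables (F : finFieldType) (C : pointed_curve F).
Local Notation K := (function_field C).
Local Notation f := (@curve_const F C).
Local Notation A := (coord_ring C).
Local Notation O := (@curve_infty F C).

Lemma closed_point_subring (B : set K) : is_closed_point f B -> is_subring B.
Proof. by case=> cB sB mB _ _; split=> //; rewrite -(rmorph1 f). Qed.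

Lemma curve_residue_dependent (y : K) : y != 0 -> exists n : nat,
  forall B : set K, is_subring B -> (forall c, B (f c)) -> B y ->
  forall v : 'I_n.+1 -> K, (forall j, B (v j)) ->
  exists2 c : 'I_n.+1 -> F, exists j, c j != 0
    & exists2 z, B z & \sum_j f (c j) * v j = y * z.
Proof.
move=> y0; have [x [_ [s hs]]] := curve_dim1 C.
have [n dep] := residue_dependent hs y0; exists n => B [_ sB mB] cB.
exact: dep.
Qed.

(** Chevalley's theorem is applied to F[1/y] and the ideal of z = 1/y. This ideal is proper: a
    relation 1 = p(z) z would make z algebraic over F, hence constant. *)
Lemma exists_pole (y : K) : ~ (exists c, y = f c) ->
  exists2 B, is_closed_point f B & ~ B y.
Proof.
move=> nc; pose z := y^-1.
pose R0 : set K := [set u | exists p, u = (map_poly f p).[z]].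
have subR0 : is_subring R0.
  split; first by exists 1; rewrite rmorph1 hornerC.
    by move=> _ _ [p ->] [q ->]; exists (p - q); rewrite rmorphB hornerD hornerN.
  by move=> _ _ [p ->] [q ->]; exists (p * q); rewrite rmorphM hornerM.
have [||B [subB R0B valB zB]] := valuation_ring_above subR0 (I := [set z]).
- by move=> _ ->; exists 'X; rewrite map_polyX hornerX.
- suff: span_over (M := K^o) R0 [set z] `<=`
      [set u | exists p, u = (map_poly f (p * 'X)).[z]].
    move=> /[apply] -[p p1]; apply: nc.
    have [|c zc] := @curve_geom_irr F C z.
      exists (p * 'X - 1); last by rewrite rootE rmorphB hornerD hornerN -p1 rmorph1 hornerC subrr.
      apply/negP => /eqP/(congr1 (fun q : {poly F} => q`_0)).
      by rewrite coefB coefMX coef1 coef0 sub0r => /eqP; rewrite oppr_eq0 oner_eq0.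
    by exists c^-1; rewrite fmorphV -zc invrK.
  apply: (@span_over_ind _ K^o).
  - by exists 0; rewrite mul0r rmorph0 horner0.
  - by move=> _ _ [p ->] [q ->]; exists (p + q); rewrite mulrDl rmorphD hornerD.
  by move=> _ _ [p ->] ->; exists p; rewrite rmorphM /= map_polyX hornerMX.
have z0 : z != 0.
  by apply/negP; rewrite invr_eq0 => /eqP y0; apply: nc; exists 0; rewrite rmorph0.
have nBy : ~ B y by have := zB z erefl z0; rewrite invrK.
exists B => //; have [B1 sB mB] := subB; split=> //.
  by move=> c; apply: R0B; exists c%:P; rewrite map_polyC hornerC.
by move=> e; apply: nBy; rewrite e.
Qed.

Lemma coord_regular (a : A) (B : set K) :
  is_closed_point f B -> B <> O -> B (coord_val a).
Proof. by case: a => x /= /asboolP; apply. Qed.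

Lemma regular_infty_const (a : A) : O (coord_val a) -> exists c,
  a = coord_const C c.
Proof.
move=> Oa; case: (pselect (exists c, coord_val a = f c)) => [[c ac]|nc].
  by exists c; apply: val_inj.
have [B cB nB] := exists_pole nc; case: (pselect (B = O)) => [e|ne].
  by case: nB; rewrite e.
by case: nB; apply: coord_regular.
Qed.

Fact coord_const_is_zmod_morphism : zmod_morphism (coord_const C).
Proof. by move=> x y; apply: val_inj; rewrite /= rmorphB. Qed.
Fact coord_const_is_monoid_morphism : monoid_morphism (coord_const C).
Proof. by split=> [|x y]; apply: val_inj; rewrite /= ?rmorph1 ?rmorphM. Qed.
HB.instance Definition _ := GRing.isZmodMorphism.Build F A (coord_const C)
  coord_const_is_zmod_morphism.
HB.instance Definition _ := GRing.isMonoidMorphism.Build F A (coord_const C)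
  coord_const_is_monoid_morphism.

Lemma coord_val_sum (I : Type) (r : seq I) (P : pred I) (G : I -> A) :
  coord_val (\sum_(i <- r | P i) G i) = \sum_(i <- r | P i) coord_val (G i).
Proof. exact: (rmorph_sum (\val : A -> K)). Qed.

Lemma coord_valX (a : A) n : coord_val (a ^+ n) = coord_val a ^+ n.
Proof. exact: (rmorphXn (\val : A -> K)). Qed.

(** * A as a finite module over F[a] *)

Section FiniteOverPolynomials.
Variable a : A.
Hypothesis a_nonconst : ~ exists c, a = coord_const C c.
Local Notation z := (coord_val a)^-1.

Let subO : is_subring O. Proof. exact: closed_point_subring (curve_inftyP C). Qed.
Let Of c : O (f c). Proof. by case: (curve_inftyP C). Qed.
Let valO x : O x \/ O x^-1. Proof. by case: (curve_inftyP C). Qed.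
Let nOa : ~ O (coord_val a). Proof. by move/regular_infty_const. Qed.
Let Oz : O z. Proof. by case: (valO (coord_val a)). Qed.
Let a0 : coord_val a != 0.
Proof. by apply/negP => /eqP e; apply: nOa; rewrite e; apply: is_subring0. Qed.
Let z0 : z != 0. Proof. by rewrite invr_eq0. Qed.

(** One may assume 1/y in O. Then O / y^-1 O is finite dimensional, so some combination of powers of
    z is a multiple of 1/y. It equals its lowest power z^i0 times a unit, whence y z^i0 is in O. *)
Lemma pole_order_bounded (y : K) : exists j, O (y * z ^+ j).
Proof.
apply: contrapT => nj.
have y0 : y != 0.
  apply/negP => /eqP e; apply: nj; exists 0%N; rewrite e mul0r.
  exact: is_subring0.
have Ou : O y^-1.
  by case: (valO y) => // Oy; case: nj; exists 0%N; rewrite mulr1.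
have [n dep] := curve_residue_dependent (invr_neq0 y0).
have [c [j cj] [w Ow e]] := dep O subO Of Ou (fun i : 'I_n.+1 => z ^+ i)
  (fun i => is_subringX subO i Oz).
case: (@arg_minnP _ j (fun i => c i != 0) val cj) => i0 ci0 min.
pose t := \sum_(i < n.+1 | (i0 < i)%N) f (c i / c i0) * z ^+ (i - i0.+1).
have Ot : O t.
  apply: is_subring_sum => // i _; apply: is_subringM => //.
  exact: is_subringX.
have [||s0 Os] := @valuation_unit K O subO valO z t; rewrite ?invrK //.
have fc0 : f (c i0) != 0 by rewrite fmorph_eq0.
have et : y^-1 * w = z ^+ i0 * f (c i0) * (1 + z * t).
  rewrite -e (bigID (fun i : 'I_n.+1 => (i0 < i)%N)) /= addrC mulrDr mulr1.
  congr (_ + _).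
    rewrite (bigD1 i0) ?ltnn //= big1 ?addr0 1?mulrC // => i /andP[le ne].
    case: (eqVneq (c i) 0) => [->|/min]; first by rewrite rmorph0 mul0r.
    rewrite leq_eqVlt (negPf le) orbF => /eqP eq.
    by case/eqP: ne; apply: val_inj.
  rewrite /t !mulr_sumr; apply: eq_bigr => i lt.
  rewrite -{1}(subnKC lt) exprD exprS rmorphM fmorphV.
  by field; rewrite fc0.
apply: nj; exists i0.
have -> : y * z ^+ i0 = (f (c i0))^-1 * w * (1 + z * t)^-1.
  apply: (mulIf s0); rewrite mulfVK //; apply: (mulfI fc0).
  rewrite mulVKf // -[RHS](mulVKf y0) et; ring.
by apply: is_subringM => //; apply: is_subringM => //; rewrite -fmorphV.
Qed.

Let polys : set A := [set u | exists p, u = (map_poly (coord_const C) p).[a]].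
Local Notation aspan s := (span_over (M := A^o) polys [set` s]).

Let subP : is_subring polys.
Proof.
split; first by exists 1; rewrite rmorph1 hornerC.
  by move=> _ _ [p ->] [q ->]; exists (p - q); rewrite rmorphB hornerD hornerN.
by move=> _ _ [p ->] [q ->]; exists (p * q); rewrite rmorphM hornerM.
Qed.

(** The filtration by pole order at infinity, with the pole order of a as unit. *)
Let filt j : set A := [set y | O (coord_val y * z ^+ j)].

Let aspan_cat s1 s2 y : aspan s1 y \/ aspan s2 y -> aspan (s1 ++ s2) y.
Proof.
case; apply: (@span_over_sub _ A^o) => // x /=; rewrite mem_cat => ->.
  by [].
by rewrite orbT.
Qed.

(** J is the largest degree of the chosen generators; one of degree d is multiplied by a^(j+1-d) to
    act in degree j + 1, which keeps its leading coefficient. The set P lets one statement serve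
    twice: P = {j + 1} makes each single step finite, and the full P yields one s that suffices for
    all degrees from J on. *)
Let filt_step (P : set nat) : exists J (s : seq A),
  (forall N, (forall j, P j -> (j <= N)%N) -> (J <= N)%N) /\
  forall j, P j.+1 -> (J <= j.+1)%N -> forall y, filt j.+1 y ->
    exists2 y', aspan s y' & filt j (y - y').
Proof.
pose Y : set K := [set u | exists j y, [/\ P j,
  filt j y & u = coord_val y * z ^+ j]].
have [n dep] := curve_residue_dependent z0.
have YO : Y `<=` O by move=> _ [j [y [_ Oy ->]]].
have [k [v [Yv hv]]] := residue_generators subO Of (dep O subO Of Oz) YO.
have [jf hjf] := choice Yv; have [yf hyf] := choice hjf.
exists (\max_i jf i), [seq yf i | i <- enum 'I_k]; split.
  by move=> N PN; apply/bigmax_leqP => i _; apply: PN; case: (hyf i).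
move=> j Pj le y fy.
have [|c [u [Ou e]]] := hv (coord_val y * z ^+ j.+1); first by exists j.+1, y.
exists (\sum_i (coord_const C (c i) * a ^+ (j.+1 - jf i)) * yf i).
  apply: (@span_over_sum _ A^o) => i _; apply: (@span_over_gen _ A^o).
    exists ((c i)%:P * 'X^(j.+1 - jf i)).
    by rewrite rmorphM /= map_polyC map_polyXn hornerCM hornerXn.
  by rewrite /= map_f // mem_enum.
rewrite /filt /=; suff -> : (coord_val y - coord_val (\sum_i (coord_const C (c i) *
    a ^+ (j.+1 - jf i)) * yf i)) * z ^+ j = u by [].
apply: (mulfI z0); rewrite mulrCA -exprS mulrBl e coord_val_sum mulr_suml.
rewrite addrAC -sumrB big1 ?add0r // => i _; apply/eqP; rewrite subr_eq0; apply/eqP.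
have [_ _ ->] := hyf i; have lei : (jf i <= j.+1)%N.
  by apply: leq_trans le; apply: (leq_bigmax i).
rewrite -{2}(subnKC lei) exprD /= coord_valX.
have zd : coord_val a ^+ (j.+1 - jf i) * z ^+ (j.+1 - jf i) = 1.
  by rewrite -exprMn divff ?expr1n.
rewrite -[LHS]mulr1 -zd; ring.
Qed.

Let filt_span j : exists s : seq A, filt j `<=` aspan s.
Proof.
elim: j => [|j [s0 hs0]].
  exists [:: 1] => y; rewrite /filt /= mulr1 => /regular_infty_const[c ->].
  rewrite -[coord_const _ _]mulr1; apply: (@span_over_gen _ A^o).
    by exists c%:P; rewrite map_polyC hornerC.
  by rewrite /= inE.
have [J [s [hJ hs]]] := filt_step [set j.+1].
exists (s ++ s0) => y fy.
have [|y' sy' fy'] := hs j erefl _ y fy.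
  by apply: hJ => _ ->.
rewrite -[y](subrK y'); apply: (@span_overD _ A^o); apply: aspan_cat.
  by right; apply: hs0.
by left.
Qed.

Lemma coord_ring_finite : exists s : seq A, forall y,
  exists p : 'I_(size s) -> {poly F},
    y = \sum_i (map_poly (coord_const C) (p i)).[a] * s`_i.
Proof.
have [J [s1 [_ hs1]]] := filt_step setT.
have [s0 hs0] := filt_span J; exists (s1 ++ s0) => y.
suff: aspan (s1 ++ s0) y.
  move/(@span_over_seq _ A^o _ _ _) => [||c hc ->].
  - exact: is_subring0.
  - exact: is_subringD.
  by have [p hp] := choice hc; exists p; apply: eq_bigr => i _; rewrite hp.
have [j] := pole_order_bounded (coord_val y).
have : filt (J + j) y -> aspan (s1 ++ s0) y.
  elim: j y => [|j IH] y; first by rewrite addn0 => /hs0 ?; apply: aspan_cat; right.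
  rewrite addnS => fy; have [|y' sy' fy'] := hs1 _ Logic.I _ y fy.
    by rewrite -addnS leq_addr.
  rewrite -[y](subrK y'); apply: (@span_overD _ A^o); first exact: IH.
  by apply: aspan_cat; left.
move=> h Oj; apply: h; rewrite /filt /= addnC exprD mulrA.
by apply: is_subringM => //; apply: is_subringX.
Qed.

(** A is finite over F[a] and a^n lies in I^n, so the products a^i s_j with i < n span A / I^n over
    F. *)
Lemma coord_ring_mod_pow (I : set A) : is_ideal I -> I a -> forall n,
  exists s : seq A, forall y : A, exists c : 'I_(size s) -> F,
    ideal_pow I n (y - \sum_i coord_const C (c i) * s`_i).
Proof.
move=> idI Ia n; have [s hs] := coord_ring_finite.
have [In0 InD InM] := ideal_pow_ideal I n.
pose t := [seq a ^+ i * x | i <- iota 0 n, x <- s].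
exists t => y; have [p ->] := hs y.
suff : exists2 u, span_over (M := A^o) (range (coord_const C)) [set` t] u &
    ideal_pow I n (\sum_i (map_poly (coord_const C) (p i)).[a] * s`_i - u).
  move=> [u hu]; have [||c hc ->] := @span_over_seq _ A^o _ _ _ hu.
  - by exists 0 => //; apply: rmorph0.
  - by move=> _ _ [c _ <-] [d _ <-]; exists (c + d) => //; apply: rmorphD.
  have /choice[c' hc'] : forall i, exists d, coord_const C d = c i.
    by move=> i; have [d _ <-] := hc i; exists d.
  move=> h; exists c'; rewrite (eq_bigr (fun i => c i *: (t`_i : A^o))) // => i _.
  by rewrite hc'.
have each i : exists2 u, span_over (M := A^o) (range (coord_const C)) [set` t] u &
    ideal_pow I n ((map_poly (coord_const C) (p i)).[a] * s`_i - u).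
  exists (\sum_(j < n) coord_const C (p i)`_j * (a ^+ j * s`_i)).
    apply: (@span_over_sum _ A^o) => j _; apply: (@span_over_gen _ A^o).
      by exists (p i)`_j.
    apply/allpairsP; exists (nat_of_ord j, s`_i); split=> //=.
      by rewrite mem_iota /=.
    exact: mem_nth.
  (* Padding to n + [size (p i)] terms splits off exactly n low terms; the others are multiples of
     a^n. *)
  rewrite (@horner_coef_wide _ (n + size (p i))) ?size_map_poly ?leq_addl //.
  rewrite big_split_ord /= mulrDl mulr_suml.
  rewrite [X in X + _ - _](eq_bigr
      (fun j : 'I_n => coord_const C (p i)`_j * (a ^+ j * s`_i))) => [|j _];
        last first.
    by rewrite coef_map /= mulrA.
  rewrite addrAC subrr add0r mulr_suml; apply: is_ideal_sum => // j _.
  rewrite exprD mulrCA -mulrA mulrC; apply: InM.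
  exact: ideal_pow_exp.
have /choice[u hu] i : exists u,
    span_over (M := A^o) (range (coord_const C)) [set` t] u /\
    ideal_pow I n ((map_poly (coord_const C) (p i)).[a] * s`_i - u).
  by have [u] := each i; exists u.
exists (\sum_i u i).
  by apply: (@span_over_sum _ A^o) => i _; case: (hu i).
by rewrite -sumrB; apply: is_ideal_sum => // i _; case: (hu i).
Qed.

End FiniteOverPolynomials.

Lemma ideal_pow_separated (I : set A) (y : A) : is_maximal_ideal I ->
  (forall N, exists2 n, (N <= n)%N & ideal_pow I n y) -> y = 0.
Proof.
move=> [idI nI _] hy; have [I0 ID IM] := idI.
pose R0 := range (@coord_val F C); pose J := (@coord_val F C) @` I.
have subR0 : is_subring R0.
  split; first by exists 1.
    by move=> _ _ [x _ <-] [x' _ <-]; exists (x - x').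
  by move=> _ _ [x _ <-] [x' _ <-]; exists (x * x').
have JR0 : J `<=` R0 by move=> _ [x _ <-]; exists x.
have J1 : ~ span_over (M := K^o) R0 J 1.
  suff s : span_over (M := K^o) R0 J `<=` J.
    move=> /s[x Ix x1]; apply: nI; apply/seteqP; split=> // w _.
    by rewrite -[w]mulr1; apply: IM; suff <- : x = 1 by []; apply: val_inj.
  apply: (@span_over_ind _ K^o).
  - by exists 0.
  - by move=> _ _ [x Ix <-] [x' Ix' <-]; exists (x + x') => //; apply: ID.
  - by move=> _ _ [x _ <-] [x' Ix' <-]; exists (x * x') => //; apply: IM.
have [B [subB R0B valB JB]] := valuation_ring_above subR0 JR0 J1.
(* Elements of I are nonunits of B, so n-fold products in I become n-fold products in the maximal
   ideal of B; [max_powD] absorbs the sums. *)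
have powB n x : ideal_pow I n x -> max_pow B n (coord_val x).
  elim: n x => [|n IH] x; first by move=> _; apply: R0B; exists x.
  move: x; apply: (@span_over_ind _ A^o).
  - exists 0, 0; split; rewrite ?mul0r //.
      by split; [apply: is_subring0 | rewrite eqxx].
    elim: {IH} n => [|n IHn] /=; first exact: is_subring0.
    by exists 0, 0; split=> //; rewrite ?mul0r //; split;
      [apply: is_subring0 | rewrite eqxx].
  - by move=> x x'; apply: (@max_powD _ _ subB valB n.+1).
  - move=> c _ _ [u [v [Iu /IH nv ->]]]; rewrite /GRing.scale /=.
    apply: (@max_powM _ _ subB n.+1); first by apply: R0B; exists c.
    exists (coord_val u), (coord_val v); split=> //; split.
      by apply: R0B; exists u.
    by apply: JB; exists u.
apply: contrapT => /eqP y0.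
have vy0 : coord_val y != 0.
  by apply: contra_neq y0 => vy; apply: val_inj.
have Bf c : B (f c) by apply: R0B; exists (coord_const C c).
have [n dep] := curve_residue_dependent vy0.
have [m lt /powB] := hy n.+1.
move=> /(max_pow_le subB lt)/(max_pow_independent subB Bf vy0)[w Bw wi].
have By : B (coord_val y) by apply: R0B; exists y.
have [c [j cj] /wi c0] := dep B subB Bf By w Bw.
by rewrite c0 eqxx in cj.
Qed.

End Curve.

(** * Power series, Laurent series and lattices *)

Section PowerSeries.
Variable k : fieldType.
Implicit Types f g : pseries k.

Lemma pscoef0 n : pscoef (0 : pseries k) n = 0.
Proof. by rewrite /= if_same. Qed.

Lemma pscoefD f g n : pscoef (f + g) n = pscoef f n + pscoef g n.
Proof. by []. Qed.

Lemma pscoefN f n : pscoef (- f) n = - pscoef f n.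
Proof. by []. Qed.

Lemma pscoefM f g n :
  pscoef (f * g) n = \sum_(i < n.+1) pscoef f i * pscoef g (n - i).
Proof. by []. Qed.

Lemma pscoefM0 f g : pscoef (f * g) 0 = pscoef f 0 * pscoef g 0.
Proof. by rewrite pscoefM big_ord1. Qed.

Lemma pscoefX0 f n : pscoef (f ^+ n) 0 = pscoef f 0 ^+ n.
Proof. by elim: n => [//|n IH]; rewrite !exprS pscoefM0 IH. Qed.

Lemma pscoef_sum (I : Type) (r : seq I) (P : pred I) (G : I -> pseries k) n :
  pscoef (\sum_(i <- r | P i) G i) n = \sum_(i <- r | P i) pscoef (G i) n.
Proof.
by apply: (big_morph (fun f => pscoef f n)) => [f g|]; rewrite ?pscoefD ?pscoef0.
Qed.

Definition psvar : pseries k := PSeries (fun n => (n == 1%N)%:R).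

Lemma pscoef_varM f n :
  pscoef (psvar * f) n = if n is n'.+1 then pscoef f n' else 0.
Proof.
rewrite pscoefM; case: n => [|n]; first by rewrite big_ord1 mul0r.
rewrite big_ord_recl mul0r add0r big_ord_recl /= mul1r subSS subn0 big1 ?addr0 //.
by move=> i _; rewrite mul0r.
Qed.

Lemma psvar_dvd f : pscoef f 0 = 0 -> exists g, f = psvar * g.
Proof.
move=> f0; exists (PSeries (fun n => pscoef f n.+1)); apply: pseriesP => n.
by rewrite pscoef_varM; case: n.
Qed.

Lemma psvar_neq0 : psvar != 0.
Proof.
apply/eqP => /(congr1 (fun f => pscoef f 1)); rewrite pscoef0 /= => /eqP.
by rewrite oner_eq0.
Qed.

Let pscoef_pow_lt f n i : pscoef f 0 = 0 -> (i < n)%N -> pscoef (f ^+ n) i = 0.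
Proof.
move=> /psvar_dvd[g ->]; rewrite exprMn; move: (g ^+ n) => {}g.
elim: n i => [//|n IH] [|i] lt; rewrite exprS -mulrA pscoef_varM //.
exact: IH.
Qed.

(** Geometric series in h = 1 - f / f(0), which has no constant term: the n-th coefficient of the
    limit is that of the partial sum with n + 1 terms. *)
Lemma ps_inverse f : pscoef f 0 != 0 -> exists g, g * f = 1.
Proof.
move=> f0; pose c := psC (pscoef f 0)^-1; pose h := 1 - c * f.
have h0 : pscoef h 0 = 0 by rewrite pscoefD pscoefN pscoefM0 /= mulVf // subrr.
pose G N := \sum_(j < N) h ^+ j.
pose g := PSeries (fun n => pscoef (G n.+1) n).
have gG N i : (i < N)%N -> pscoef g i = pscoef (G N) i.
  move=> iN; have -> : pscoef g i = pscoef (G i.+1) i by [].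
  rewrite -(subnKC iN) /G big_split_ord pscoefD [X in _ + X]pscoef_sum.
  rewrite [X in _ + X]big1 ?addr0 // => j _.
  by apply: pscoef_pow_lt => //; rewrite ltnS leq_addr.
have gh : g * (1 - h) = 1.
  apply: pseriesP => n.
  have -> : pscoef (g * (1 - h)) n = pscoef (G n.+1 * (1 - h)) n.
    by rewrite !pscoefM; apply: eq_bigr => i _; rewrite (gG n.+1).
  have -> : G n.+1 * (1 - h) = 1 - h ^+ n.+1.
    by rewrite -[in RHS](expr1n _ n.+1) subrXX mulrC; congr (_ * _);
      apply: eq_bigr => j _; rewrite expr1n mul1r.
  by rewrite pscoefD pscoefN pscoef_pow_lt // subr0.
by exists (g * c); rewrite -mulrA -[RHS]gh /h; congr (_ * _); ring.
Qed.

Lemma ps_factor f : f != 0 -> exists n g u, f = psvar ^+ n * g /\ u * g = 1.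
Proof.
move=> f0; have ex : exists n, pscoef f n != 0.
  apply: contrapT => nex; case/eqP: f0; apply: pseriesP => n.
  rewrite pscoef0; apply/eqP; apply: contrapT => /negP fn.
  by apply: nex; exists n.
case: (ex_minnP ex) => n; elim: n f {f0 ex} => [|n IH] f fn min.
  have [u uf] := ps_inverse fn.
  by exists 0%N, f, u; rewrite expr0 mul1r.
have [g fg] : exists g, f = psvar * g.
  by apply: psvar_dvd; apply/eqP; apply: contrapT => /negP /min.
move: fn min; rewrite fg pscoef_varM => gn min.
have [|m [g' [u [-> ug]]]] := IH g gn.
  by move=> j gj; have := min j.+1; rewrite pscoef_varM; apply.
by exists m.+1, g', u; rewrite exprS mulrA.
Qed.

Lemma pseries_principal (I : set (pseries k)) : is_ideal I ->
  exists f, I = [set z | exists r, z = r * f].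
Proof.
move=> [I0 ID IM].
case: (pselect (exists n, `[< I (psvar ^+ n) >])) => [ex|nex]; last first.
  exists 0; apply/seteqP; split=> [z Iz|_ [r ->]]; last by rewrite mulr0.
  exists 0; rewrite mulr0; apply/eqP; apply: contrapT => /negP z0.
  have [n [g [u [e ug]]]] := ps_factor z0; apply: nex; exists n; apply/asboolP.
  by rewrite -[_ ^+ _]mulr1 -ug mulrCA -e; apply: IM.
case: (ex_minnP ex) => n /asboolP In min; exists (psvar ^+ n).
apply/seteqP; split=> [z Iz|_ [r ->]]; last exact: IM.
case: (eqVneq z 0) => [->|z0]; first by exists 0; rewrite mul0r.
have [m [g [u [e ug]]]] := ps_factor z0.
have /min le : `[< I (psvar ^+ m) >].
  by apply/asboolP; rewrite -[_ ^+ _]mulr1 -ug mulrCA -e; apply: IM.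
by exists (psvar ^+ (m - n) * g); rewrite e -{1}(subnK le) exprD mulrAC.
Qed.

End PowerSeries.

Local Notation "x %:F" := (@FracField.tofrac _ x).

Lemma fraction_numden (R : idomainType) (x : {fraction R}) :
  exists n d : R, d != 0 /\ x * d%:F = n%:F.
Proof.
elim/quotW: x => r; exists (frac r).1, (frac r).2; split.
  by case: r.
unlock FracField.tofrac; rewrite -[LHS](FracField.pi_mul r); apply/eqmodP.
have d0 : (frac r).2 != 0 by case: r.
by rewrite /= FracField.equivfE /FracField.mulf !numden_Ratio ?oner_neq0 ?mulr1 // mulrC.
Qed.

Section Laurent.
Variable k : fieldType.
Local Notation E := (laurent k).
Local Notation OE := (@laurent_int k).

Definition lvar : E := (psvar k)%:F.

Lemma lvar_neq0 : lvar != 0.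
Proof. by rewrite tofrac_eq0 psvar_neq0. Qed.

Lemma laurent_int_subring : is_subring OE.
Proof.
split; first by exists 1; rewrite ?tofrac1.
  by move=> _ _ [f _ <-] [g _ <-]; exists (f - g); rewrite ?tofracB.
by move=> _ _ [f _ <-] [g _ <-]; exists (f * g); rewrite ?tofracM.
Qed.

Lemma laurent_int_var : OE lvar. Proof. by exists (psvar k). Qed.

Lemma laurent_bounded (x : E) : exists c, OE (lvar ^+ c * x).
Proof.
have [n [d [d0 e]]] := fraction_numden x.
have [m [g [u [dE ug]]]] := ps_factor d0; exists m, (u * n) => //.
rewrite tofracM -e mulrCA -tofracM dE mulrCA ug mulr1 tofracXn mulrC //.
Qed.

Lemma laurent_bounded_fin (I : finType) (x : I -> E) :
  exists c, forall i, OE (lvar ^+ c * x i).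
Proof.
have [c hc] := choice (fun i => laurent_bounded (x i)).
exists (\sum_i c i)%N => i; rewrite (bigD1 i) //= addnC exprD -mulrA.
apply: is_subringM laurent_int_subring _ _ _ (hc i).
by apply: is_subringX laurent_int_subring _ _ laurent_int_var.
Qed.

Lemma laurent_normalize (I : finType) (c : I -> E) : (exists i, c i != 0) ->
  exists j, c j != 0 /\ forall i, OE (c i / c j).
Proof.
move=> [i0 ci0]; have [N hN] := laurent_bounded_fin c.
have T0 : lvar ^+ N != 0 by rewrite expf_neq0 // lvar_neq0.
have /choice[f hf] i : exists f, lvar ^+ N * c i = f%:F.
  by have [f _ <-] := hN i; exists f.
(* d i is the t-adic valuation of t^N c_i, with default 0 when c_i = 0; the minimum below runs over
   the nonzero entries. *)
have /choice[d hd] i : exists d, c i != 0 -> exists g u,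
    f i = psvar k ^+ d * g /\ u * g = 1.
  case: (eqVneq (c i) 0) => [_|ci]; first by exists 0%N.
  have [|n [g [u h]]] := @ps_factor k (f i); last by exists n => _; exists g, u.
  by rewrite -tofrac_eq0 -hf mulf_neq0.
case: (@arg_minnP _ i0 (fun i => c i != 0) d ci0) => j cj min.
exists j; split=> // i; case: (eqVneq (c i) 0) => [->|ci].
  by rewrite mul0r; apply: is_subring0 laurent_int_subring.
have [g [u [fi _]]] := hd i ci; have [g' [u' [fj ug]]] := hd j cj.
exists (psvar k ^+ (d i - d j) * g * u') => //.
apply: (mulIf cj); rewrite divfK //; apply: (mulfI T0).
rewrite mulrCA !hf -tofracM; congr (_ %:F).
rewrite fi fj -{2}(subnK (min i ci)) exprD -[RHS]mulr1 -ug; ring.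
Qed.

(** Take a generating family with r least. In a nontrivial relation, division by the coefficient of
    least valuation expresses one generator integrally by the others, against minimality. *)
Lemma lattice_basis (V : lmodType E) (s : seq V) :
  exists r (e : 'I_r -> V), span_over OE (range e) = span_over OE [set` s] /\
    forall c : 'I_r -> E, \sum_i c i *: e i = 0 -> forall i, c i = 0.
Proof.
have subO := laurent_int_subring.
pose P r := `[< exists e : 'I_r -> V,
  span_over OE (range e) = span_over OE [set` s] >].
have exP : exists r, P r.
  exists (size s); apply/asboolP; exists (fun i => s`_i); congr span_over.
  apply/seteqP; split=> [_ [i _ <-]|x /= xs]; first exact: mem_nth.
  have xi : (index x s < size s)%N by rewrite index_mem.
  by exists (Ordinal xi) => //=; rewrite nth_index.
case: (ex_minnP exP) => r /asboolP[e eE] min; exists r, e; split=> // c c0.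
apply: contrapT => nc.
have [|j [cj hj]] := @laurent_normalize _ c.
  apply: contrapT => nex; apply: nc => i; apply/eqP; apply: contrapT => /negP ci.
  by apply: nex; exists i.
case: r e eE min c c0 {nc} j cj hj => [|r] e eE min c c0; first by case.
move=> j cj hj; suff /min : P r by rewrite ltnn.
apply/asboolP; exists (fun i => e (lift j i)); rewrite -eE; apply/seteqP; split.
  by apply: span_over_sub => // _ [i _ <-]; exists (lift j i).
have ej : e j = \sum_i - (c (lift j i) / c j) *: e (lift j i).
  apply/eqP; rewrite -subr_eq0; apply/eqP; apply: (scalerI cj).
  rewrite scaler0 -[RHS]c0 (bigD1_ord j) //= scalerBr; congr (_ + _).
  rewrite scaler_sumr -sumrN; apply: eq_bigr => i _.
  by rewrite scalerA -scaleNr mulrN mulrCA divff // mulr1 opprK.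
apply: span_over_ind; [exact: span_over0 | exact: span_overD |].
move=> b _ Ob [i _ <-]; apply: span_overZ => //; first exact: is_subringM.
case: (unliftP j i) => [i' ->|->].
  by apply: span_over_incl; [apply: is_subring1 | exists i'].
rewrite ej; apply: span_over_sum => i' _; apply: span_over_gen; last by exists i'.
exact: is_subringN.
Qed.

(* y lies outside t N, and lambda is a coordinate in an O_E-basis of N. *)
Lemma lattice_functional (V : vectType E) (s : seq V) (y : V) :
  span_over OE [set` s] y ->
  (forall y', span_over OE [set` s] y' -> y <> lvar *: y') ->
  exists lam : V -> E,
    [/\ forall u v, lam (u + v) = lam u + lam v,
        forall b v, lam (b *: v) = b * lam v,
        forall v, span_over OE [set` s] v -> OE (lam v)
      & forall z, OE z -> lam y <> lvar * z].
Proof.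
have subO := laurent_int_subring.
have [r [e [<- ind]]] := lattice_basis s => Ny nTy.
pose X := [tuple e i | i < r]; have Xe (i : 'I_r) : X`_i = e i.
  by rewrite -tnth_nth tnth_mktuple.
have freeX : free X.
  apply/freeP => c c0; apply: ind; rewrite -[RHS]c0.
  by apply: eq_bigr => i _; rewrite Xe.
have coordsum (c : 'I_r -> E) j : coord X j (\sum_i c i *: e i) = c j.
  rewrite -[RHS](coord_sum_free c j freeX); congr (coord _ _ _).
  by apply: eq_bigr => i _; rewrite Xe.
have repr v : span_over OE (range e) v ->
    exists2 c : 'I_r -> E, forall i, OE (c i) & v = \sum_i c i *: e i.
  move: v; apply: (@span_over_ind _ _ _ _ (fun v =>
    exists2 c : 'I_r -> E, forall i, OE (c i) & v = \sum_i c i *: e i)).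
  - exists (fun=> 0); first by move=> _; apply: is_subring0.
    by rewrite big1 // => i _; rewrite scale0r.
  - move=> _ _ [c Oc ->] [d Od ->]; exists (fun i => c i + d i).
      by move=> i; apply: is_subringD.
    by rewrite -big_split; apply: eq_bigr => i _; rewrite scalerDl.
  move=> b _ Ob [j _ <-]; exists (fun i => if i == j then b else 0).
    by move=> i; case: ifP => // _; apply: is_subring0.
  rewrite (bigD1 j) //= eqxx big1 ?addr0 // => i /negPf->.
  by rewrite scale0r.
have [c Oc yE] := repr y Ny.
have [j cj] : exists j, forall z, OE z -> c j <> lvar * z.
  apply: contrapT => nex.
  have /choice[z hz] i : exists z, OE z /\ c i = lvar * z.
    apply: contrapT => nz; apply: nex; exists i => z Oz ce.
    by apply: nz; exists z.
  apply: (nTy (\sum_i z i *: e i)).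
    apply: span_over_sum => i _; apply: span_over_gen; last by exists i.
    by case: (hz i).
  rewrite yE scaler_sumr; apply: eq_bigr => i _; rewrite scalerA.
  by case: (hz i) => _ <-.
exists (coord X j : V -> E); split.
- by move=> u v; rewrite linearD.
- by move=> b v; rewrite linearZ.
- by move=> v /repr[d Od ->]; rewrite coordsum.
by move=> z Oz; rewrite yE coordsum; apply: cj.
Qed.

Lemma laurent_pow_var (x : E) n z : OE x -> OE z -> x ^+ n = lvar * z ->
  exists2 z', OE z' & x = lvar * z'.
Proof.
move=> [f _ <-] [g _ <-]; rewrite -tofracXn -tofracM => /eqP.
rewrite tofrac_eq => /eqP fg.
have [h ->] : exists h, f = psvar k * h.
  apply: psvar_dvd; apply/eqP; have := congr1 (fun f => pscoef f 0) fg.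
  rewrite pscoefM0 mul0r pscoefX0 => /eqP; rewrite expf_eq0.
  by case/andP.
by exists h%:F; [exists h | rewrite tofracM].
Qed.

End Laurent.

Lemma finfield_exprD (F : finFieldType) (R : comNzRingType) (f : {rmorphism F -> R})
  (x y : R) : (x + y) ^+ #|F| = x ^+ #|F| + y ^+ #|F|.
Proof.
have [p pr_p pF] := finPcharP F; have pR := rmorph_pchar f pF.
apply: exprDn_pchar; rewrite (eq_pnat _ (pcharf_eq pR)) -cardsT.
exact: abelian.abelem_pgroup (abelian.fin_ring_pchar_abelem pF).
Qed.

(** A subspace B that contains U and is maximal among those missing y is a hyperplane: adjoining any
    x outside B captures y. Then chi reads off the coefficient along y modulo B. *)
Lemma linear_functional (F : fieldType) (K : nzRingType) (f : {rmorphism F -> K})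
    (U : set K) (y : K) :
  U 0 -> (forall u v, U u -> U v -> U (u + v)) ->
  (forall c u, U u -> U (f c * u)) -> ~ U y ->
  exists chi : K -> F,
    [/\ forall u v, chi (u + v) = chi u + chi v,
        forall c u, chi (f c * u) = c * chi u, forall u, U u -> chi u = 0
      & chi y = 1].
Proof.
move=> U0 UD UM nUy.
pose good (B : set K) := [/\ forall u v, B u -> B v -> B (u + v),
  forall c u, B u -> B (f c * u), U `<=` B & ~ B y].
have [|B [PB maxB]] := @Zorn_bigcup K (fun B => B = set0 \/ good B).
  move=> Fm FmP tot.
  case: (pselect (exists2 B, Fm B & good B)) => [[B0 FB0 gB0]|nex]; last first.
    left; apply/seteqP; split=> // x [B FB Bx].
    case: (FmP B FB) => [B0|gB]; first by move: Bx; rewrite B0.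
    by case: nex; exists B.
  have goodin B x : Fm B -> B x -> good B.
    by move=> FB Bx; case: (FmP _ FB) => // e; move: Bx; rewrite e.
  right; split.
  - move=> u v [B FB Bu] [B' FB' Bv].
    by case: (tot _ _ FB FB') => s; [exists B' | exists B] => //;
      [case: (goodin _ _ FB' Bv) | case: (goodin _ _ FB Bu)] => + _ _ _; apply =>
        //; apply: s.
  - by move=> c u [B FB Bu]; exists B => //; case: (goodin _ _ FB Bu) => _ + _ _;
    apply.
  - by move=> u Uu; exists B0 => //; case: gB0 => _ _ + _; apply.
  by move=> [B FB By]; case: (goodin _ _ FB By).
have gU : good U by split.
have gB : good B.
  case: PB => // B0; case: (maxB U); last by right.
  by rewrite B0; split=> // /(_ 0 U0).
have [BD BM UB nBy] := gB; have B0 : B 0 by apply: UB.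
have /choice[chi hchi] x : exists c, exists2 b, B b & x = b + f c * y.
  case: (pselect (B x)) => [Bx|nBx].
    by exists 0, x => //; rewrite rmorph0 mul0r addr0.
  pose B' : set K := [set z | exists b c, B b /\ z = b + f c * x].
  have [b [c [Bb yE]]] : B' y.
    apply: contrapT => nB'y; apply: (maxB B'); last first.
      right; split=> //.
      - move=> _ _ [b [c [Bb ->]]] [b' [c' [Bb' ->]]].
        exists (b + b'), (c + c'); split; first exact: BD.
        by rewrite rmorphD mulrDl addrACA.
      - move=> d _ [b [c [Bb ->]]]; exists (f d * b), (d * c).
        by split; [apply: BM | rewrite mulrDr mulrA rmorphM].
      by move=> u Uu; exists u, 0; split; [apply: UB | rewrite rmorph0 mul0r addr0].
    split; last first.
      by move=> sub; apply: nBx; apply: sub; exists 0, 1;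
        rewrite rmorph1 mul1r add0r.
    by move=> b Bb; exists b, 0; rewrite rmorph0 mul0r addr0.
  have c0 : c != 0.
    by apply/negP => /eqP c0; apply: nBy; rewrite yE c0 rmorph0 mul0r addr0.
  exists c^-1, (f (- c^-1) * b); first exact: BM.
  rewrite [in RHS]yE mulrDr !mulrA -rmorphM mulVf // rmorph1 mul1r addrA.
  by rewrite -mulrDl -rmorphD addNr rmorph0 mul0r add0r.
have uniq b b' c c' : B b -> B b' -> b + f c * y = b' + f c' * y -> c = c'.
  move=> Bb Bb' e; apply/eqP; rewrite -subr_eq0; apply: contrapT => /negP d0.
  apply: nBy; have -> : y = f (c - c')^-1 * (b' + f (-1) * b).
    have -> : b' + f (- 1) * b = f (c - c') * y.
      rewrite rmorphN rmorph1 mulN1r rmorphB mulrBl.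
      by apply/eqP; rewrite subr_eq addrAC eq_sym subr_eq addrC -e addrC.
    by rewrite mulrA -rmorphM mulVf // rmorph1 mul1r.
  by apply: (BM); apply: BD => //; apply: BM.
exists chi; split.
- move=> u v; have [b Bb uE] := hchi u; have [b' Bb' vE] := hchi v.
  have [b'' Bb'' e] := hchi (u + v); apply: (uniq b'' (b + b')) => //.
    exact: BD.
  by rewrite -e rmorphD mulrDl addrACA -uE -vE.
- move=> c u; have [b Bb uE] := hchi u; have [b' Bb' e] := hchi (f c * u).
  apply: (uniq b' (f c * b)) => //; first exact: BM.
  by rewrite -e rmorphM -mulrA -mulrDr -uE.
- move=> u /UB Bu; have [b Bb uE] := hchi u; apply: (uniq b u) => //.
  by rewrite -uE rmorph0 mul0r addr0.
have [b Bb yE] := hchi y; apply: (uniq b 0) => //.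
by rewrite -yE rmorph1 mul1r add0r.
Qed.

(** * Noetherian modules and generation by universal properties *)

Definition noetherian (R : comNzRingType) : Prop := forall I : set R,
  is_ideal I -> exists s : seq R, I = span_over (M := R^o) setT [set` s].

Section Hilbert.
Variable R : comNzRingType.
Hypothesis noethR : noetherian R.

Lemma span_over_ideal (S : comNzRingType) (X : set S) :
  is_ideal (span_over (M := S^o) setT X).
Proof.
split; first exact: (@span_over0 _ S^o).
  by move=> x y; apply: (@span_overD _ S^o).
by move=> r x; apply: (@span_overZ _ S^o).
Qed.

Lemma noetherian_chain (a : nat -> R) :
  exists N, span_over (M := R^o) setT [set a i | i in [set i | (i < N)%N]] (a N).
Proof.
pose J N : set R := span_over (M := R^o) setT [set a i | i in [set i | (i < N)%N]].
have Jle N N' : (N <= N')%N -> J N `<=` J N'.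
  move=> le; apply: (@span_over_sub _ R^o) => // _ [i /= lt <-].
  by exists i => //=; apply: leq_trans le.
have [s hs] := noethR (span_over_ideal (range a)).
have bound x : span_over (M := R^o) setT (range a) x -> exists N, J N x.
  move: x; apply: (@span_over_ind _ R^o).
  - by exists 0%N; apply: span_over0.
  - move=> x y [N Nx] [N' Ny]; exists (N + N')%N; apply: span_overD.
      exact: Jle (leq_addr _ _) _ Nx.
    exact: Jle (leq_addl _ _) _ Ny.
  move=> c _ _ [i _ <-]; exists i.+1; apply: span_over_gen => //.
  by exists i => /=.
have [N hN] : exists N, forall x, x \in s -> J N x.
  have : forall x, x \in s -> span_over (M := R^o) setT (range a) x.
    by rewrite hs => x xs; apply: (@span_over_incl _ R^o).
  elim: (s) => [|x s' IH] hx; first by exists 0%N.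
  have [N Nx] := bound x (hx x (mem_head _ _)).
  have [|N' hN'] := IH; first by move=> y ys; apply: hx; rewrite inE ys orbT.
  exists (N + N')%N => y; rewrite inE => /orP[/eqP->|/hN'].
    exact: Jle (leq_addr _ _) _ Nx.
  exact: Jle (leq_addl _ _) _.
exists N; have : span_over (M := R^o) setT (range a) (a N).
  by apply: (@span_over_incl _ R^o) => //; exists N.
rewrite hs; move: (a N); apply: (@span_over_ind _ R^o).
- exact: span_over0.
- exact: span_overD.
by move=> c x _ /hN; apply: (@span_overZ _ R^o).
Qed.

(** If I is not finitely generated, choose successively f_n of least degree in I outside the span of
    its predecessors. Some leading coefficient of f_N is a combination of earlier ones; subtracting
    the matching q from f_N lowers the degree but stays outside that span. *)
Theorem hilbert_basis : noetherian {poly R}.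
Proof.
move=> I idI; have [I0 ID IM] := idI.
have IB x y : I x -> I y -> I (x - y).
  by move=> Ix Iy; apply: ID => //; rewrite -mulN1r; apply: IM.
pose sp (s : seq {poly R}) : set {poly R} :=
  span_over (M := {poly R}^o) setT [set` s].
have spI s : (forall x, x \in s -> I x) -> sp s `<=` I.
  move=> sI; apply: (@span_over_ind _ {poly R}^o) => // c x _ /sI.
  exact: IM.
apply: contrapT => nfg.
(* p has least size in I outside the span of s; 0 is the default when s is not contained in I. *)
have /choice[next hnext] (s : seq {poly R}) : exists p,
    (forall x, x \in s -> I x) -> [/\ I p, ~ sp s p &
      forall q, I q -> ~ sp s q -> (size p <= size q)%N].
  case: (pselect (forall x, x \in s -> I x)) => [sI|nsI]; last by exists 0.
  have ex : exists n, `[< exists p, [/\ I p, ~ sp s p & size p = n] >].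
    apply: contrapT => nex; apply: nfg; exists s; apply/seteqP; split.
      move=> p Ip; apply: contrapT => np; apply: nex; exists (size p).
      by apply/asboolP; exists p.
    exact: spI.
  case: (ex_minnP ex) => n /asboolP[p [Ip np pn]] min; exists p => _; split=> //.
  by move=> q Iq nq; rewrite pn; apply: min; apply/asboolP; exists q.
(* [l n] lists f_0, ..., f_(n-1). *)
pose l := fix l n := if n is n'.+1 then rcons (l n') (next (l n')) else [::].
pose f n := next (l n).
have lE n x : x \in l n -> exists2 i, (i < n)%N & x = f i.
  elim: n => [//|n IH] /=; rewrite mem_rcons inE => /orP[/eqP->|/IH[i lt ->]].
    by exists n.
  by exists i => //; apply: leqW.
have lI n x : x \in l n -> I x.
  elim: n x => [//|n IH] x /=; rewrite mem_rcons inE => /orP[/eqP->|/IH //].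
  by case: (hnext _ IH).
have fl i n : (i < n)%N -> f i \in l n.
  elim: n => [//|n IH]; rewrite ltnS leq_eqVlt /= mem_rcons inE.
  by case/orP => [/eqP->|/IH ->]; rewrite ?eqxx ?orbT.
have fP n : [/\ I (f n), ~ sp (l n) (f n) &
    forall q, I q -> ~ sp (l n) q -> (size (f n) <= size q)%N].
  by apply: hnext => x; apply: lI.
have sp_le i n : (i <= n)%N -> sp (l i) `<=` sp (l n).
  move=> le; apply: (@span_over_sub _ {poly R}^o) => // x /= /lE[j lt ->].
  by apply: fl; apply: leq_trans le.
have f0 n : f n != 0.
  apply/negP => /eqP e; have [_ + _] := fP n; apply.
  by rewrite e; apply: span_over0.
have size_le i n : (i <= n)%N -> (size (f i) <= size (f n))%N.
  move=> le; have [_ _ min] := fP i; have [If nf _] := fP n; apply: min => //.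
  by move/(sp_le _ _ le).
have [N hN] := noetherian_chain (fun n => lead_coef (f n)).
have [q [lq sq Lq]] : exists q, [/\ sp (l N) q, (size q <= size (f N))%N &
    q`_(size (f N)).-1 = lead_coef (f N)].
  move: hN.
  suff : span_over (M := R^o) setT [set lead_coef (f i) | i in [set i | (i < N)%N]]
    `<=` [set z | exists q, [/\ sp (l N) q, (size q <= size (f N))%N &
    q`_(size (f N)).-1 = z]] by apply.
  apply: (@span_over_ind _ R^o).
  - by exists 0; split; [apply: span_over0 | rewrite size_poly0 | rewrite coef0].
  - move=> _ _ [p [lp sp' <-]] [p' [lp' sp'' <-]]; exists (p + p'); split.
    + exact: span_overD.
    + by rewrite (leq_trans (size_polyD _ _)) // geq_max sp' sp''.
    + by rewrite coefD.
  move=> c _ _ [i /= lt <-]; have le := size_le i N (ltnW lt).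
  have si : (0 < size (f i))%N by rewrite lt0n size_poly_eq0.
  exists (c%:P * 'X^(size (f N) - size (f i)) * f i); split.
  - by apply: (@span_over_gen _ {poly R}^o) => //=; apply: fl.
  - rewrite -mulrA mul_polyC (leq_trans (size_scale_leq _ _)) //.
    by rewrite mulrC size_mulXn // subnK.
  rewrite -mulrA coefCM coefXnM /lead_coef.
  have -> : ((size (f N)).-1 < size (f N) - size (f i))%N = false.
    apply/negbTE; rewrite -leqNgt leq_subLR; case: (size (f i)) si => // d _.
    by rewrite addSn (leq_trans (leqSpred _)) // ltnS leq_addl.
  congr (_ * _`__); move: le si; case: (size (f i)) => // d le _ /=.
  by rewrite -{1}(subnK le) addnS /= addKn.
have [If nf min] := fP N.
have nfq : ~ sp (l N) (f N - q).
  by move=> h; apply: nf; rewrite -(subrK q (f N)); apply: span_overD.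
have := min _ (IB _ _ If (spI _ (@lI N) _ lq)) nfq.
have sN : (0 < size (f N))%N by rewrite lt0n size_poly_eq0.
apply/negP; rewrite -ltnNge -(prednK sN) ltnS; apply/leq_sizeP => j.
rewrite leq_eqVlt coefB => /orP[/eqP<-|]; first by rewrite Lq subrr.
rewrite (prednK sN) => lt; rewrite !nth_default ?subr0 //.
exact: leq_trans lt.
Qed.

End Hilbert.

(** Scalars act through th, so that a noetherian ring can act on modules over a larger ring.
    Induction on the generators: the coefficients at g0 of elements of X form an ideal, and after
    subtracting lifts of its generators the remainder lies in the span of the tail. *)
Lemma noetherian_submodule (B R : comNzRingType) (th : {rmorphism B -> R})
    (N : lmodType R) (g : seq N) (X : set N) : noetherian B ->
  X 0 -> (forall x y, X x -> X y -> X (x + y)) ->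
  (forall b x, X x -> X (th b *: x)) ->
  X `<=` span_over (range th) [set` g] ->
  exists s : seq N, X = span_over (range th) [set` s].
Proof.
move=> noethB; elim: g X => [|g0 g IH] X X0 XD XM Xg.
  exists [::]; apply/seteqP; split=> x; first exact: Xg.
  by move: x; apply: span_over_ind.
have B1 : range th 1 by exists 1; rewrite ?rmorph1.
have XB x y : X x -> X y -> X (x - y).
  move=> Xx Xy; apply: XD => //.
  by rewrite -scaleN1r -(rmorph1 th) -rmorphN; apply: XM.
have spM b x : span_over (range th) [set` g] x ->
    span_over (range th) [set` g] (th b *: x).
  apply: span_overZ; last by exists b.
  by move=> _ _ [c _ <-] [d _ <-]; exists (c * d); rewrite ?rmorphM.
have dec x : span_over (range th) [set` g0 :: g] x -> exists b w,
    span_over (range th) [set` g] w /\ x = th b *: g0 + w.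
  move: x; apply: (@span_over_ind _ _ _ _ (fun x => exists b w,
    span_over (range th) [set` g] w /\ x = th b *: g0 + w)).
  - by exists 0, 0; rewrite rmorph0 scale0r addr0; split=> //; apply: span_over0.
  - move=> _ _ [b [w [gw ->]]] [b' [w' [gw' ->]]]; exists (b + b'), (w + w').
    by split; [apply: span_overD | rewrite rmorphD scalerDl addrACA].
  move=> _ x [b _ <-] /=; rewrite inE => /orP[/eqP->|gx].
    by exists b, 0; rewrite addr0; split=> //; apply: span_over0.
  exists 0, (th b *: x); rewrite rmorph0 scale0r add0r; split=> //.
  by apply: span_over_gen => //; exists b.
pose I : set B := [set b | exists w, span_over (range th) [set` g] w /\
  X (th b *: g0 + w)].
have idI : is_ideal I.
  split.
  - by exists 0; rewrite rmorph0 scale0r addr0; split=> //; apply: span_over0.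
  - move=> b b' [w [gw Xw]] [w' [gw' Xw']]; exists (w + w').
    by rewrite rmorphD scalerDl addrACA; split; [apply: span_overD | apply: XD].
  move=> b b' [w [gw Xw]]; exists (th b *: w); split; first exact: spM.
  by rewrite rmorphM -scalerA -scalerDr; apply: XM.
have [t tI] := noethB I idI.
have /choice[wt hwt] b : exists w, b \in t ->
    span_over (range th) [set` g] w /\ X (th b *: g0 + w).
  case: (boolP (b \in t)) => [bt|_]; last by exists 0.
  have [w hw] : I b by rewrite tI; apply: (@span_over_incl _ B^o).
  by exists w.
pose X' : set N := X `&` span_over (range th) [set` g].
have [||||s' s'E] := IH X'.
- by split=> //; apply: span_over0.
- by move=> x y [Xx gx] [Xy gy]; split; [apply: XD | apply: span_overD].
- by move=> b x [Xx gx]; split; [apply: XM | apply: spM].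
- by move=> x [].
pose s := [seq th b *: g0 + wt b | b <- t] ++ s'; exists s.
have sX x : x \in s -> X x.
  rewrite mem_cat => /orP[/mapP[b bt ->]|xs']; first by case: (hwt b bt).
  suff: X' x by case.
  by rewrite s'E; apply: span_over_incl.
apply/seteqP; split; last first.
  by apply: span_over_ind => // _ x [b _ <-] /sX; apply: XM.
move=> x Xx; have [b [w [gw xE]]] := dec x (Xg x Xx).
have Ib : span_over (M := B^o) setT [set` t] b.
  by rewrite -tI; exists w; rewrite -xE.
have [w' [sw' gw']] : exists w', span_over (range th) [set` s] (th b *: g0 + w') /\
    span_over (range th) [set` g] w'.
  move: b Ib {xE}; apply: (@span_over_ind _ B^o _ _ (fun b => exists w',
    span_over (range th) [set` s] (th b *: g0 + w') /\
    span_over (range th) [set` g] w')).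
  - exists 0; rewrite rmorph0 scale0r addr0.
    by split; apply: span_over0.
  - move=> b b' [v [sv gv]] [v' [sv' gv']]; exists (v + v').
    by rewrite rmorphD scalerDl addrACA; split; apply: span_overD.
  move=> c b _ /= bt; exists (th c *: wt b); split.
    rewrite rmorphM -scalerA -scalerDr; apply: span_over_gen; first by exists c.
    by rewrite /= mem_cat; apply/orP; left; apply/mapP; exists b.
  by apply: spM; case: (hwt b bt).
have Xs y : span_over (range th) [set` s] y -> X y.
  by move: y; apply: span_over_ind => // _ y [c _ <-] /sX; apply: XM.
have : X' (w - w').
  split; last first.
    apply: span_overD => //; rewrite -scaleN1r -(rmorph1 th) -rmorphN.
    exact: spM.
  have -> : w - w' = x - (th b *: g0 + w') by rewrite xE opprD addrACA subrr add0r.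
  by apply: XB => //; apply: Xs.
rewrite s'E => ww'.
have -> : x = (th b *: g0 + w') + (w - w').
  by rewrite xE -addrA [w' + _]addrC subrK.
apply: span_overD => //; apply: span_over_sub ww' => // y /= ys.
by rewrite mem_cat ys orbT.
Qed.

(** * Submodules and subgroups as types, to serve as targets of universal maps *)

Record submodule_set (R : nzRingType) (M : lmodType R) := SubmoduleSet {
  submodule_carrier : set M;
  submoduleP : submodule_carrier 0 /\ forall a x y,
    submodule_carrier x -> submodule_carrier y -> submodule_carrier (a *: x + y)
}.

Section SubmoduleType.
Variables (R : nzRingType) (M : lmodType R) (P : submodule_set M).

Definition submodule_pred : {pred M} := fun x => `[< submodule_carrier P x >].

Fact submodule_pred_closed : submod_closed submodule_pred.
Proof.
have [P0 PD] := submoduleP P; split; first exact/asboolP.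
by move=> a x y /asboolP Px /asboolP Py; apply/asboolP; apply: PD.
Qed.

HB.instance Definition _ :=
  GRing.isSubmodClosed.Build R M submodule_pred submodule_pred_closed.

Record submodule_type :=
  SubmoduleType { submodule_val : M;
    submodule_valP : submodule_val \in submodule_pred }.

HB.instance Definition _ := [isSub for submodule_val].
HB.instance Definition _ := [Choice of submodule_type by <:].
HB.instance Definition _ := [SubChoice_isSubLmodule of submodule_type by <:].

End SubmoduleType.

(* Uniqueness in the universal property identifies the identity of N with the
   retraction N -> P -> N. *)
Lemma base_change_generated (R S : nzRingType) (f : R -> S)
    (M : lmodType R) (N : lmodType S) (eta : M -> N) (P : set N) :
  is_base_change f eta -> P 0 -> (forall a x y, P x -> P y -> P (a *: x + y)) ->
  (forall m, P (eta m)) -> P = setT.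
Proof.
move=> [[etaD etaZ] univ] P0 PD Peta.
pose Q := SubmoduleSet (conj P0 PD).
have Qeta m : eta m \in submodule_pred Q by apply/asboolP; apply: Peta.
pose g m : submodule_type Q := SubmoduleType (Qeta m).
have [|h hg _] := univ (submodule_type Q) g.
  by split=> [x y|r x]; apply: val_inj; rewrite /= ?etaD ?etaZ.
have semieta : Defs.semilinear_for f eta by split.
have [h0 _ uniq] := univ N eta semieta.
have e1 : (\val : submodule_type Q -> N) \o h =1 h0.
  by apply: uniq => m /=; rewrite hg.
have e2 : idfun =1 h0 by exact: uniq.
apply/seteqP; split=> // x _; have -> : x = \val (h x) by rewrite [RHS]e1 -e2.
by case: (h x) => y /= /asboolP.
Qed.

Record zsubgroup_set (M : zmodType) := ZsubgroupSet {
  zsubgroup_carrier : set M;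
  zsubgroupP : zsubgroup_carrier 0 /\ forall x y,
    zsubgroup_carrier x -> zsubgroup_carrier y -> zsubgroup_carrier (x - y)
}.

Section ZsubgroupType.
Variables (M : zmodType) (P : zsubgroup_set M).

Definition zsubgroup_pred : {pred M} := fun x => `[< zsubgroup_carrier P x >].

Fact zsubgroup_pred_closed : zmod_closed zsubgroup_pred.
Proof.
have [P0 PB] := zsubgroupP P; split; first exact/asboolP.
by move=> x y /asboolP Px /asboolP Py; apply/asboolP; apply: PB.
Qed.

HB.instance Definition _ :=
  GRing.isZmodClosed.Build M zsubgroup_pred zsubgroup_pred_closed.

Record zsubgroup_type :=
  ZsubgroupType { zsubgroup_val : M;
    zsubgroup_valP : zsubgroup_val \in zsubgroup_pred }.

HB.instance Definition _ := [isSub for zsubgroup_val].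
HB.instance Definition _ := [Choice of zsubgroup_type by <:].
HB.instance Definition _ := [SubChoice_isSubZmodule of zsubgroup_type by <:].

End ZsubgroupType.

Section TensorSums.
Variables (F A E : comNzRingType) (fA : F -> A) (fE : F -> E).
Variable T : tensor_algebra fA fE.

Let sums : set T := [set r | exists n (a : 'I_n -> A) (x : 'I_n -> E),
  r = \sum_j tens_inl T (a j) * tens_inr T (x j)].

(** As for base change: the identity and the composite T -> sums -> T agree on pure tensors, hence
    everywhere by uniqueness in [tens_univ]. *)
Lemma tens_ring_sums (r : T) : exists n (a : 'I_n -> A) (x : 'I_n -> E),
  r = \sum_j tens_inl T (a j) * tens_inr T (x j).
Proof.
have s1 a x : sums (tens_inl T a * tens_inr T x).
  by exists 1%N, (fun=> a), (fun=> x); rewrite big_ord1.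
have s0 : sums 0 by rewrite -(mul0r (tens_inr T 0)) -(rmorph0 (tens_inl T)).
have sE : sums = span_over (M := T^o)
    [set u | exists a, u = tens_inl T a] [set v | exists x, v = tens_inr T x].
  apply/seteqP; split=> [_ [n [a [x ->]]]|_ [n [c [v [hc hv ->]]]]].
    exists n, (fun j => tens_inl T (a j)), (fun j => tens_inr T (x j)).
    by split=> // j; eexists.
  have [a ha] := choice hc; have [x hx] := choice hv; exists n, a, x.
  by apply: eq_bigr => j _; rewrite ha hx.
have sD u v : sums u -> sums v -> sums (u + v).
  by rewrite sE; apply: (@span_overD _ T^o).
have sN u : sums u -> sums (- u).
  move=> [n [a [x ->]]]; exists n, (fun j => - a j), x.
  by rewrite -sumrN; apply: eq_bigr => j _; rewrite rmorphN mulNr.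
pose Q := ZsubgroupSet (conj s0 (fun u v su sv => sD u (- v) su (sN v sv))).
have Qt a x : tens_inl T a * tens_inr T x \in zsubgroup_pred Q.
  by apply/asboolP; apply: s1.
pose b a x : zsubgroup_type Q := ZsubgroupType (Qt a x).
have [|||h hb _] := @tens_univ _ _ _ _ _ T (zsubgroup_type Q) b.
- by move=> a a' x; apply: val_inj; rewrite /= rmorphD mulrDl.
- by move=> a x x'; apply: val_inj; rewrite /= rmorphD mulrDr.
- by move=> c a x; apply: val_inj; rewrite /= !rmorphM tens_const -mulrA mulrCA.
have [|||h0 _ uniq] := @tens_univ _ _ _ _ _ T T
  (fun a x => tens_inl T a * tens_inr T x).
- by move=> a a' x; rewrite rmorphD mulrDl.
- by move=> a x x'; rewrite rmorphD mulrDr.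
- by move=> c a x; rewrite !rmorphM tens_const -mulrA mulrCA.
have e1 : (\val : zsubgroup_type Q -> T) \o h =1 h0.
  by apply: uniq => a x /=; rewrite hb.
have e2 : idfun =1 h0 by exact: uniq.
have -> : r = \val (h r) by rewrite [RHS]e1 -e2.
by case: (h r) => y /= /asboolP.
Qed.

End TensorSums.

(** * The tensor product A (x) E *)

Section LocallyFree.
Variables (R : comNzRingType) (M : lmodType R).
Hypothesis torsion_bounded : forall f : R,
  exists B, forall K y, f ^+ K * y = 0 -> f ^+ B * y = 0.

(** Finite generation gives one N such that all f^N m have coordinates in e. These are determined
    only up to f-power torsion, so linearity holds after multiplication by the f^B that kills this
    torsion; the results are forms on M itself, with values in R. *)
Lemma loc_basis_coordinates (f : R) r (e : 'I_r -> M) (s : seq M) :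
  span_over setT [set` s] = setT -> loc_basis f e ->
  exists psi : 'I_r -> M -> R,
    (forall j a x y, psi j (a *: x + y) = a * psi j x + psi j y) /\
    forall m, (forall j, psi j m = 0) -> exists K, f ^+ K *: m = 0.
Proof.
move=> hs [gen ind]; have [B hB] := torsion_bounded f.
have [N hN] : exists N, forall m, exists c : 'I_r -> R,
  f ^+ N *: m = \sum_i c i *: e i.
  have [Ng hNg] := choice gen; pose n (j : 'I_(size s)) := Ng s`_j.
  exists (\sum_j n j)%N => m.
  have : span_over setT [set` s] m by rewrite hs.
  move/span_over_seq => [//|//|x _ ->].
  have /choice[c hc] (j : 'I_(size s)) : exists c : 'I_r -> R,
      f ^+ (\sum_j n j)%N *: s`_j = \sum_i c i *: e i.
    have [c hc] := hNg s`_j.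
    exists (fun i => f ^+ (\sum_(j' | j' != j) n j')%N * c i).
    rewrite (bigD1 j) //= addnC exprD -scalerA hc scaler_sumr.
    by apply: eq_bigr => i _; rewrite scalerA.
  exists (fun i => \sum_j x j * c j i); rewrite scaler_sumr.
  transitivity (\sum_j \sum_i (x j * c j i) *: e i).
    apply: eq_bigr => j _; rewrite scalerA mulrC -scalerA hc scaler_sumr.
    by apply: eq_bigr => i _; rewrite scalerA.
  by rewrite exchange_big; apply: eq_bigr => i _; rewrite scaler_suml.
have [c hc] := choice hN; exists (fun j m => f ^+ B * c m j); split.
  move=> j a x y; apply/eqP; rewrite -subr_eq0; apply/eqP.
  have -> : f ^+ B * c (a *: x + y) j - (a * (f ^+ B * c x j) + f ^+ B * c y j)
    = f ^+ B * (c (a *: x + y) j - a * c x j - c y j) by ring.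
  have [|K hK] := ind (fun j => c (a *: x + y) j - a * c x j - c y j).
    under eq_bigr => i _ do rewrite !scalerBl -scalerA.
    rewrite !sumrB -scaler_sumr -!hc scalerDr !scalerA mulrC -!scalerA.
    by rewrite addrAC addrK subrr.
  exact: hB (hK j).
move=> m m0; exists (B + N)%N; rewrite exprD -scalerA hc scaler_sumr big1 // => j _.
by rewrite scalerA m0 scale0r.
Qed.

(** Used with J the annihilator of an element whose local coordinates all vanish. *)
Lemma power_annihilated (J : set R) n (f c : 'I_n -> R) : is_ideal J ->
  \sum_i c i * f i = 1 -> (forall i, exists K, J (f i ^+ K)) -> J 1.
Proof.
move=> [J0 JD JM] c1 fJ.
suff [K] : exists K, J ((\sum_i c i * f i) ^+ K) by rewrite c1 expr1n.
apply: (big_ind (fun x => exists K, J (x ^+ K))).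
- by exists 1%N; rewrite expr1.
- move=> x y [a Ja] [b Jb]; exists (a + b)%N; rewrite exprDn.
  apply: is_ideal_sum => // i _; rewrite -mulr_natl; apply: (JM).
  case: (leqP b i) => [bi|/ltnW ib].
    by rewrite -(subnK bi) exprD mulrA; apply: JM.
  by rewrite -(addnBA _ ib) addnC exprD mulrAC; apply: JM.
by move=> i _; have [K JK] := fJ i; exists K; rewrite exprMn; apply: JM.
Qed.

Lemma locally_free_embedding r (s : seq M) :
  span_over setT [set` s] = setT -> locally_free_rank M r ->
  exists N (psi : 'I_N -> M -> R),
    (forall j a x y, psi j (a *: x + y) = a * psi j x + psi j y) /\
    forall m, (forall j, psi j m = 0) -> m = 0.
Proof.
move=> hs [n [f [[c c1] hf]]].
have /choice[psi hpsi] i : exists psi : 'I_r -> M -> R,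
    (forall j a x y, psi j (a *: x + y) = a * psi j x + psi j y) /\
    forall m, (forall j, psi j m = 0) -> exists K, f i ^+ K *: m = 0.
  by have [e he] := hf i; apply: loc_basis_coordinates hs he.
exists #|{: 'I_n * 'I_r}|, (fun j => psi (enum_val j).1 (enum_val j).2); split.
  by move=> j; case: (hpsi (enum_val j).1) => + _; apply.
move=> m m0; rewrite -[m]scale1r.
apply: (@power_annihilated [set x | x *: m = 0] n f c) => //.
  split=> [|x y /= xm ym|x y /= ym].
  - by rewrite /= scale0r.
  - by rewrite scalerDl xm ym addr0.
  - by rewrite -scalerA ym scaler0.
move=> i; case: (hpsi i) => _; apply => j.
by have := m0 (enum_rank (i, j)); rewrite enum_rankK.
Qed.

End LocallyFree.


Section Tensor.
Variables (F : finFieldType) (C : pointed_curve F) (k : fieldType).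
Variable i : {rmorphism F -> k}.
Local Notation A := (coord_ring C).
Local Notation E := (laurent k).
Local Notation cc := (coord_const C).
Local Notation cE := (laurent_const i).
Local Notation OE := (@laurent_int k).

Fact laurent_const_is_zmod_morphism : zmod_morphism cE.
Proof.
move=> x y; rewrite /laurent_const -tofracB; congr (_ %:F).
by apply: pseriesP => -[|n] /=; rewrite ?rmorphB ?subr0.
Qed.
Fact laurent_const_is_monoid_morphism : monoid_morphism cE.
Proof.
split; first by rewrite /laurent_const rmorph1 -[RHS]tofrac1.
move=> x y; rewrite /laurent_const -tofracM; congr (_ %:F).
apply: pseriesP => n; rewrite pscoefM big_ord_recl /= subn0.
rewrite big1 ?addr0 => [|j _]; last by rewrite mul0r.
by case: n => [|n] /=; rewrite ?rmorphM ?mulr0.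
Qed.
HB.instance Definition _ := GRing.isZmodMorphism.Build F E cE
  laurent_const_is_zmod_morphism.
HB.instance Definition _ := GRing.isMonoidMorphism.Build F E cE
  laurent_const_is_monoid_morphism.

Lemma laurent_const_int c : OE (cE c). Proof. by exists (psC (i c)). Qed.

Variable AE : tensor_algebra cc cE.
Local Notation AO := (@tens_int F C k i AE).
Local Notation lpowAE l n := (@lpow_mul F C k i AE l n (AE : comNzRingType)^o setT).

Lemma tensDl a b x : tens AE (a + b) x = tens AE a x + tens AE b x.
Proof. by rewrite /tens rmorphD mulrDl. Qed.
Lemma tensDr a x y : tens AE a (x + y) = tens AE a x + tens AE a y.
Proof. by rewrite /tens rmorphD mulrDr. Qed.
Lemma tensM a b x y : tens AE (a * b) (x * y) = tens AE a x * tens AE b y.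
Proof. by rewrite /tens !rmorphM mulrACA. Qed.
Lemma tens1l x : tens AE 1 x = tens_inr AE x.
Proof. by rewrite /tens rmorph1 mul1r. Qed.
Lemma tens1r a : tens AE a 1 = tens_inl AE a.
Proof. by rewrite /tens rmorph1 mulr1. Qed.
Lemma tensE a x : tens AE a x = tens AE 1 x * tens AE a 1.
Proof. by rewrite -tensM mul1r mulr1. Qed.
Lemma tens_sum_r (I : Type) (r : seq I) (P : pred I) (G : I -> E) a :
  tens AE a (\sum_(j <- r | P j) G j) = \sum_(j <- r | P j) tens AE a (G j).
Proof. by rewrite /tens rmorph_sum mulr_sumr. Qed.
Lemma tens_const_r c a x : tens AE a (cE c * x) = tens AE (cc c * a) x.
Proof. by rewrite /tens !rmorphM tens_const mulrCA mulrA. Qed.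

Lemma tens_intE : AO = span_over (M := (AE : comNzRingType)^o)
  (range (tens_inl AE)) (tens_inr AE @` OE).
Proof.
apply/seteqP; split=> [_ [n [a [x [Ox ->]]]]|_ [n [c [v [hc hv ->]]]]].
  exists n, (fun j => tens_inl AE (a j)), (fun j => tens_inr AE (x j)).
  by split=> [j|j|//]; [exists (a j) | exists (x j)].
have /choice[a ha] j : exists a, c j = tens_inl AE a.
  by have [a _ <-] := hc j; exists a.
have /choice[x hx] j : exists x, OE x /\ v j = tens_inr AE x.
  by have [x Ox <-] := hv j; exists x.
exists n, a, x; split=> [j|]; first by case: (hx j).
by apply: eq_bigr => j _; rewrite ha; case: (hx j) => _ ->.
Qed.

Lemma tens_int_tens a x : OE x -> AO (tens AE a x).
Proof. by move=> Ox; exists 1%N, (fun=> a), (fun=> x); rewrite big_ord1. Qed.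

Lemma tens_int_ind (P : set AE) : P 0 -> (forall x y, P x -> P y -> P (x + y)) ->
  (forall a x, OE x -> P (tens AE a x)) -> AO `<=` P.
Proof.
move=> P0 PD Pt _ [n [a [x [Ox ->]]]].
by apply: (big_ind P) => // j _; apply: Pt.
Qed.

Lemma tens_ind (P : set AE) : P 0 -> (forall x y, P x -> P y -> P (x + y)) ->
  (forall a x, P (tens AE a x)) -> forall r, P r.
Proof.
move=> P0 PD Pt r; have [n [a [x ->]]] := tens_ring_sums r.
by apply: (big_ind P) => // j _; apply: Pt.
Qed.

Lemma tens_int_subring : is_subring AO.
Proof.
have OED : forall x y, AO x -> AO y -> AO (x + y).
  by rewrite tens_intE => x y; apply: (@span_overD _ (AE : comNzRingType)^o).
have O0 : AO 0 by rewrite tens_intE; apply: (@span_over0 _ (AE : comNzRingType)^o).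
have subO := laurent_int_subring k; split.
- by rewrite -(rmorph1 (tens_inl AE)) -tens1r; apply: tens_int_tens;
  apply: is_subring1.
- move=> x y Ox Oy; apply: (OED) => //; move: y Oy.
  apply: (@tens_int_ind (fun y => AO (- y))).
  + by rewrite oppr0.
  + by move=> x' y Ox' Oy; rewrite opprD; apply: OED.
  by move=> a z Oz; rewrite /tens -mulNr -rmorphN; apply: tens_int_tens.
move=> x y Ox Oy; move: x Ox; apply: (@tens_int_ind (fun x => AO (x * y))).
- by rewrite mul0r.
- by move=> x x' Ox Ox'; rewrite mulrDl; apply: OED.
move=> a z Oz; move: y Oy; apply: (@tens_int_ind (fun y => AO (tens AE a z * y))).
- by rewrite mulr0.
- by move=> x x' Ox Ox'; rewrite mulrDr; apply: OED.
by move=> a' z' Oz'; rewrite -tensM; apply: tens_int_tens; apply: is_subringM.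
Qed.

Lemma tens_bounded r : exists c, AO (tens AE 1 (lvar k ^+ c) * r).
Proof.
have subO := laurent_int_subring k; have subAO := tens_int_subring.
move: r; apply: (@tens_ind (fun r => exists c, AO (tens AE 1 (lvar k ^+ c) * r))).
- by exists 0%N; rewrite mulr0; apply: is_subring0.
- move=> x y [c cx] [d dy]; exists (c + d)%N; rewrite mulrDr exprD.
  apply: is_subringD => //.
    rewrite -[1]mulr1 tensM mulrAC; apply: is_subringM => //.
    by apply: tens_int_tens; apply: is_subringX (laurent_int_var k).
  rewrite -[1]mulr1 tensM -mulrA; apply: is_subringM => //.
  by apply: tens_int_tens; apply: is_subringX (laurent_int_var k).
move=> a x; have [c cx] := laurent_bounded x; exists c.
by rewrite -tensM mul1r; apply: tens_int_tens.
Qed.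

Lemma tens_bounded_fin (I : finType) (r : I -> AE) :
  exists c, forall j, AO (tens AE 1 (lvar k ^+ c) * r j).
Proof.
have [c hc] := choice (fun j => tens_bounded (r j)).
exists (\sum_j c j)%N => j; rewrite (bigD1 j) //= addnC exprD -[1]mulr1 tensM -mulrA.
apply: (is_subringM tens_int_subring) (hc j).
by apply: tens_int_tens; apply: is_subringX (laurent_int_subring k) _ _ (laurent_int_var k).
Qed.

(** * A (x) O_E as a finite algebra over k[[t]][X] *)

Section Noetherian.
Variable a : A.
Hypothesis a_nonconst : ~ exists c, a = coord_const C c.

(** The map k[[t]][X] -> A (x) E sending X to a (x) 1. Since A is finite over F[a], A (x) O_E is
    finite over its image. *)
Let th : {rmorphism {poly pseries k} -> AE} :=
  horner_eval (tens_inl AE a) \o map_poly (tens_inr AE \o @FracField.tofrac _).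

Let thAO : range th `<=` AO.
Proof.
have subAO := tens_int_subring.
move=> _ [p _ <-] /=; rewrite /horner_eval horner_coef; apply: is_subring_sum =>
  // j _.
rewrite coef_map /= mulrC -rmorphXn -/(tens _ _ _); apply: tens_int_tens.
by eexists.
Qed.

Let noeth : noetherian {poly pseries k}.
Proof.
apply: hilbert_basis => I idI; have [f fI] := pseries_principal idI.
exists [:: f]; rewrite fI; apply/seteqP; split=> [_ [r ->]|].
  by apply: (@span_over_gen _ (pseries k)^o) => //=; rewrite inE.
apply: (@span_over_ind _ (pseries k)^o).
- by exists 0; rewrite mul0r.
- by move=> _ _ [x ->] [y ->]; exists (x + y); rewrite mulrDl.
by move=> c x _ /=; rewrite inE => /eqP->; exists c.
Qed.

Lemma tens_int_generators : exists s : seq AE,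
  AO = span_over (M := (AE : comNzRingType)^o) (range th) [set` s].
Proof.
have subAO := tens_int_subring.
have [s hs] := coord_ring_finite a_nonconst.
have sAO x : x \in [seq tens_inl AE y | y <- s] -> AO x.
  move=> /mapP[y _ ->]; rewrite -tens1r; apply: tens_int_tens.
  exact: is_subring1 (laurent_int_subring k).
exists [seq tens_inl AE y | y <- s]; apply/seteqP; split; last first.
  apply: (@span_over_ind _ (AE : comNzRingType)^o).
  - exact: is_subring0.
  - by move=> x y; apply: is_subringD.
  by move=> c x /thAO Oc /= /sAO Ox; apply: is_subringM.
apply: tens_int_ind.
- exact: (@span_over0 _ (AE : comNzRingType)^o).
- exact: (@span_overD _ (AE : comNzRingType)^o).
move=> y x [f _ <-]; have [p ->] := hs y.
rewrite /tens rmorph_sum mulr_suml.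
apply: (@span_over_sum _ (AE : comNzRingType)^o) => j _.
rewrite rmorphM mulrAC; apply: (@span_over_gen _ (AE : comNzRingType)^o);
  last first.
  by rewrite /= map_f // mem_nth.
exists (map_poly (@psC k \o i) (p j) * f%:P) => //.
rewrite rmorphM /= /horner_eval map_polyC hornerC; congr (_ * _).
rewrite -horner_map /=; congr (_.[_]); apply/polyP => n.
rewrite !coef_map /= coef_map_id0 /= ?rmorph0 //.
by rewrite -/(cE _) -tens_const.
Qed.

Lemma tens_int_noetherian (N : lmodType AE) (g : seq N) (X : set N) :
  X 0 -> (forall x y, X x -> X y -> X (x + y)) ->
  (forall b x, AO b -> X x -> X (b *: x)) ->
  X `<=` span_over AO [set` g] ->
  exists s : seq N, X = span_over AO [set` s].
Proof.
move=> X0 XD XM Xg; have [t ht] := tens_int_generators.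
have [||s Xs] := @noetherian_submodule _ _ th N
    [seq b *: x | b <- t, x <- g] X noeth X0 XD.
- by move=> b x Xx; apply: XM => //; apply: thAO; exists b.
- apply: subset_trans Xg _; apply: span_over_ind.
  + exact: span_over0.
  + exact: span_overD.
  move=> c x + xg; rewrite ht; move: c;
    apply: (@span_over_ind _ (AE : comNzRingType)^o
    _ _ (fun c => span_over (range th) [set` [seq b *: x | b <- t,
      x <- g]] (c *: x))).
  + by rewrite scale0r; apply: span_over0.
  + by move=> c d hc hd; rewrite scalerDl; apply: span_overD.
  move=> b c hb ct; rewrite -scalerA; apply: span_over_gen => //.
  by apply/allpairsP; exists (c, x).
exists s; rewrite {1}Xs; apply/seteqP; split.
  exact: span_over_sub.
apply: span_over_ind; [by rewrite -Xs | by rewrite -Xs |].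
move=> b x Ob xs; rewrite -Xs; apply: XM => //; rewrite Xs.
by apply: span_over_incl => //; exists 1; rewrite ?rmorph1.
Qed.

(** The f-power torsion of A (x) O_E is finitely generated, so one exponent kills it. A general y is
    moved into A (x) O_E by a power of t, which is invertible in A (x) E. *)
Lemma tens_torsion_bounded (f : AE) :
  exists B, forall K y, f ^+ K * y = 0 -> f ^+ B * y = 0.
Proof.
have subAO := tens_int_subring.
pose X : set ((AE : comNzRingType)^o) := [set y | AO y /\ exists K, f ^+ K * y = 0].
have up K K' y : f ^+ K * y = 0 -> f ^+ (K + K') * y = 0.
  by rewrite addnC exprD -mulrA => ->; rewrite mulr0.
have [||||s Xs] := @tens_int_noetherian (AE : comNzRingType)^o [:: 1] X.
- by split; [apply: is_subring0 | exists 0%N; rewrite mulr0].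
- move=> x y [Ox [K Kx]] [Oy [K' Ky]]; split; first exact: is_subringD.
  by exists (K + K')%N; rewrite mulrDr up // addnC up // addr0.
- move=> b x Ob [Ox [K Kx]]; split; first exact: is_subringM.
  by exists K; rewrite mulrCA Kx mulr0.
- move=> x [Ox _]; rewrite -[x]mulr1; apply: span_over_gen => //=.
  by rewrite inE.
have [B hB] : exists B, forall x, x \in s -> f ^+ B * x = 0.
  have : forall x, x \in s -> X x.
    by move=> x xs; rewrite Xs; apply: span_over_incl => //; apply: is_subring1.
  elim: (s) => [|x s' IH] hx; first by exists 0%N.
  have [_ [K Kx]] := hx x (mem_head _ _).
  have [|B hB] := IH; first by move=> y ys; apply: hx; rewrite inE ys orbT.
  exists (K + B)%N => y; rewrite inE => /orP[/eqP->|/hB]; first exact: up.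
  by rewrite addnC; apply: up.
exists B => K y Ky; have [c Oy] := tens_bounded y.
have : X (tens AE 1 (lvar k ^+ c) * y).
  by split=> //; exists K; rewrite mulrCA Ky mulr0.
rewrite Xs => h.
have : f ^+ B * (tens AE 1 (lvar k ^+ c) * y) = 0.
  move: h; move: (_ * y); apply: (@span_over_ind _ (AE : comNzRingType)^o _ _
    (fun z => f ^+ B * z = 0)) => [|x z ex ez|b x _ /hB ex].
  - by rewrite mulr0.
  - by rewrite mulrDr ex ez addr0.
  - by rewrite /GRing.scale /= mulrCA ex mulr0.
have tt : tens AE 1 (lvar k ^- c) * tens AE 1 (lvar k ^+ c) = 1.
  by rewrite -tensM mulr1 mulVf ?expf_neq0 ?lvar_neq0 // tens1l rmorph1.
by move=> e; rewrite -[y]mul1r -tt -mulrA mulrCA e mulr0.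
Qed.

End Noetherian.

(* In a shortest expression of x modulo A (x) O_E as a sum of tensors a_j (x) y_j,
   the y_j are F-independent modulo O_E; an F-linear chi : E -> F killing O_E and
   all y_j but y_0, with chi(y_0) = 1, maps x to a_0, so a_0 lies in every l^n. *)
Lemma tens_int_closed (l : set A) (x : AE) : is_maximal_ideal l ->
  (forall N, exists n, (N <= n)%N /\ exists z w, [/\ AO z,
    lpowAE l n w & x = z + w]) ->
  AO x.
Proof.
move=> maxl hx; have subO := laurent_int_subring k; have subAO := tens_int_subring.
pose P n := `[< exists (a : 'I_n -> A) (y : 'I_n -> E),
  AO (x - \sum_j tens AE (a j) (y j)) >].
have exP : exists n, P n.
  have [n [a [y e]]] := tens_ring_sums x; exists n; apply/asboolP; exists a, y.
  by rewrite {1}e subrr; apply: is_subring0.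
case: (ex_minnP exP) => -[|n] /asboolP[a [y hay]] min.
  by move: hay; rewrite big_ord0 subr0.
suff /min : P n by rewrite ltnn.
move: hay; rewrite big_ord_recl => hay.
pose U : set E := [set u | exists c : 'I_n -> F, exists2 o, OE o &
  u = \sum_j cE (c j) * y (lift ord0 j) + o].
case: (pselect (U (y ord0))) => [[c [o Oo y0]]|nU].
  apply/asboolP; exists (fun j => a (lift ord0 j) + cc (c j) * a ord0),
    (fun j => y (lift ord0 j)).
  have -> : \sum_j tens AE (a (lift ord0 j) + cc (c j) * a ord0) (y (lift ord0 j)) =
      tens AE (a ord0) (y ord0) - tens AE (a ord0) o +
      \sum_j tens AE (a (lift ord0 j)) (y (lift ord0 j)).
    rewrite y0 tensDr addrK tens_sum_r -big_split; apply: eq_bigr => j _.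
    by rewrite tens_const_r tensDl addrC.
  set S := \sum_j _ in hay *.
  have -> : x - (tens AE (a ord0) (y ord0) - tens AE (a ord0) o + S) =
    x - (tens AE (a ord0) (y ord0) + S) + tens AE (a ord0) o by ring.
  by apply: is_subringD => //; apply: tens_int_tens.
have [||||chi [chiD chiM chiU chi1]] := @linear_functional F E cE U (y ord0).
- exists (fun=> 0), 0; first exact: is_subring0.
  by rewrite addr0 big1 // => j _; rewrite rmorph0 mul0r.
- move=> _ _ [c [o Oo ->]] [c' [o' Oo' ->]].
  exists (fun j => c j + c' j), (o + o'); first exact: is_subringD.
  by rewrite addrACA -big_split; congr (_ + _); apply: eq_bigr => j _;
    rewrite rmorphD mulrDl.
- move=> d _ [c [o Oo ->]]; exists (fun j => d * c j), (cE d * o).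
    by apply: is_subringM => //; apply: laurent_const_int.
  by rewrite mulrDr mulr_sumr; congr (_ + _); apply: eq_bigr => j _;
    rewrite rmorphM mulrA.
- by [].
(* h is id (x) chi; being A-linear, it carries l^m (A (x) E) into l^m. *)
have [|||h hE _] := @tens_univ _ _ _ _ _ AE A (fun a x => cc (chi x) * a).
- by move=> b b' z; rewrite mulrDr.
- by move=> b z z'; rewrite chiD rmorphD mulrDl.
- by move=> c b z; rewrite chiM rmorphM mulrA [cc c * _]mulrC.
have hO z : AO z -> h z = 0.
  move: z; apply: tens_int_ind => [|z z' ez ez'|b z Oz].
  - by rewrite raddf0.
  - by rewrite raddfD ez ez' addr0.
  rewrite hE chiU ?rmorph0 ?mul0r //; exists (fun=> 0), z => //.
  by rewrite big1 ?add0r // => j _; rewrite rmorph0 mul0r.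
have hA b z : h (tens AE b 1 * z) = b * h z.
  move: z; apply: (@tens_ind (fun z => h (tens AE b 1 * z) = b * h z)).
  - by rewrite mulr0 !raddf0 mulr0.
  - by move=> z1 z2 e1 e2; rewrite mulrDr !raddfD e1 e2 mulrDr.
  by move=> b' z'; rewrite -tensM mul1r !hE mulrCA.
have hl m w : lpowAE l m w -> ideal_pow l m (h w).
  have [I0 ID IM] := ideal_pow_ideal l m.
  move: w; apply: (@span_over_ind _ (AE : comNzRingType)^o _ _
    (fun w => ideal_pow l m (h w))).
  - by rewrite raddf0.
  - by move=> u v hu hv; rewrite raddfD; apply: ID.
  move=> c _ _ [b [z [lb _ ->]]]; rewrite /GRing.scale /= mulrCA hA mulrC.
  exact: IM.
have hx0 : h x = a ord0.
  have := hO _ hay; rewrite raddfB raddfD => /eqP; rewrite subr_eq0 => /eqP->.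
  rewrite raddf_sum big1 => [|j _]; first by rewrite hE chi1 rmorph1 mul1r addr0.
  rewrite hE chiU ?rmorph0 ?mul0r //.
  exists (fun j' => if j' == j then 1 else 0), 0; first exact: is_subring0.
  rewrite addr0 (bigD1 j) //= eqxx rmorph1 mul1r big1 ?addr0 // => j' /negPf->.
  by rewrite rmorph0 mul0r.
have a0 : a ord0 = 0.
  apply: (ideal_pow_separated maxl) => N.
  have [m [le [z [w [Oz lw xE]]]]] := hx N; exists m => //.
  by rewrite -hx0 xE raddfD hO // add0r; apply: hl.
apply/asboolP; exists (fun j => a (lift ord0 j)), (fun j => y (lift ord0 j)).
by move: hay; rewrite a0 /tens rmorph0 mul0r add0r.
Qed.

End Tensor.

(** * Lattices in Frobenius spaces *)

Section FrobeniusBound.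
Variables (k : fieldType) (q : nat) (D : frob_space k q).
Hypotheses (q_gt1 : (1 < q)%N)
  (frobD : forall x y : laurent k, (x + y) ^+ q = x ^+ q + y ^+ q).
Local Notation E := (laurent k).
Local Notation OE := (@laurent_int k).
Local Notation t := (lvar k).
Let phi_eta (v : D) : D := frob_phi D (frob_eta v).

Lemma frob_etaD (u v : D) : frob_eta (u + v) = frob_eta u + frob_eta v.
Proof. by have [[+ _] _] := frob_etaP D; apply. Qed.
Lemma frob_etaZ b (v : D) : frob_eta (b *: v) = b ^+ q *: frob_eta v.
Proof. by have [[_ +] _] := frob_etaP D; apply. Qed.

(* If t^c N lies in phi(sigma^* N), then a stable lattice L satisfies
   t^c L <= N: with d least such that t^d L <= N and y in t^d L \ t N one gets
   phi(sigma^* y) in t^(qd - d) N, which forces (q - 1) d <= c. *)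
Lemma frob_lattice_bound (sN sL : seq D) c :
  let N := span_over OE [set` sN] in let L := span_over OE [set` sL] in
  span_over setT N = setT ->
  (forall x, N x -> span_over OE (phi_eta @` N) (t ^+ c *: x)) ->
  (forall x, L x -> L (phi_eta x)) ->
  forall x, L x -> N (t ^+ c *: x).
Proof.
move=> N L spN cN phiL; have subO := laurent_int_subring k.
have tX n : OE (t ^+ n) by apply: is_subringX (laurent_int_var k).
have NZ b v : OE b -> N v -> N (b *: v).
  by apply: span_overZ => x y; apply: is_subringM.
have NX n m v : (n <= m)%N -> N (t ^+ n *: v) -> N (t ^+ m *: v).
  by move=> /subnK <- h; rewrite exprD -scalerA; apply: NZ.
have ex : exists d, `[< forall x, L x -> N (t ^+ d *: x) >].
  have bound v : exists d, N (t ^+ d *: v).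
    have : span_over setT N v by rewrite spN.
    move: v; apply: (@span_over_ind _ _ _ _ (fun v => exists d, N (t ^+ d *: v))).
    - by exists 0%N; rewrite scaler0; apply: span_over0.
    - move=> x y [d Nx] [d' Ny]; exists (d + d')%N; rewrite scalerDr.
      apply: span_overD; first exact: NX (leq_addr _ _) Nx.
      exact: NX (leq_addl _ _) Ny.
    move=> b x _ Nx; have [d Ob] := laurent_bounded b; exists d.
    by rewrite scalerA; apply: NZ.
  have [d hd] : exists d, forall x, x \in sL -> N (t ^+ d *: x).
    elim: (sL) => [|x s [d IH]]; first by exists 0%N.
    have [d' hd'] := bound x; exists (d + d')%N => y; rewrite inE.
    move=> /orP[/eqP->|/IH h]; first exact: NX (leq_addl _ _) hd'.
    exact: NX (leq_addr _ _) h.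
  exists d; apply/asboolP; apply: span_over_ind.
  - by rewrite scaler0; apply: span_over0.
  - by move=> x y hx hy; rewrite scalerDr; apply: span_overD.
  by move=> b x Ob /hd Nx; rewrite scalerA mulrC -scalerA; apply: NZ.
case: (ex_minnP ex) => d /asboolP hd min x Lx; case: (leqP d c) => [dc|cd].
  exact: NX dc (hd _ Lx).
(* From here on the least exponent is d + 1, and c < d + 1 is to be refuted. *)
case: d cd hd min => // d cd hd min; exfalso.
have [x' [Lx' nN]] : exists x', L x' /\ ~ N (t ^+ d *: x').
  apply: contrapT => nex; suff /min : `[< forall x, L x -> N (t ^+ d *: x) >].
    by rewrite ltnn.
  apply/asboolP => z Lz; apply: contrapT => nz; apply: nex.
  by exists z.
have [|lam [lamD lamZ lamN lamy]] := lattice_functional (hd _ Lx').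
  move=> y' Ny' e; apply: nN; suff -> : t ^+ d *: x' = y' by [].
  by apply: (scalerI (lvar_neq0 k)); rewrite -e scalerA -exprS.
set y := t ^+ d.+1 *: x' in lamy.
(* h is the Frobenius twist of lam, integral on the O_E-span of the image of N in sigma^* D. *)
have [|h hE _] := (frob_etaP D).2 E^o (fun v => lam v ^+ q).
  by split=> [u v|b v]; [rewrite lamD frobD | rewrite lamZ exprMn].
pose z := t ^+ d.+1 *: phi_eta x'.
have /cN cz : N z by apply: hd; apply: phiL.
have [s Ss sE] : exists2 s, span_over OE (@frob_eta k q D @` N) s &
    frob_phi D s = t ^+ c *: z.
  move: cz; move: (_ *: z); apply: (@span_over_ind _ _ _ _ (fun z => exists2 s,
    span_over OE (@frob_eta k q D @` N) s & frob_phi D s = z)).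
  - by exists 0; [apply: span_over0 | rewrite linear0].
  - move=> _ _ [s Ss <-] [s' Ss' <-]; exists (s + s'); last by rewrite linearD.
    exact: span_overD.
  move=> b _ Ob [v Nv <-]; exists (b *: frob_eta v); last by rewrite linearZ.
  by apply: span_over_gen => //; exists v.
have hO : OE (h s).
  move: Ss; move: (s); apply: (@span_over_ind _ _ _ _ (fun s => OE (h s))).
  - by rewrite linear0; apply: is_subring0.
  - by move=> u v Ou Ov; rewrite linearD; apply: is_subringD.
  move=> b _ Ob [v Nv <-]; rewrite linearZ /= hE; apply: is_subringM => //.
  by apply: is_subringX => //; apply: lamN.
have cq : (c + d.+1 < d.+1 * q)%N.
  apply: (@leq_trans (d.+1 * 2)); last by rewrite leq_mul2l.
  by rewrite muln2 -addnn -addSn leq_add2r.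
(* Both sides have the same image under phi. By [cq] the exponent is positive, so t divides h
   applied to [frob_eta y], which is lam(y)^q; hence t divides lam(y), against the choice of lam. *)
have ey : frob_eta y = t ^+ (d.+1 * q - (c + d.+1)) *: s.
  apply: (bij_inj (frob_phi_iso D)); rewrite linearZ /= sE /y frob_etaZ linearZ /=.
  rewrite /z !scalerA -exprM -!exprD; congr (t ^+ _ *: _).
  by rewrite subnK // ltnW.
have := congr1 h ey; rewrite linearZ hE /=.
rewrite -(prednK (n := d.+1 * q - _)) ?subn_gt0 // exprS.
set e := (_.-1)%N => lamq.
have [|||z' Oz' e'] := @laurent_pow_var k (lam y) q (t ^+ e * h s).
- by apply: lamN; apply: hd.
- exact: is_subringM.
- by rewrite lamq /GRing.scale /= mulrA.
exact: lamy Oz' e'.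
Qed.

End FrobeniusBound.

(** * A-motives and their reductions modulo powers of l *)

Section Motive.
Variables (F : finFieldType) (C : pointed_curve F) (k : fieldType).
Variables (i : {rmorphism F -> k}) (kappa : {rmorphism coord_ring C -> pseries k}).
Local Notation A := (coord_ring C).
Local Notation E := (laurent k).
Local Notation cc := (coord_const C).
Local Notation cE := (laurent_const i).
Local Notation OE := (@laurent_int k).
Local Notation t := (lvar k).

(** If every kappa(a) with a in l vanished at t = 0, so would the whole ideal they generate. An a
    with kappa(a) a unit is not constant, since a nonzero constant in l would make l all of A. *)
Lemma maximal_ideal_unit_image (l : set A) :
  (forall c : F, kappa (cc c) = psC (i c)) -> is_maximal_ideal l ->
  span_over (M := (pseries k)^o) setT (kappa @` l) = setT ->
  exists a, [/\ l a, ~ (exists c, a = cc c) & exists u, u * kappa a = 1].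
Proof.
move=> hkappa [[l0 lD lM] nl _] span1.
have [a la ka0] : exists2 a, l a & pscoef (kappa a) 0 != 0.
  apply: contrapT => nex.
  have : span_over (M := (pseries k)^o) setT (kappa @` l) 1 by rewrite span1.
  suff s : span_over (M := (pseries k)^o) setT (kappa @` l) `<=`
      [set f | pscoef f 0 = 0] by move/s => /= /eqP; rewrite oner_eq0.
  apply: (@span_over_ind _ (pseries k)^o).
  - exact: pscoef0.
  - by move=> f g /= -> ->; rewrite addr0.
  move=> c _ _ [a la <-] /=; rewrite [LHS]pscoefM0.
  suff -> : pscoef (kappa a) 0 = 0 by rewrite mulr0.
  by apply/eqP; apply: contrapT => /negP ka; apply: nex; exists a.
exists a; split=> //; last exact: ps_inverse.
move=> [c ac]; have c0 : c != 0.
  by apply: contra_neq ka0 => c0; rewrite ac c0 !rmorph0 pscoef0.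
apply: nl; apply/seteqP; split=> // x _.
have -> : x = x * cc c^-1 * a by rewrite ac -mulrA -rmorphM mulVf // rmorph1 mulr1.
exact: lM.
Qed.

Variables (AE : tensor_algebra cc cE) (tau : {rmorphism AE -> AE}).
Hypothesis htau : is_tau tau.
Variable M : Amotive kappa tau.
Local Notation AO := (@tens_int F C k i AE).
Local Notation iota := (mot_iota M).
Local Notation iota' := (mot_twiota M).
Local Notation jM := (jinv kappa iota setT).
Local Notation jgen := (jgen AE kappa).
Local Notation T x := (mot_tau (iota' (mot_eta x))).

Let subAO : is_subring AO := tens_int_subring AE.
Let subO : is_subring OE := laurent_int_subring k.

Lemma jgen_int b : AO (jgen b).
Proof.
apply: is_subringB => //; apply: tens_int_tens; first exact: is_subring1.
by exists (kappa b).
Qed.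

Lemma mot_etaD (x y : M) : mot_eta (x + y) = mot_eta x + mot_eta y.
Proof. by have [[+ _] _] := mot_etaP M; apply. Qed.
Lemma mot_etaZ r (x : M) : mot_eta (r *: x) = tau r *: mot_eta x.
Proof. by have [[_ +] _] := mot_etaP M; apply. Qed.

Lemma jinv_iota (N V : lmodType AE) (f : N -> V) (L : set N) x :
  L x -> jinv kappa f L (f x).
Proof. by move=> Lx; exists 0%N => b _; exists x; rewrite // expr0 scale1r. Qed.

Lemma jinv_lin (N V : lmodType AE) (f : {linear N -> V}) (L : set N) r u v :
  (forall x y, L x -> L y -> L (x + y)) ->
  (forall b x, AO b -> L x -> L (b *: x)) -> (forall x, L x -> L (r *: x)) ->
  jinv kappa f L u -> jinv kappa f L v -> jinv kappa f L (r *: u + v).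
Proof.
move=> LD LM Lr [n hn] [n' hn']; exists (n + n')%N => b nb.
have [x Lx ex] := hn b nb; have [y Ly ey] := hn' b nb.
exists (jgen b ^+ n' *: (r *: x) + jgen b ^+ n *: y).
  by apply: LD; apply: LM; try (apply: is_subringX => //; apply: jgen_int);
    first exact: Lr.
rewrite [RHS]linearD ![f (_ *: _)]linearZ /= -ex -ey scalerDr; congr (_ + _).
  by rewrite !scalerA; congr (_ *: _); rewrite exprD; ring.
by rewrite !scalerA -exprD.
Qed.

Lemma jinv_full_lin (N V : lmodType AE) (f : {linear N -> V}) r u v :
  jinv kappa f setT u -> jinv kappa f setT v -> jinv kappa f setT (r *: u + v).
Proof. exact: jinv_lin. Qed.

Lemma jinv_full0 (N V : lmodType AE) (f : {linear N -> V}) : jinv kappa f setT 0.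
Proof. by rewrite -(linear0 f); apply: jinv_iota. Qed.

Lemma jinv_fullZ (N V : lmodType AE) (f : {linear N -> V}) r u :
  jinv kappa f setT u -> jinv kappa f setT (r *: u).
Proof.
by move=> ju; rewrite -[r *: u]addr0; apply: jinv_full_lin => //; apply: jinv_full0.
Qed.

Lemma mot_tau0 : mot_tau (0 : mot_twfrac M) = 0.
Proof.
have j0 := jinv_full0 iota'.
have := mot_tau_linear 1 j0 j0; rewrite !scale1r addr0 => e.
by apply: (addrI (mot_tau 0)); rewrite -e addr0.
Qed.

Lemma mot_tauZ r u : jinv kappa iota' setT u -> mot_tau (r *: u) = r *: mot_tau u.
Proof.
move=> ju; have := mot_tau_linear r ju (jinv_full0 iota').
by rewrite addr0 mot_tau0 addr0.
Qed.

Lemma mot_tauD u v : jinv kappa iota' setT u -> jinv kappa iota' setT v ->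
  mot_tau (u + v) = mot_tau u + mot_tau v.
Proof. by move=> ju jv; have := mot_tau_linear 1 ju jv; rewrite !scale1r. Qed.

Lemma mot_tau_jinv u : jinv kappa iota' setT u -> jM (mot_tau u).
Proof. by case: (mot_tau_iso M) => + _ _; apply. Qed.

Lemma mot_eta_inl b x : mot_eta (tens AE b 1 *: x : M) = tens AE b 1 *: mot_eta x.
Proof. by rewrite mot_etaZ htau expr1n. Qed.

Lemma tens_varX_int c : AO (tens AE 1 (t ^+ c)).
Proof. by apply: tens_int_tens; apply: is_subringX (laurent_int_var k). Qed.

Lemma tens_var_exprD c d : tens AE 1 (t ^+ (c + d)) = tens AE 1 (t ^+ c) * tens AE 1 (t ^+ d).
Proof. by rewrite -tensM mulr1 exprD. Qed.

Lemma tens_varX_inj c x : tens AE 1 (t ^+ c) * x = 0 -> x = 0.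
Proof.
have e : tens AE 1 (t ^- c) * tens AE 1 (t ^+ c) = 1.
  by rewrite -tensM mulr1 mulVf ?expf_neq0 ?lvar_neq0 // tens1l rmorph1.
by move=> h; rewrite -[x]mul1r -e -mulrA h mulr0.
Qed.

(** Origin of the constant c. Each generator is tau_M(w) for some w; a power of [jgen a] brings w
    into tau^* M, and a power of t brings it into the integral span. Only the exponent of t has to
    be common, because [jgen a] becomes invertible modulo l^n. *)
Lemma tau_image_cokernel (a : A) (X : set M) (s : seq M) :
  ~ (exists c, a = cc c) -> X = span_over AO [set` s] -> span_over setT X = setT ->
  exists c, forall g, g \in s -> exists K y,
    span_over AO (@mot_eta _ _ _ _ _ _ _ M @` X) y /\
    (tens AE 1 (t ^+ c) * jgen a ^+ K) *: iota g = mot_tau (iota' y).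
Proof.
move=> nca Xs Xspan; pose S := span_over AO (@mot_eta _ _ _ _ _ _ _ M @` X).
have SM r u : AO r -> S u -> S (r *: u).
  by apply: span_overZ => x y; apply: is_subringM.
have Sup c d u : S (tens AE 1 (t ^+ c) *: u) -> S (tens AE 1 (t ^+ (d + c)) *: u).
  by rewrite tens_var_exprD -scalerA; apply: SM; apply: tens_varX_int.
have bounded u : exists c, S (tens AE 1 (t ^+ c) *: u).
  have : span_over setT (@mot_eta _ _ _ _ _ _ _ M @` X) u.
    suff -> : span_over setT (@mot_eta _ _ _ _ _ _ _ M @` X) = setT by [].
    apply: (base_change_generated (mot_etaP M)).
    - exact: span_over0.
    - by move=> r x y hx hy; apply: span_overD => //; apply: span_overZ.
    move=> m; have : span_over setT X m by rewrite Xspan.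
    move: m; apply: (@span_over_ind _ _ _ _ (fun m => span_over setT
      (@mot_eta _ _ _ _ _ _ _ M @` X) (mot_eta m))).
    - rewrite -(scale0r (0 : M)) mot_etaZ rmorph0 scale0r; exact: span_over0.
    - by move=> x y hx hy; rewrite mot_etaD; apply: span_overD.
    by move=> r x _ Xx; rewrite mot_etaZ; apply: span_over_gen => //; exists x.
  move: u; apply: (@span_over_ind _ _ _ _ (fun u => exists c,
    S (tens AE 1 (t ^+ c) *: u))).
  - by exists 0%N; rewrite scaler0; apply: span_over0.
  - move=> u v [c hu] [d hv]; exists (d + c)%N; rewrite scalerDr; apply: span_overD.
      exact: Sup.
    by rewrite addnC; apply: Sup.
  move=> r u _ hu; have [c hc] := tens_bounded r; exists c.
  by rewrite scalerA; apply: span_over_gen.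
(* The slack d allows the exponents of different generators to be raised to their sum. *)
have each g : exists c, forall d, exists K y, S y /\
    (tens AE 1 (t ^+ (d + c)) * jgen a ^+ K) *: iota g = mot_tau (iota' y).
  have [w jw wg] : exists2 w, jinv kappa iota' setT w & mot_tau w = iota g.
    by case: (mot_tau_iso M) => _ _; apply; apply: jinv_iota.
  have [K hK] := jw; have [m _ em] := hK a nca; have [c hc] := bounded m.
  exists c => d; exists K, (tens AE 1 (t ^+ (d + c)) *: m); split; first exact: Sup.
  by rewrite linearZ /= -em scalerA mot_tauZ // wg.
suff [c hc] : exists c, forall d g, g \in s -> exists K y, S y /\
    (tens AE 1 (t ^+ (d + c)) * jgen a ^+ K) *: iota g = mot_tau (iota' y).
  by exists c => g gs; apply: (hc 0%N g gs).
elim: (s) => [|g s' [c hc]]; first by exists 0%N.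
have [c' hc'] := each g; exists (c + c')%N => d g'; rewrite inE => /orP[/eqP->|gs].
  by rewrite addnA; apply: hc'.
by rewrite (addnC c) addnA; apply: hc.
Qed.

(** * Bounds and finite generation through an embedding in a free module *)

Section Embedding.
Variables (N : nat) (psi : 'I_N -> M -> AE).
Hypotheses (psi_lin : forall j a x y, psi j (a *: x + y) = a * psi j x + psi j y)
  (psi_inj : forall m, (forall j, psi j m = 0) -> m = 0).

Let psi0 j : psi j 0 = 0.
Proof.
have := psi_lin j 1 0 0; rewrite scaler0 addr0 mul1r => e.
by apply: (addrI (psi j 0)); rewrite -e addr0.
Qed.
Let psiD j x y : psi j (x + y) = psi j x + psi j y.
Proof. by have := psi_lin j 1 x y; rewrite scale1r mul1r. Qed.
Let psiZ j r x : psi j (r *: x) = r * psi j x.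
Proof. by have := psi_lin j r x 0; rewrite !addr0 psi0 addr0. Qed.

(** The vector t^c psi embeds Y in a free module of finite rank over A (x) O_E, where submodules are
    finitely generated; generators of the image lift back to Y. *)
Lemma bounded_submodule_generated (a : A) (Y : set M) c :
  ~ (exists c, a = cc c) -> Y 0 -> (forall x y, Y x -> Y y -> Y (x + y)) ->
  (forall b x, AO b -> Y x -> Y (b *: x)) ->
  (forall j m, Y m -> AO (tens AE 1 (t ^+ c) * psi j m)) ->
  exists s : seq M, Y = span_over AO [set` s].
Proof.
move=> nca Y0 YD YM Yb.
pose Psi m : 'rV[AE]_N := \row_j (tens AE 1 (t ^+ c) * psi j m).
have PsiD x y : Psi (x + y) = Psi x + Psi y.
  by apply/rowP => j; rewrite !mxE psiD mulrDr.
have PsiZ r x : Psi (r *: x) = r *: Psi x.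
  by apply/rowP => j; rewrite !mxE psiZ mulrCA.
have Psi0 : Psi 0 = 0 by apply/rowP => j; rewrite !mxE psi0 mulr0.
have Psi_inj x y : Psi x = Psi y -> x = y.
  move=> e; apply/eqP; rewrite -subr_eq0; apply/eqP; apply: psi_inj => j.
  apply: (@tens_varX_inj c); rewrite -scaleN1r addrC psi_lin mulN1r mulrDr mulrN.
  have := congr1 (fun v : 'rV[AE]_N => v 0 j) e; rewrite !mxE => ->.
  by rewrite addNr.
have [||||s' Xs'] := @tens_int_noetherian _ _ _ _ AE a nca 'rV[AE]_N
    [seq delta_mx 0 j | j <- enum 'I_N] (Psi @` Y).
- by exists 0.
- by move=> _ _ [x Yx <-] [y Yy <-]; exists (x + y); [apply: YD | rewrite PsiD].
- by move=> b _ Ob [x Yx <-]; exists (b *: x); [apply: YM | rewrite PsiZ].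
- move=> _ [m Ym <-]; rewrite [Psi m]row_sum_delta.
  apply: span_over_sum => j _; apply: span_over_gen; first by rewrite mxE;
    apply: Yb.
  by rewrite /= map_f // mem_enum.
have /choice[lft hl] v : exists m, v \in s' -> Y m /\ Psi m = v.
  case: (boolP (v \in s')) => [vs|_]; last by exists 0.
  suff [m Ym mv] : (Psi @` Y) v by exists m.
  by rewrite Xs'; apply: span_over_incl => //; apply: is_subring1.
exists [seq lft v | v <- s']; apply/seteqP; split; last first.
  apply: span_over_ind => // b _ Ob /mapP[v vs ->]; apply: YM => //.
  by case: (hl v vs).
move=> m Ym; have : (Psi @` Y) (Psi m) by exists m.
rewrite Xs' => /span_over_seq[||o Oo e].
- exact: is_subring0.
- by move=> x y; apply: is_subringD.
have -> : m = \sum_j o j *: lft s'`_j.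
  apply: Psi_inj; rewrite e (big_morph Psi PsiD Psi0); apply: eq_bigr => j _.
  by rewrite PsiZ; have [_ ->] := hl s'`_j (mem_nth _ (ltn_ord j)).
apply: span_over_sum => j _; apply: span_over_gen => //=.
by rewrite map_f // mem_nth.
Qed.

(** c' = c1 + c: t^c brings m into X + l^n M, and t^c1 makes the coordinates of X integral. The
    coordinates of m are then handled by [tens_int_closed]. *)
Lemma embedding_bound (l : set A) (X : set M) (s : seq M) c :
  is_maximal_ideal l -> X = span_over AO [set` s] ->
  exists c', forall m, (forall n0, exists2 n, (n0 <= n)%N & exists x u,
      [/\ X x, lpow_mul l n setT u & tens AE 1 (t ^+ c) *: m = x + u]) ->
    forall j, AO (tens AE 1 (t ^+ c') * psi j m).
Proof.
move=> maxl Xs.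
have [c1 hc1] := tens_bounded_fin (fun p : 'I_N * 'I_(size s) => psi p.1 s`_p.2).
have Xb j x : X x -> AO (tens AE 1 (t ^+ c1) * psi j x).
  rewrite Xs => /span_over_seq[||o Oo ->].
  - exact: is_subring0.
  - by move=> y z; apply: is_subringD.
  rewrite (big_morph (psi j) (psiD j) (psi0 j)) mulr_sumr;
    apply: is_subring_sum => // q _.
  by rewrite psiZ mulrCA; apply: is_subringM => //; apply: (hc1 (j, q)).
exists (c1 + c)%N => m hm j; rewrite tens_var_exprD -mulrA -psiZ.
apply: (tens_int_closed maxl) => n0; have [n le [x [u [Xx lu e]]]] := hm n0.
exists n; split=> //; exists (tens AE 1 (t ^+ c1) * psi j x),
  (tens AE 1 (t ^+ c1) * psi j u).
split; [exact: Xb | | by rewrite e psiD mulrDr].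
move: u lu {e}; apply: (@span_over_ind _ _ _ _ (fun u =>
  @lpow_mul F C k i AE l n (AE : comNzRingType)^o setT (tens AE 1 (t ^+ c1) * psi j u))).
- by rewrite psi0 mulr0; apply: span_over0.
- by move=> u v hu hv; rewrite psiD mulrDr; apply: span_overD.
move=> r _ _ [b [y [lb _ ->]]]; rewrite !psiZ [X in lpow_mul _ _ _ X]mulrA.
by apply: span_over_gen => //; exists b, (psi j y).
Qed.

End Embedding.

(** * Reduction modulo a power of l *)

Section Level.
Variables (l : set A) (a : A).
Hypotheses (idl : is_ideal l) (la : l a) (a_nonconst : ~ exists c, a = cc c).
Variable kinv : pseries k.
Hypothesis kinvE : kinv * kappa a = 1.

(* 1 - a/kappa(a) divides 1 - (a/kappa(a))^n. *)
Lemma jgen_inverse_mod n K : exists2 w, AO w &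
  exists z, 1 - w * jgen a ^+ K = tens AE (a ^+ n) 1 * z.
Proof.
pose v := tens AE 1 (kinv%:F : E); pose x := tens AE a (kinv%:F : E).
have Ov : AO v by apply: tens_int_tens; exists kinv.
have Ox : AO x by apply: tens_int_tens; exists kinv.
have vj : - v * jgen a = 1 - x.
  rewrite /jgen mulNr mulrBr -!tensM !mul1r mulr1 -tofracM kinvE tofrac1.
  by rewrite opprB tens1l rmorph1.
pose G := \sum_(s < n) x ^+ s.
have xn : x ^+ n = tens AE (a ^+ n) 1 * tens AE 1 (kinv%:F ^+ n : E).
  by rewrite -tensM mulr1 mul1r /x /tens !rmorphXn -exprMn.
have xG : - v * G * jgen a = 1 - x ^+ n.
  rewrite mulrAC vj -[in RHS](expr1n _ n) subrXX; congr (_ * _).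
  by apply: eq_bigr => s _; rewrite expr1n mul1r.
exists ((- v * G) ^+ K).
  apply: is_subringX => //; apply: is_subringM; rewrite ?mulNr //.
    exact: is_subringN.
  by apply: is_subring_sum => // s _; apply: is_subringX.
rewrite -exprMn xG -{1}(expr1n _ K) subrXX opprB addrCA subrr addr0 xn -mulrA.
by eexists.
Qed.

Lemma lpow_lin (n : nat) (V : lmodType AE) (N : set V) r x y :
  lpow_mul l n N x -> lpow_mul l n N y -> lpow_mul l n N (r *: x + y).
Proof. by move=> lx ly; apply: span_overD => //; apply: span_overZ. Qed.

Lemma lpow0 (n : nat) (V : lmodType AE) (N : set V) : lpow_mul l n N 0.
Proof. exact: span_over0. Qed.

Lemma lpowZ (n : nat) (V : lmodType AE) (N : set V) r x :
  lpow_mul l n N x -> lpow_mul l n N (r *: x).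
Proof. by apply: span_overZ. Qed.

Lemma lpowN (n : nat) (V : lmodType AE) (N : set V) x :
  lpow_mul l n N x -> lpow_mul l n N (- x).
Proof. by move=> lx; rewrite -scaleN1r; apply: lpowZ. Qed.

Lemma lpow_gen (n : nat) (V : lmodType AE) (N : set V) c x :
  ideal_pow l n c -> N x -> lpow_mul l n N (tens AE c 1 *: x).
Proof. by move=> lc Nx; apply: span_over_incl => //; exists c, x. Qed.

Section Quotient.
Variables (n : nat) (D : frob_space k #|F|) (pr : M -> D).
Hypothesis prP : is_frob_quotient l n pr.
Local Notation phi_eta v := (frob_phi D (frob_eta v)).
(** The class of v modulo l^n M[j^-1] is that of x; this relation stands for the isomorphism of M /
    l^n M with M[j^-1] / l^n M[j^-1]. *)
Local Notation cong v x := (lpow_mul l n jM (v - iota x)).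

Let prD x y : pr (x + y) = pr x + pr y. Proof. by case: prP. Qed.
Let prE b x : pr (tens AE 1 b *: x) = b *: pr x. Proof. by case: prP. Qed.
Let prS v : exists m, pr m = v. Proof. by case: prP. Qed.
Let prK m : pr m = 0 <-> lpow_mul l n setT m. Proof. by case: prP. Qed.

Lemma pr0 : pr 0 = 0. Proof. by apply/prK; apply: lpow0. Qed.
Lemma prB x y : pr (x - y) = pr x - pr y.
Proof. by apply/eqP; rewrite eq_sym subr_eq -prD subrK. Qed.
Lemma pr_sum (I : Type) (r : seq I) (P : pred I) (G : I -> M) :
  pr (\sum_(j <- r | P j) G j) = \sum_(j <- r | P j) pr (G j).
Proof. exact: (big_morph pr prD pr0). Qed.
Lemma pr_tens b x m : pr (tens AE b x *: m) = x *: pr (tens AE b 1 *: m).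
Proof. by rewrite tensE -scalerA prE. Qed.

Lemma pr_scale r m m' : pr m = pr m' -> pr (r *: m) = pr (r *: m').
Proof.
move=> e; have /prK h : pr (m - m') = 0 by rewrite prB e subrr.
have /prK := lpowZ r h; rewrite scalerBr prB => /eqP; rewrite subr_eq0.
by move/eqP.
Qed.

Lemma frob_of_cong x x' : cong (T x) x' -> phi_eta (pr x) = pr x'.
Proof. by case: prP => _ _ _ _; apply. Qed.

(* M / l^n M -> M[1/j] / l^n M[1/j] is injective: the clause of is_frob_quotient
   about the structure map, read at m = 0. *)
Lemma pr_iota_eq m m' : lpow_mul l n jM (iota m - iota m') -> pr m = pr m'.
Proof.
move=> h; have e0 : mot_eta (0 : M) = 0.
  by rewrite -(scale0r 0) mot_etaZ rmorph0 scale0r.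
have : cong (T 0) (m - m').
  rewrite e0 linear0 mot_tau0 sub0r; apply: lpowN.
  by rewrite linearB.
move/frob_of_cong; rewrite pr0 prB.
rewrite -[in frob_eta _](scale0r 0) frob_etaZ expr0n.
have -> : (#|F| == 0)%N = false by apply/negbTE; rewrite -lt0n; apply/card_gt0P;
  exists 0.
by rewrite scale0r linear0 => /esym/eqP; rewrite subr_eq0 => /eqP.
Qed.

Lemma cong_unique v m m' : cong v m -> cong v m' -> pr m = pr m'.
Proof.
move=> h h'; apply: pr_iota_eq.
have -> : iota m - iota m' = -1 *: (v - iota m) + (v - iota m').
  by rewrite scaleN1r opprB addrA subrK.
exact: lpow_lin.
Qed.

Lemma congZ r v x : cong v x -> cong (r *: v) (r *: x).
Proof. by move=> h; rewrite linearZ -scalerBr; apply: lpowZ. Qed.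

Lemma congD v x v' x' : cong v x -> cong v' x' -> cong (v + v') (x + x').
Proof. by move=> h h'; rewrite linearD opprD addrACA; apply: span_overD. Qed.

Lemma jgen_cancel m K w z : 1 - w * jgen a ^+ K = tens AE (a ^+ n) 1 * z ->
  pr (w *: (jgen a ^+ K *: m)) = pr m.
Proof.
move=> e; apply/eqP; rewrite eq_sym -subr_eq0 -prB; apply/eqP; apply/prK.
rewrite scalerA -{1}[m]scale1r -scalerBl e -scalerA.
by apply: lpow_gen => //; apply: ideal_pow_exp.
Qed.

(** If (jgen a)^K v = x, then w x represents v, where w inverts (jgen a)^K modulo a^n. As w is
    integral, w x stays in X. *)
Lemma jinv_cong (X : set M) v : (forall b x, AO b -> X x -> X (b *: x)) ->
  jM v -> jinv kappa iota X v -> exists2 x, X x & cong v x.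
Proof.
move=> XM jv [K hK]; have [x Xx ex] := hK a a_nonconst.
have [w Ow [z ez]] := jgen_inverse_mod n K; exists (w *: x); first exact: XM.
have -> : v - iota (w *: x) = tens AE (a ^+ n) 1 *: (z *: v).
  by rewrite linearZ /= -ex !scalerA -ez scalerBl scale1r.
by apply: lpow_gen; [apply: ideal_pow_exp | apply: jinv_fullZ].
Qed.

Lemma T_jinv x : jM (T x).
Proof. by apply: mot_tau_jinv; apply: jinv_iota. Qed.

Lemma T_cong x : exists x', cong (T x) x'.
Proof.
have [//|||x' _ h] := @jinv_cong setT (T x); [exact: T_jinv|exact: T_jinv|].
by exists x'.
Qed.

Lemma T_inl b x : T (tens AE b 1 *: x) = tens AE b 1 *: T x.
Proof. by rewrite mot_eta_inl linearZ mot_tauZ //; apply: jinv_iota. Qed.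

Section Image.
Variables (X : set M) (s : seq M).
Hypotheses (Xs : X = span_over AO [set` s]) (Xspan : span_over setT X = setT).
Hypothesis Xtau : forall y, span_over AO (@mot_eta _ _ _ _ _ _ _ M @` X) y ->
  jinv kappa iota X (mot_tau (iota' y)).

Let XM b x : AO b -> X x -> X (b *: x).
Proof. by rewrite Xs; apply: span_overZ => u v; apply: is_subringM. Qed.
Let XD x y : X x -> X y -> X (x + y).
Proof. by rewrite Xs; apply: span_overD. Qed.
Let X0 : X 0. Proof. by rewrite Xs; apply: span_over0. Qed.

Lemma T_cong_in x : X x -> exists2 x', X x' & cong (T x) x'.
Proof.
move=> Xx; apply: jinv_cong => //; first exact: T_jinv.
apply: Xtau; apply: span_over_incl; first exact: is_subring1.
by exists x.
Qed.

(** Finite over O_E, and not just over A (x) O_E, because A / l^n is finite dimensional over F. *)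
Lemma image_generated : exists s' : seq D, pr @` X = span_over OE [set` s'].
Proof.
have [ts hts] := coord_ring_mod_pow a_nonconst idl la n.
exists [seq pr (tens AE b 1 *: x) | b <- ts, x <- s].
have O1 := is_subring1 subO.
have XO b o x : OE o -> X x -> (pr @` X) (o *: pr (tens AE b 1 *: x)).
  by move=> Oo Xx; exists (tens AE b o *: x); [apply: XM => //;
    apply: tens_int_tens | rewrite pr_tens].
have sX x : x \in s -> X x.
  by move=> xs; rewrite Xs; apply: span_over_incl => //; apply: is_subring1.
apply/seteqP; split; last first.
  apply: span_over_ind.
  - by exists 0; rewrite ?pr0.
  - by move=> _ _ [x Xx <-] [y Xy <-]; exists (x + y); [apply: XD | rewrite prD].
  by move=> o _ Oo /= /allpairsP[[b x] /= [bt xs ->]]; apply: XO => //; apply: sX.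
move=> _ [x + <-]; rewrite Xs; move: x; apply: (@span_over_ind _ _ _ _ (fun x =>
  span_over OE [set` [seq pr (tens AE b 1 *: x) | b <- ts, x <- s]] (pr x))).
- by rewrite pr0; apply: span_over0.
- by move=> x y hx hy; rewrite prD; apply: span_overD.
move=> r x + xs; move: r; apply: tens_int_ind.
- by rewrite scale0r pr0; apply: span_over0.
- by move=> r r' h h'; rewrite scalerDl prD; apply: span_overD.
move=> b o Oo; have [c hc] := hts b.
have -> : pr (tens AE b o *: x) = \sum_j (o * cE (c j)) *: pr (tens AE ts`_j 1 *: x).
  rewrite pr_tens.
  have -> : pr (tens AE b 1 *: x) = pr (tens AE (\sum_j cc (c j) * ts`_j) 1 *: x).
    apply/eqP; rewrite -subr_eq0 -prB -scalerBl /tens -mulrBl -rmorphB; apply/eqP.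
    by apply/prK; apply: lpow_gen.
  rewrite tens1r rmorph_sum scaler_suml pr_sum scaler_sumr; apply: eq_bigr => j _.
  by rewrite -tens1r -tens_const_r pr_tens scalerA mulr1.
apply: span_over_sum => j _; apply: span_over_gen.
  by apply: is_subringM => //; apply: laurent_const_int.
by apply/allpairsP; exists (ts`_j, x); split=> //=; apply: mem_nth.
Qed.

Lemma image_spans : span_over setT (pr @` X) = setT.
Proof.
apply/seteqP; split=> // v _; have [m <-] := prS v.
have : span_over setT X m by rewrite Xspan.
move: m {v}; apply: (@span_over_ind _ _ _ _ (fun m =>
  span_over setT (pr @` X) (pr m))).
- by rewrite pr0; apply: span_over0.
- by move=> x y hx hy; rewrite prD; apply: span_overD.
move=> r x _ Xx; move: r; apply: tens_ind.
- by rewrite scale0r pr0; apply: span_over0.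
- by move=> r r' h h'; rewrite scalerDl prD; apply: span_overD.
move=> b o; rewrite pr_tens; apply: span_over_gen => //.
exists (tens AE b 1 *: x) => //; apply: XM => //.
by apply: tens_int_tens; apply: is_subring1.
Qed.

Lemma image_frob_stable x : X x -> (pr @` X) (phi_eta (pr x)).
Proof.
by move=> /T_cong_in[x' Xx' /frob_of_cong->]; exists x'.
Qed.

Lemma image_integral_model : is_frob_integral_model (pr @` X).
Proof.
split; [exact: image_generated | exact: image_spans |].
apply: span_over_ind.
- by exists 0; rewrite ?pr0 ?linear0.
- move=> y y' [x Xx ex] [x' Xx' ex']; exists (x + x'); first exact: XD.
  by rewrite prD ex ex' linearD.
move=> o _ Oo [_ [x Xx <-] <-]; have [x' Xx' ex'] := image_frob_stable Xx.
exists (tens AE 1 o *: x'); last by rewrite prE ex' linearZ.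
by apply: XM => //; apply: tens_int_tens.
Qed.


Section Cokernel.
Variable c : nat.
Hypothesis hc : forall g, g \in s -> exists K y,
  span_over AO (@mot_eta _ _ _ _ _ _ _ M @` X) y /\
  (tens AE 1 (t ^+ c) * jgen a ^+ K) *: iota g = mot_tau (iota' y).

Local Notation Phi := (span_over OE ((fun v : D => phi_eta v) @` (pr @` X))).

Let PhiZ o v : OE o -> Phi v -> Phi (o *: v).
Proof. by apply: span_overZ => u w; apply: is_subringM. Qed.

(** The multiplier r is part of the statement because Phi is defined as an O_E-span only; its
    stability under A comes from that of X and from [T_inl]. *)
Lemma tau_span_cong y : span_over AO (@mot_eta _ _ _ _ _ _ _ M @` X) y ->
  exists y', cong (mot_tau (iota' y)) y' /\ forall r, AO r -> Phi (pr (r *: y')).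
Proof.
move: y; apply: (@span_over_ind _ _ _ _ (fun y => exists y',
  cong (mot_tau (iota' y)) y' /\ forall r, AO r -> Phi (pr (r *: y')))).
- exists 0; split; first by rewrite !linear0 mot_tau0 addr0; apply: lpow0.
  by move=> r _; rewrite scaler0 pr0; apply: span_over0.
- move=> y z [y' [hy Py]] [z' [hz Pz]]; exists (y' + z'); split.
    by rewrite [iota' _]linearD mot_tauD;
      [apply: congD | apply: jinv_iota | apply: jinv_iota].
  by move=> r Or; rewrite scalerDr prD; apply: span_overD; [apply: Py | apply: Pz].
move=> r _ Or [x Xx <-]; have [x' hx'] := T_cong x; exists (r *: x'); split.
  by rewrite [iota' _]linearZ mot_tauZ; [apply: congZ | apply: jinv_iota].
move=> r' Or'; rewrite scalerA.
have : AO (r' * r) by apply: is_subringM.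
move: (r' * r); apply: (@tens_int_ind _ _ _ _ _ (fun u => Phi (pr (u *: x')))).
- by rewrite scale0r pr0; apply: span_over0.
- by move=> u u' h h'; rewrite scalerDl prD; apply: span_overD.
move=> b o Oo; rewrite pr_tens; apply: PhiZ => //.
apply: span_over_incl; first exact: is_subring1.
exists (pr (tens AE b 1 *: x)); first exists (tens AE b 1 *: x) => //.
  by apply: XM => //; apply: tens_int_tens; apply: is_subring1.
by apply: frob_of_cong; rewrite T_inl; apply: congZ.
Qed.

(** The relation on M is reduced modulo l^n, where w cancels the power of [jgen a]; c is thereby the
    same for all n. *)
Lemma image_cokernel v : (pr @` X) v -> Phi (t ^+ c *: v).
Proof.
move=> [x + <-]; rewrite {1}Xs -prE; move: x; apply: (@span_over_ind _ _ _ _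
  (fun x => Phi (pr (tens AE 1 (t ^+ c) *: x)))).
- by rewrite scaler0 pr0; apply: span_over0.
- by move=> x y hx hy; rewrite scalerDr prD; apply: span_overD.
move=> r g Or gs; have [K [y [Sy ey]]] := hc gs.
have [w Ow [z ez]] := jgen_inverse_mod n K.
have [y' [hy' Py']] := tau_span_cong Sy.
rewrite -(jgen_cancel _ ez).
have -> : w *: (jgen a ^+ K *: (tens AE 1 (t ^+ c) *: (r *: g))) =
    (r * w) *: ((tens AE 1 (t ^+ c) * jgen a ^+ K) *: g).
  by rewrite !scalerA; congr (_ *: _); ring.
rewrite (@pr_scale _ _ y'); first by apply: Py'; apply: is_subringM.
by apply: pr_iota_eq; rewrite linearZ /= ey.
Qed.

Lemma max_model_bound (L : set D) v : is_frob_integral_model L -> L v ->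
  (pr @` X) (t ^+ c *: v).
Proof.
move=> [[sL LE] _ Lphi] Lv; have [sN NE] := image_generated.
rewrite NE; apply: (@frob_lattice_bound _ _ D _ _ sN sL).
- exact: card_finNzRing_gt1.
- by move=> x y; apply: (finfield_exprD cE).
- by rewrite -NE image_spans.
- by rewrite -NE; apply: image_cokernel.
- rewrite -LE => x Lx; apply: Lphi; apply: span_over_incl; first exact: is_subring1.
  by exists x.
by rewrite -LE.
Qed.

End Cokernel.
End Image.

(** * Stability of the maximal Frobenius model under A (x) O_E *)

Section MaxModel.
Variable L : set D.
Hypothesis maxL : is_max_frob_integral_model L.

Let LD u v : L u -> L v -> L (u + v).
Proof. by case: maxL => -[[s ->] _ _] _; apply: span_overD. Qed.
Let LZ o v : OE o -> L v -> L (o *: v).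
Proof.
case: maxL => -[[s ->] _ _] _; apply: span_overZ => x y; exact: is_subringM.
Qed.
Let L0 : L 0. Proof. by case: maxL => -[[s ->] _ _] _; apply: span_over0. Qed.

Lemma max_model_phi v : L v -> L (phi_eta v).
Proof.
move=> Lv; case: maxL => -[_ _ Lphi] _; apply: Lphi; apply: span_over_incl.
  exact: is_subring1.
by exists v.
Qed.

(** L' is L + b L. The type of D carries no action of A, so b acts through lifts to M, which is
    independent of the lift by [pr_scale]. Frobenius commutes with b, so L' is an integral model. *)
Lemma max_model_inl b x : L (pr x) -> L (pr (tens AE b 1 *: x)).
Proof.
have [[[s LE] Lspan Lphi] Lmax] := maxL.
have [lft hl] := choice prS.
pose L' := span_over OE [set` s ++ [seq pr (tens AE b 1 *: lft v) | v <- s]].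
have LL' : L `<=` L'.
  by rewrite LE; apply: span_over_sub => // v /= vs; rewrite mem_cat vs.
have bL y : L (pr y) -> L' (pr (tens AE b 1 *: y)).
  rewrite LE => h; have [||o Oo e] := span_over_seq h.
  - exact: is_subring0.
  - by move=> u v; apply: is_subringD.
  rewrite (@pr_scale _ _ (\sum_j tens AE 1 (o j) *: lft s`_j)); last first.
    by rewrite e pr_sum; apply: eq_bigr => j _; rewrite prE hl.
  rewrite scaler_sumr pr_sum; apply: span_over_sum => j _.
  rewrite scalerA mulrC -scalerA prE; apply: span_over_gen => //=.
  by rewrite mem_cat map_f ?orbT // mem_nth.
have L'D u v : L' u -> L' v -> L' (u + v) by apply: span_overD.
have L'Z o v : OE o -> L' v -> L' (o *: v).
  by apply: span_overZ => u w; apply: is_subringM.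
have phiL' v : L' v -> L' (phi_eta v).
  move: v; apply: (@span_over_ind _ _ _ _ (fun v => L' (phi_eta v))).
  - by rewrite -[in frob_eta _](scale0r 0) frob_etaZ linearZ; apply: L'Z;
      [apply: is_subringX => //; exact: is_subring0 | apply: LL';
        apply: max_model_phi].
  - by move=> u v hu hv; rewrite frob_etaD linearD; apply: L'D.
  move=> o v Oo /=; rewrite mem_cat frob_etaZ linearZ => vs.
  apply: L'Z; first exact: is_subringX.
  have Ls u : u \in s -> L u.
    by move=> us; rewrite LE; apply: span_over_incl => //; apply: is_subring1.
  case/orP: vs => [vs|/mapP[u us ->]].
    by apply: LL'; apply: max_model_phi; apply: Ls.
  have [x' hx'] := T_cong (lft u).
  rewrite (@frob_of_cong _ (tens AE b 1 *: x')); last first.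
    by rewrite T_inl; apply: congZ.
  by apply: bL; rewrite -(frob_of_cong hx') hl; apply: max_model_phi; apply: Ls.
suff L'L : L' `<=` L by move=> Lx; apply: L'L; apply: bL.
apply: Lmax; split; first by eexists.
  apply/seteqP; split=> // v _.
  have : span_over setT L v by rewrite Lspan.
  exact: span_over_sub.
apply: span_over_ind.
- by rewrite linear0; apply: LL'.
- by move=> y y' h h'; rewrite linearD; apply: L'D.
by move=> o _ Oo [v L'v <-]; rewrite linearZ; apply: L'Z => //; apply: phiL'.
Qed.

Lemma max_model_scale r x : AO r -> L (pr x) -> L (pr (r *: x)).
Proof.
move=> + Lx; move: r; apply: tens_int_ind.
- by rewrite scale0r pr0.
- by move=> r r' h h'; rewrite scalerDl prD; apply: LD.
by move=> b o Oo; rewrite pr_tens; apply: LZ => //; apply: max_model_inl.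
Qed.

Lemma max_modelD x y : L (pr x) -> L (pr y) -> L (pr (x + y)).
Proof. by rewrite prD; apply: LD. Qed.

Lemma max_model_tau x r : AO r -> L (pr x) ->
  exists y, cong (mot_tau (iota' (r *: mot_eta x))) y /\ L (pr y).
Proof.
move=> Or Lx; have [x' hx'] := T_cong x; exists (r *: x'); split.
  by rewrite [iota' _]linearZ mot_tauZ; [apply: congZ | apply: jinv_iota].
by apply: max_model_scale => //; rewrite -(frob_of_cong hx'); apply: max_model_phi.
Qed.

(** A representative y of v modulo l^n may depend on n, whereas b, K and m do not; this is how the
    numerators of an element of M[j^-1] are tested at each level. *)
Lemma max_model_jgen v y b K m : cong v y -> L (pr y) ->
  jgen b ^+ K *: v = iota m -> L (pr m).
Proof.
move=> vy Ly e; have <- : pr (jgen b ^+ K *: y) = pr m.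
  apply: (@cong_unique (jgen b ^+ K *: v)); first exact: congZ.
  by rewrite e subrr; apply: lpow0.
by apply: max_model_scale => //; apply: is_subringX => //; apply: jgen_int.
Qed.

End MaxModel.
End Quotient.
End Level.
End Motive.

(** * Comparison of M_O with M' *)

Theorem theorem4p31
  (F : finFieldType) (C : pointed_curve F)
  (k : fieldType) (i : {rmorphism F -> k}) (hk : perfect_field k)
  (kappa : {rmorphism coord_ring C -> pseries k})
  (hkappa : forall c : F, kappa (coord_const C c) = psC (i c))
  (l : set (coord_ring C)) (hl : is_maximal_ideal l)
  (hkl : span_over (M := (pseries k)^o) setT (kappa @` l) = setT)
  (AE : tensor_algebra (@coord_const F C) (laurent_const i))
  (tau : {rmorphism AE -> AE}) (htau : is_tau tau)
  (M : Amotive kappa tau)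
  (MO : set M) (hMO : is_max_integral_model MO)
  (D : nat -> frob_space k #|F|) (pr : forall n : nat, M -> D n)
  (hD : forall n : nat, (0 < n)%N -> is_frob_quotient l n (pr n))
  (L : forall n : nat, set (D n))
  (hL : forall n : nat, (0 < n)%N -> is_max_frob_integral_model (L n))
  (m : M) :
  MO m <->
  exists N : nat, forall n : nat, (0 < n)%N -> (N <= n)%N -> L n (pr n m).
Proof.
have [a [la nca [u ua]]] := maximal_ideal_unit_image hkappa hl hkl.
have [idl _ _] := hl.
have [[[s MOs] MOspan MOtau] MOmax] := hMO.
have MOL n x : (0 < n)%N -> MO x -> L n (pr n x).
  move=> n0 Mx; apply: (proj2 (hL n n0) (pr n @` MO)); last by exists x.
  exact: (image_integral_model idl la nca ua (hD n n0) MOs MOspan MOtau).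
split=> [Mm|]; first by exists 0%N => n n0 _; apply: MOL.
pose M' : set M := [set m | exists N : nat, forall n : nat,
  (0 < n)%N -> (N <= n)%N -> L n (pr n m)].
have MOM' : MO `<=` M' by move=> x Mx; exists 0%N => n n0 _; apply: MOL.
have M'0 : M' 0 by apply: MOM'; rewrite MOs; apply: span_over0.
have M'D x y : M' x -> M' y -> M' (x + y).
  move=> [N hN] [N' hN']; exists (N + N')%N => n n0 le.
  apply: (max_modelD (hD n n0) (hL n n0)).
    by apply: hN => //; apply: leq_trans le; apply: leq_addr.
  by apply: hN' => //; apply: leq_trans le; apply: leq_addl.
have M'M r x : tens_int r -> M' x -> M' (r *: x).
  move=> Or [N hN]; exists N => n n0 le.
  by apply: (max_model_scale htau la nca ua (hD n n0) (hL n n0) Or); apply: hN.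
have [c hc] := tau_image_cokernel nca MOs MOspan.
have MOgen : span_over setT [set` s] = setT.
  apply/seteqP; split=> // x _.
  have : span_over setT MO x by rewrite MOspan.
  apply: span_over_ind; [exact: span_over0 | exact: span_overD |].
  move=> r y _; rewrite MOs => hy; apply: span_overZ => //.
  exact: span_over_sub hy.
have [r lfM] := mot_loc_free M.
have [N [psi [psi_lin psi_inj]]] :=
  locally_free_embedding (tens_torsion_bounded nca) MOgen lfM.
have [c' hc'] := embedding_bound psi_lin c hl MOs.
have [s' M's] : exists s' : seq M, M' = span_over (@tens_int _ _ _ _ AE) [set` s'].
  apply: (bounded_submodule_generated psi_lin psi_inj (c := c') nca) =>
    // j x [N0 hx].
  (* The level has to be positive, at least n0, and at least N0, from where on the class of x lies
     in L_n. *)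
  apply: hc' => n0; exists (n0 + N0).+1; first by apply: leqW; apply: leq_addr.
  set n := (n0 + N0).+1; have n_gt0 : (0 < n)%N by [].
  have Lx : L n (pr n x) by apply: hx => //; apply: leqW; apply: leq_addl.
  have [z MOz] := max_model_bound htau idl la nca ua (hD n n_gt0) MOs MOspan hc
    (proj1 (hL n n_gt0)) Lx.
  have [_ prE _ prK _] := hD n n_gt0; rewrite -prE => ez.
  exists z, (tens AE 1 (lvar k ^+ c) *: x - z); split=> //;
    last by rewrite addrC subrK.
  by apply/prK; rewrite (prB (hD n n_gt0)) ez subrr.
(* M_O is maximal for inclusion, so it is M' itself, containing M_O, that must be shown to be an
   integral model. *)
suff <- : M' = MO by [].
apply: MOmax => //; split; first by exists s'.
  apply/seteqP; split=> // x _.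
  have : span_over setT MO x by rewrite MOspan.
  exact: span_over_sub.
(* The exponent K serves tau_M(y) in M[j^-1] for every nonconstant b; the levels n only have to
   certify that the resulting numerators lie in M'. *)
move=> y hy; have [K hK] := mot_tau_jinv (jinv_iota kappa (mot_twiota M) (L := setT) (x := y) Logic.I).
have [N0 hN0] : exists N0, forall n, (0 < n)%N -> (N0 <= n)%N -> exists2 y',
    lpow_mul l n (jinv kappa (mot_iota M) setT) (mot_tau (mot_twiota M y) - mot_iota M y')
    & L n (pr n y').
  move: y hy {K hK}; apply: (@span_over_ind _ _ _ _ (fun y => exists N0, forall n,
    (0 < n)%N -> (N0 <= n)%N -> exists2 y',
    lpow_mul l n (jinv kappa (mot_iota M) setT) (mot_tau (mot_twiota M y) - mot_iota M y')
    & L n (pr n y'))).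
  - exists 0%N => n n0 _; exists 0; first by rewrite !linear0 mot_tau0 addr0;
    apply: lpow0.
    by apply: MOL => //; rewrite MOs; apply: span_over0.
  - move=> y z [N1 h1] [N2 h2]; exists (N1 + N2)%N => n n0 le.
    have [y' hy' Ly'] := h1 n n0 (leq_trans (leq_addr _ _) le).
    have [z' hz' Lz'] := h2 n n0 (leq_trans (leq_addl _ _) le).
    exists (y' + z'); last exact: (max_modelD (hD n n0) (hL n n0)).
    rewrite [mot_twiota M _]linearD mot_tauD; first exact: congD.
      exact: jinv_iota.
    exact: jinv_iota.
  move=> b _ Ob [x [N1 h1] <-]; exists N1 => n n0 le.
  have [y' [hy' Ly']] := max_model_tau htau la nca ua (hD n n0) (hL n n0) Ob (h1 n n0 le).
  by exists y'.
exists K => b nb; have [x _ ex] := hK b nb; exists x => //.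
exists N0 => n n0 le; have [y' hy' Ly'] := hN0 n n0 le.
exact: (max_model_jgen htau la nca ua (hD n n0) (hL n n0) hy' Ly' ex).
Qed.
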